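(* Let $m,q\ge 1$, $m+q=n+1$, let $K\subset\mathbb{R}^m$ be a convex body and let $C=K\times\mathbb{R}^q\subset\mathbb{R}^{n+1}$. Then for every volume $v>0$ there exists an isoperimetric region of volume $v$ in $C$, and isoperimetric regions in $C$ are bounded.
   Context: A convex body is a compact convex set with non-empty interior. For measurable $E\subset C$, $|E|$ denotes the $(n+1)$-dimensional Hausdorff (Lebesgue) measure, called volume. The relative perimeter of $E$ in the interior of $C$ is $P_C(E)=\sup\{\int_E \operatorname{div}\xi\, dH^{n+1} : \xi \text{ smooth vector field with compact support in } \operatorname{int}(C),\ |\xi|\le 1\}$. The isoperimetric profile is $I_C(v)=\inf\{P_C(E): E\subset C,\ |E|=v\}$, and $E\subset C$ is an isoperimetric region if $P_C(E)=I_C(|E|)$. Sets are identified when they differ by a null set; an isoperimetric region is always represented by a closed set that includes its points of density one and contains no points of density zero. *)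

(* Defs.v *)
From HB Require Import structures.
From mathcomp Require Import all_boot all_order all_algebra.
From mathcomp Require Import all_classical all_reals all_analysis.

Set Implicit Arguments.
Unset Strict Implicit.
Unset Printing Implicit Defensive.

Import Order.TTheory GRing.Theory Num.Theory.
Import numFieldNormedType.Exports.

Local Open Scope classical_set_scope.
Local Open Scope ring_scope.

(* The product sigma-algebra on R^N, generated by the coordinate functions;
   it coincides with the Borel sigma-algebra. *)

Definition rV_display : measure_display.
Proof. exact: default_measure_display. Qed.

Section measurable_rV.
Context {R : realType} {N : nat}.

Definition rV_coord (i : 'I_N) (x : 'rV[R]_N) : measurableTypeR R := x ord0 i.

Let rV_set0 : g_sigma_preimage rV_coord set0.
Proof. exact: sigma_algebra0. Qed.

Let rV_setC A : g_sigma_preimage rV_coord A -> g_sigma_preimage rV_coord (~` A).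
Proof. exact: sigma_algebraC. Qed.

Let rV_bigcup (F : _^nat) : (forall i, g_sigma_preimage rV_coord (F i)) ->
  g_sigma_preimage rV_coord (\bigcup_i (F i)).
Proof. exact: sigma_algebra_bigcup. Qed.

HB.instance Definition _ := @isMeasurable.Build rV_display
  'rV[R]_N (g_sigma_preimage rV_coord) rV_set0 rV_setC rV_bigcup.

Lemma measurable_rV_coord (i : 'I_N) : measurable_fun setT (rV_coord i).
Proof.
move=> _ Y mY; rewrite setTI; apply: sub_sigma_algebra => /=.
rewrite -bigcup_seq/=; exists i => /=; first by rewrite mem_index_enum.
by exists Y => //; rewrite setTI.
Qed.

Lemma measurable_fun_rV d (T : measurableType d) (f : T -> 'rV[R]_N) :
  (forall i, measurable_fun setT (rV_coord i \o f)) -> measurable_fun setT f.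
Proof.
move=> mf _ A mA; rewrite setTI.
suff : g_sigma_preimage (fun i => rV_coord i \o f) `<=` measurable.
  by rewrite g_sigma_preimage_comp; apply; exists A => //; rewrite setTI.
apply: smallest_sub; first exact: sigma_algebra_measurable.
move=> B; rewrite -bigcup_seq => -[i _ [Y mY <-]]; exact: mf.
Qed.

End measurable_rV.

Section lebesgue_rV.
Context {R : realType}.

Definition rV_cons N (p : measurableTypeR R * 'rV[R]_N) : 'rV[R]_N.+1 :=
  row_mx (p.1 : R)%:M p.2 : 'rV[R]_(1 + N).

Definition rV_uncons N (x : 'rV[R]_N.+1) : measurableTypeR R * 'rV[R]_N :=
  (x ord0 ord0, \row_i x ord0 (lift ord0 i)).

Lemma rV_consK N : cancel (@rV_cons N) (@rV_uncons N).
Proof.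
move=> [a y]; rewrite /rV_cons /rV_uncons /=; congr pair.
  have -> : (ord0 : 'I_N.+1) = lshift N (ord0 : 'I_1) by exact/val_inj.
  by rewrite (@row_mxEl _ 1 1 N) mxE eqxx mulr1n.
apply/rowP => i; rewrite mxE.
have -> : lift ord0 i = rshift 1 i by exact/val_inj.
by rewrite (@row_mxEr _ 1 1 N).
Qed.

Lemma measurable_rV_cons N : measurable_fun setT (@rV_cons N).
Proof.
apply: measurable_fun_rV => i.
case: (@split_ordP 1 N i) => j ->.
  rewrite (_ : _ \o _ = fst); first exact: measurable_fst.
  by apply/funext => p /=; rewrite /rV_coord /rV_cons (@row_mxEl _ 1 1 N) !ord1 mxE.
rewrite (_ : _ \o _ = rV_coord j \o snd).
  exact: measurableT_comp (measurable_rV_coord j) measurable_snd.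
by apply/funext => p /=; rewrite /rV_coord /rV_cons (@row_mxEr _ 1 1 N).
Qed.

Lemma measurable_rV_uncons N : measurable_fun setT (@rV_uncons N).
Proof.
apply: measurable_fun_pair; first exact: measurable_rV_coord.
apply: measurable_fun_rV => i.
rewrite (_ : _ \o _ = rV_coord (lift ord0 i)); first exact: measurable_rV_coord.
by apply/funext => x /=; rewrite /rV_coord mxE.
Qed.

Section prod_step.
Variables (N : nat) (mu : {sigma_finite_measure set 'rV[R]_N -> \bar R}).
Local Open Scope ereal_scope.

Definition lebesgue_rV_step : set 'rV[R]_N.+1 -> \bar R :=
  pushforward (@lebesgue_measure R \x mu) (@rV_cons N).

Let step0 : lebesgue_rV_step set0 = 0.
Proof. by rewrite /lebesgue_rV_step /pushforward preimage_set0 measure0. Qed.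

Let step_ge0 A : 0 <= lebesgue_rV_step A.
Proof. by rewrite /lebesgue_rV_step /pushforward; exact: measure_ge0. Qed.

Let step_sigma_additive : semi_sigma_additive lebesgue_rV_step.
Proof.
apply: measure_semi_sigma_additive.
exact: measurable_rV_cons.
Qed.

HB.instance Definition _ := isMeasure.Build _ _ _ lebesgue_rV_step
  step0 step_ge0 step_sigma_additive.

Let step_sigma_finite : sigma_finite setT lebesgue_rV_step.
Proof.
have /sigma_finiteP[A [TA ndA Aoo]] := sigma_finiteT (@lebesgue_measure R).
have /sigma_finiteP[B [TB ndB Boo]] := sigma_finiteT mu.
exists (fun k => @rV_uncons N @^-1` (A k `*` B k)).
  rewrite -preimage_bigcup -[LHS](preimage_setT (@rV_uncons N)).
  congr (_ @^-1` _); rewrite -setXTT TA TB predeqE => -[x y]; split.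
    move=> [/= [n _ Anx] [k _ Bky]]; exists (maxn n k) => //; split.
      by move: x Anx; exact/subsetPset/ndA/leq_maxl.
    by move: y Bky; exact/subsetPset/ndB/leq_maxr.
  by move=> [n _ []/= ? ?]; split; exists n.
move=> k; have [mA Ak] := Aoo k; have [mB Bk] := Boo k.
split.
  rewrite -[X in measurable X]setTI; apply: measurable_rV_uncons => //.
  exact: measurableX.
rewrite /lebesgue_rV_step /pushforward -comp_preimage.
rewrite (_ : _ \o _ = id) ?preimage_id; last exact/funext/rV_consK.
by rewrite product_measure1E// lte_mul_pinfty// ge0_fin_numE.
Qed.

HB.instance Definition _ := Measure_isSigmaFinite.Build _ _ _ lebesgue_rV_step
  step_sigma_finite.

End prod_step.

(* Lebesgue measure on the Borel sets of R^N, as an iterated product. *)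
Fixpoint borel_lebesgue_rV N : {sigma_finite_measure set 'rV[R]_N -> \bar R} :=
  match N with
  | 0 => \d_(0 : 'rV[R]_0)
  | M.+1 => lebesgue_rV_step (borel_lebesgue_rV M)
  end.


(* Its completion, on the Caratheodory (that is, Lebesgue) measurable sets.  The
   underlying set function is the Lebesgue outer measure, total on sets. *)
Definition lebesgue_rV_type N :=
  caratheodory_type (mu_ext (borel_lebesgue_rV N)).

HB.instance Definition _ N := Measurable.on (lebesgue_rV_type N).

Definition lebesgue_rV N : set (lebesgue_rV_type N) -> \bar R :=
  @completed_measure_extension _ _ _ (borel_lebesgue_rV N).

HB.instance Definition _ N := Measure.on (@lebesgue_rV N).

Definition lebesgue_measurable N (E : set 'rV[R]_N) : Prop :=
  measurable (E : set (lebesgue_rV_type N)).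

Definition volume N (E : set 'rV[R]_N) : \bar R := @lebesgue_rV N E.

End lebesgue_rV.

Section euclidean.
Context {R : realType} {N : nat}.
Implicit Types (x y : 'rV[R]_N) (E C : set 'rV[R]_N).

(* The library norm on matrices is the sup norm, hence the explicit formula. *)
Definition enorm x : R := Num.sqrt (\sum_i (x ord0 i) ^+ 2).

Definition eball x (r : R) : set 'rV[R]_N := [set y | enorm (y - x) < r].

Definition partial (i : 'I_N) (f : 'rV[R]_N -> R) : 'rV[R]_N -> R :=
  'D_(delta_mx ord0 i) f.

Fixpoint is_Ck (k : nat) (f : 'rV[R]_N -> R) : Prop :=
  match k with
  | 0 => continuous f
  | k'.+1 => (forall x, differentiable f x) /\
             (forall i, is_Ck k' (partial i f))
  end.

Definition smooth_field (xi : 'rV[R]_N -> 'rV[R]_N) : Prop :=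
  forall (i : 'I_N) (k : nat), is_Ck k (fun x => xi x ord0 i).

Definition divergence (xi : 'rV[R]_N -> 'rV[R]_N) x : R :=
  \sum_i partial i (fun y => xi y ord0 i) x.

Definition field_support (xi : 'rV[R]_N -> 'rV[R]_N) : set 'rV[R]_N :=
  closure [set x | xi x != 0].

Definition test_field C (xi : 'rV[R]_N -> 'rV[R]_N) : Prop :=
  [/\ smooth_field xi, compact (field_support xi), field_support xi `<=` interior C
    & forall x, enorm (xi x) <= 1].

Definition perimeter C E : \bar R :=
  ereal_sup [set (\int[@lebesgue_rV R N]_(x in E) (divergence xi x)%:E)%E
            | xi in test_field C].

Definition isoperimetric_profile C (v : \bar R) : \bar R :=
  ereal_inf [set perimeter C E
            | E in [set E | [/\ lebesgue_measurable E, E `<=` C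
                              & volume E = v]]].

Definition isoperimetric_region C E : Prop :=
  [/\ lebesgue_measurable E, E `<=` C, (volume E < +oo)%E
    & perimeter C E = isoperimetric_profile C (volume E)].

Definition has_density E x (theta : R) : Prop :=
  fine (volume (E `&` eball x r)) / fine (volume (eball x r))
    @[r --> 0^'+] --> theta.

(* F is the closed set standing for the class of E modulo null sets. *)
Definition represents E (F : set 'rV[R]_N) : Prop :=
  [/\ volume (E `+` F) = 0%E, closed F,
      forall x, has_density F x 1 -> F x
    & forall x, has_density F x 0 -> ~ F x].

Definition convex_body (K : set 'rV[R]_N) : Prop :=
  [/\ compact K, convex_set (K : set (convex_lmodType 'rV[R]_N))
    & interior K !=set0].

End euclidean.

Definition cylinder {R : realType} {m : nat} (q : nat) (K : set 'rV[R]_m) :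
    set 'rV[R]_(m + q) :=
  [set x | K (lsubmx x)].

Arguments cylinder {R m} q K.

(* Main.v *)
Require Import Defs.
From HB Require Import structures.
From mathcomp Require Import all_boot all_order all_algebra.
From mathcomp Require Import all_classical all_reals all_analysis.
From mathcomp Require Import ring lra measurable_realfun.

Set Implicit Arguments.
Unset Strict Implicit.
Unset Printing Implicit Defensive.

Import Order.TTheory GRing.Theory Num.Theory.
Import numFieldNormedType.Exports.

Local Open Scope classical_set_scope.
Local Open Scope ring_scope.

(** The domain C = K x R^q is convex, is mapped into itself by contractions of any of
   the last q coordinates, and is cobounded under its translations.

   Testing the perimeter against constant fields times cutoffs gives
   |{x in E : x + h in C \ E}| <= const |h| P(E).  Averaging over |h| < d yields the
   basic nonlocal estimate: a part of E, every point of which sees a definite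
   proportion of the complement at scale d, has volume at most const d P(E).  It plays
   the role of the relative isoperimetric inequality, and also shows that, up to an
   error const d P(E), a set of finite perimeter is a union of cells of size d;
   choosing the cells along an ultrafilter gives compactness in L^1_loc.

   Stretching one of the last q coordinates shows I(w) >= (w/v) I(v) for w <= v.
   A minimizing sequence of volume v, translated so as not to vanish, converges locally
   to a set of some volume v1 in ]0, v].  Cutting along a large sphere, the part lost at
   infinity costs at least (1 - v1/v) I(v), so that the limit has perimeter at most
   (v1/v) I(v), and stretching it to volume v gives a minimizer.

   The linear bound on the profile also makes a minimizer E almost minimal among its
   subsets: P(E) <= P(E \ F) + (P(E)/v) |F|.  A De Giorgi iteration on concentric balls
   then shows that E has a uniform volume in every small ball centered at its support,
   which is therefore bounded. *)

(** * Affine changes of variables *)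

(** The obstacle is the loss of volume at infinity. A homothety would leave [C], so lost volume can
    only be restored by stretching along the axis, which multiplies the volume by some s and the
    perimeter by at most s. The resulting bound on the profile is merely linear, but the factors
    v1/v of the loss and v/v1 of the restoration cancel exactly. For boundedness a linear bound
    alone is too weak. The gain comes from scale: a set of small density at scale s has volume at
    most const s times its perimeter, and in the iteration s shrinks together with the width of the
    shells. Perimeters are handled through upper bounds ([perim_le]), so that every comparison of
    sets is a construction of test fields: pulled back for stretching, mixed by a cutoff for
    cutting. Slicing by spheres is done by a bisection that finds a radius around which, at
    arbitrarily small scales, volume grows no faster than on average; one such radius serves all
    test fields at once. The arguments run on Borel sets, to which Lebesgue measurable sets reduce
    by removing a null set. *)

Lemma ex_scaled_pushforward d d' (T1 : measurableType d) (T2 : measurableType d')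
    (R : realType) (m : {measure set T1 -> \bar R}) (f : T1 -> T2) (c : R) :
  measurable_fun setT f -> 0 <= c ->
  exists nu : {measure set T2 -> \bar R},
    forall A, nu A = (c%:E * m (f @^-1` A))%E.
Proof.
move=> mf c0.
unshelve eexists (mscale (NngNum c0) (pushforward m f : {measure set T2 -> \bar R})).
  exact: mf.
by move=> A; rewrite /mscale.
Qed.

Lemma le_of_eq disp (T : porderType disp) (x y : T) : x = y -> (x <= y)%O.
Proof. by move=> ->. Qed.

Section boxes.
Context {R : realType}.

Definition box N (J : 'I_N -> set R) : set 'rV[R]_N :=
  [set x | forall i, J i (x ord0 i)].

Lemma measurable_box N (J : 'I_N -> set R) :
  (forall i, measurable (J i : set (measurableTypeR R))) -> measurable (box J).
Proof.
move=> mJ.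
have -> : box J = \bigcap_(i in [set: 'I_N]) (rV_coord i @^-1` J i).
  apply/seteqP; split => x /= Jx; first by move=> i _; exact: Jx.
  by move=> i; exact: (Jx i Logic.I).
apply: fin_bigcap_measurable => //.
move=> i _; rewrite -[X in measurable X]setTI.
exact: measurable_rV_coord.
Qed.

Local Open Scope ereal_scope.

Lemma borel_lebesgue_box N (J : 'I_N -> set R) :
  (forall i, measurable (J i : set (measurableTypeR R))) ->
  borel_lebesgue_rV N (box J) = \prod_i (lebesgue_measure (J i)).
Proof.
elim: N J => [|N IH] J mJ.
  rewrite big_ord0 /= diracE.
  by rewrite (_ : (0%R : 'rV[R]_0) \in box J) //; apply/mem_set => -[].
rewrite big_ord_recl /= /lebesgue_rV_step /pushforward.
have -> : rV_cons (N:=N) @^-1` box J =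
    (J ord0 : set (measurableTypeR R)) `*` box (fun i => J (lift ord0 i)).
  apply/seteqP; split => -[a y] /= H.
    split => [|i].
      have := H ord0; rewrite /rV_cons /=.
      have -> : (ord0 : 'I_N.+1) = lshift N (ord0 : 'I_1) by exact/val_inj.
      by rewrite (@row_mxEl _ 1 1 N) mxE eqxx mulr1n.
    have := H (lift ord0 i); rewrite /rV_cons /=.
    have -> : lift ord0 i = rshift 1 i by exact/val_inj.
    by rewrite (@row_mxEr _ 1 1 N).
  move=> i; case: H => H0 H1; case: (@split_ordP 1 N i) => j ->.
    rewrite /rV_cons (@row_mxEl _ 1 1 N) !ord1 mxE eqxx mulr1n /=.
    by have -> : lshift N (ord0 : 'I_1) = ord0 by exact/val_inj.
  rewrite /rV_cons (@row_mxEr _ 1 1 N) /=.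
  have -> : rshift 1 j = lift ord0 j by exact/val_inj.
  exact: H1.
rewrite product_measure1E//; last exact: measurable_box.
by rewrite IH.
Qed.

Lemma lebesgue_measure_affine (a b : R) (J : set (measurableTypeR R)) :
  (0 < a)%R -> measurable J ->
  lebesgue_measure ((fun x => a * x + b)%R @^-1` J) =
  (a^-1)%:E * lebesgue_measure J.
Proof.
move=> a0 mJ.
have a00 : (0 <= a)%R by exact: ltW.
pose f : measurableTypeR R -> measurableTypeR R := fun x => (a * x + b)%R.
have mf : measurable_fun setT f.
  apply: measurable_funD; last exact: measurable_cst.
  exact: measurable_funM.
have [nu nuE] : exists nu : {measure set (measurableTypeR R) -> \bar R},
    forall A, nu A = a%:E * lebesgue_measure (f @^-1` A).
  exact: ex_scaled_pushforward.
have H : lebesgue_measure J = nu J.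
  apply: lebesgue_measure_unique => // _ [[u v]] _ <-.
  rewrite nuE.
  have -> : f @^-1` `]u, v] = `]((u - b) / a)%R, ((v - b) / a)%R]%classic.
    apply/seteqP; split => x; rewrite /f /= !in_itv /= => /andP[H1 H2]; apply/andP; split.
    - by rewrite ltr_pdivrMr// ltrBlDr mulrC.
    - by rewrite ler_pdivlMr// lerBrDr mulrC.
    - by move: H1; rewrite ltr_pdivrMr// ltrBlDr mulrC.
    - by move: H2; rewrite ler_pdivlMr// lerBrDr mulrC.
  rewrite !lebesgue_measure_itv /= !lte_fin ltr_pM2r ?invr_gt0// ltrD2r.
  case: ifPn => _; last by rewrite mule0.
  by rewrite -!EFinD -EFinM; congr EFin; field; exact: lt0r_neq0.
rewrite H nuE muleA -EFinM mulVf ?mul1e //; exact: lt0r_neq0.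
Qed.

End boxes.

Section affine.
Context {R : realType} {N : nat}.
Local Notation mu := (borel_lebesgue_rV N).

(** Diagonal maps send boxes to boxes, and they include the changes of variables of the proof:
    translations, homotheties and stretching of one coordinate. *)
Definition aff (d h x : 'rV[R]_N) : 'rV[R]_N :=
  \row_i (d ord0 i * x ord0 i + h ord0 i).

Lemma measurable_aff d h : measurable_fun setT (aff d h).
Proof.
apply: measurable_fun_rV => i.
rewrite (_ : _ \o _ = fun x => d ord0 i * rV_coord i x + h ord0 i); last first.
  by apply/funext => x /=; rewrite /rV_coord mxE.
apply: measurable_funD; last exact: measurable_cst.
apply: measurable_funM; first exact: measurable_cst.
exact: measurable_rV_coord.
Qed.

Local Open Scope ereal_scope.

Let boxes : set (set 'rV[R]_N) := [set A | exists2 J : 'I_N -> set R,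
  (forall i, measurable (J i : set (measurableTypeR R))) & A = box J].

Lemma boxes_generate : @measurable _ 'rV[R]_N = <<s boxes >>.
Proof.
apply/seteqP; split.
  apply: smallest_sub; first exact: smallest_sigma_algebra.
  move=> B; rewrite -bigcup_seq => -[i _ [Y mY <-]].
  apply: sub_sigma_algebra; rewrite setTI.
  exists (fun j => if j == i then Y else setT).
    by move=> j; case: ifP => _ //; exact: measurableT.
  apply/seteqP; split => x /=.
    by move=> Yx j; case: eqP => // ->.
  by move=> /(_ i); rewrite eqxx.
apply: smallest_sub; first exact: sigma_algebra_measurable.
by move=> _ [J mJ ->]; exact: measurable_box.
Qed.

(** Uniqueness of measures on the intersection-stable class of boxes, where the formula is a product
    of one-dimensional ones; the cubes [G n] give the exhaustion by sets of finite measure. *)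
Lemma borel_lebesgue_affine (d h : 'rV[R]_N) (A : set 'rV[R]_N) :
  (forall i, 0 < d ord0 i)%R -> measurable A ->
  mu (aff d h @^-1` A) = (\prod_i (d ord0 i)^-1)%R%:E * mu A.
Proof.
move=> d0 mA.
pose c := (\prod_i d ord0 i)%R.
have c0 : (0 < c)%R by exact: prodr_gt0.
have c00 := ltW c0.
have [nu nuE] : exists nu : {measure set 'rV[R]_N -> \bar R},
    forall A, nu A = c%:E * mu (aff d h @^-1` A).
  exact: (ex_scaled_pushforward mu (measurable_aff d h)).
suff : mu A = nu A.
  move=> ->; rewrite nuE muleA -EFinM prodfV.
  by rewrite mulVf ?mul1e //; exact: lt0r_neq0.
have Hbox J : (forall i, measurable (J i : set (measurableTypeR R))) ->
    mu (box J) = nu (box J).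
  move=> mJ; rewrite nuE.
  have -> : aff d h @^-1` box J =
      box (fun i => (fun x => d ord0 i * x + h ord0 i)%R @^-1` J i).
    by apply/seteqP; split => x /= H i; have := H i; rewrite mxE.
  rewrite !borel_lebesgue_box//; last first.
    move=> i; rewrite -[X in measurable X]setTI.
    have : measurable_fun setT (fun x : measurableTypeR R =>
        (d ord0 i * x + h ord0 i)%R : measurableTypeR R).
      apply: measurable_funD; last exact: measurable_cst.
      exact: measurable_funM.
    by apply.
  under [in RHS]eq_bigr do rewrite lebesgue_measure_affine//.
  rewrite big_split /= prodEFin muleA -EFinM prodfV mulfV ?mul1e//.
  exact: lt0r_neq0.
pose G n : set 'rV[R]_N := box (fun _ => `[(- n%:R)%R, n%:R]%classic).
apply: (@measure_unique _ _ _ boxes G) => //.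
- exact: boxes_generate.
- move=> _ _ [J mJ ->] [J' mJ' ->]; exists (fun i => J i `&` J' i).
    by move=> i; exact: measurableI.
  apply/seteqP; split => x /=; first by move=> [H H'] i.
  by move=> H; split => i; case: (H i).
- by move=> n; exists (fun _ => `[(- n%:R)%R, n%:R]%classic).
- apply/seteqP; split => // x _.
  have [n Hn] : exists n : nat, forall i, (`|x ord0 i| <= n%:R)%R.
    exists (Num.bound (\sum_i `|x ord0 i|)%R) => i.
    apply: (@le_trans _ _ (\sum_i `|x ord0 i|)%R).
      by rewrite (bigD1 i)//= lerDl sumr_ge0.
    by rewrite ltW// archi_boundP// sumr_ge0.
  by exists n => // i /=; rewrite in_itv/= -ler_norml.
- by move=> _ [J mJ ->]; exact: Hbox.
- move=> n.
  apply: (@le_lt_trans _ _ (\prod_(i < N)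
      lebesgue_measure (`[(- n%:R)%R, n%:R%R]%classic : set R))).
    by apply: le_of_eq; exact: borel_lebesgue_box.
  rewrite big_const.
  rewrite (_ : lebesgue_measure _ = (2 * n%:R)%:E).
    elim: #|_| => [|k IH] /=; first by rewrite ltry.
    by rewrite lte_mul_pinfty// ltry.
  rewrite lebesgue_measure_itv /= lte_fin.
  case: ifPn => H; first by rewrite -EFinD; congr EFin; lra.
  have n0 := ler0n R n.
  by congr EFin; lra.
Qed.

End affine.

(** * Balls *)

Section lebesgue_space.
Context {R : realType} {N : nat}.
Local Notation mu := (borel_lebesgue_rV N).
Implicit Types (x y h : 'rV[R]_N) (e r : R) (A E : set 'rV[R]_N).

Lemma rV_ballP x e y : 0 < e ->
  ball x e y <-> forall i, `|x ord0 i - y ord0 i| < e.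
Proof.
move=> e0; split => [[_ H] i|H]; first exact: H.
by split => // i j; rewrite (ord1 i); exact: H.
Qed.

Lemma rV_ball_box x e : 0 < e ->
  ball x e = box (fun i => `](x ord0 i - e), (x ord0 i + e)[%classic).
Proof.
move=> e0; apply/seteqP; split => y.
  by move=> /(rV_ballP _ _ e0) H i /=; rewrite in_itv/=; move: (H i); rewrite ltr_norml => /andP[? ?]; apply/andP; split; lra.
move=> H; apply/(rV_ballP _ _ e0) => i; have := H i; rewrite /= in_itv/= ltr_norml => /andP[? ?]; apply/andP; split; lra.
Qed.

Lemma measurable_rV_ball x e : measurable (ball x e).
Proof.
have [e0|e0] := ltP 0 e; first by rewrite rV_ball_box//; exact: measurable_box.
rewrite (_ : ball x e = set0) //; apply/seteqP; split => // y [e1 _].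
by move: e0; rewrite leNgt e1.
Qed.

Lemma borel_lebesgue_ball x e : 0 < e -> mu (ball x e) = ((2 * e) ^+ N)%:E.
Proof.
move=> e0; rewrite rV_ball_box// borel_lebesgue_box//.
transitivity (\prod_(i < N) (2 * e)%:E)%E; last first.
  by rewrite prodEFin prodr_const card_ord.
apply: eq_bigr => i _; rewrite lebesgue_measure_itv /= lte_fin.
by rewrite ifT -?EFinD; [congr EFin; lra|lra].
Qed.

Lemma rV_coord_le_norm x i : `|x ord0 i| <= `|x|.
Proof.
rewrite [leRHS]/Num.norm /= mx_normrE; apply/bigmax_geP; right => /=.
by exists (ord0, i).
Qed.

Lemma rV_norm_leP x e : 0 <= e -> (forall i, `|x ord0 i| <= e) -> `|x| <= e.
Proof.
move=> e0 H; rewrite [leLHS]/Num.norm /= mx_normrE; apply/bigmax_leP; split => //.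
by move=> [i j] _ /=; rewrite (ord1 i).
Qed.

(** Rational centers and radii make the balls countable. The factor [c] leaves room around the small
    ball for the support of a cutoff, and for passing between the sup norm and the Euclidean
    norm. *)
Lemma rat_ball_dense A x (c : R) : 1 <= c -> open A -> A x ->
  exists p : 'rV[rat]_N * nat,
    ball (\row_i ratr (p.1 ord0 i) : 'rV[R]_N) (p.2.+1%:R^-1 : R) x /\
    ball (\row_i ratr (p.1 ord0 i) : 'rV[R]_N) (c * p.2.+1%:R^-1 : R) `<=` A.
Proof.
move=> c1 oA Ax; have c0 : 0 < c by rewrite (lt_le_trans _ c1).
have [e e0 He] : exists2 e : R, 0 < e & ball x e `<=` A.
  by have /nbhs_ballP[e /= e0 ?] := open_nbhs_nbhs (conj oA Ax); exists e.
have [n Hn] : exists n : nat, n.+1%:R^-1 < e / 2 / c.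
  have /ltr_add_invr : 0 < e / 2 / c by rewrite !divr_gt0.
  by move=> [k]; rewrite add0r; exists k.
have n0 : (0 : R) < n.+1%:R^-1 by rewrite invr_gt0.
have cn0 : (0 : R) < c * n.+1%:R^-1 by rewrite mulr_gt0.
have cn : n.+1%:R^-1 <= c * n.+1%:R^-1 by rewrite ler_peMl// ltW.
have /boolp.choice[q Hq] : forall i, exists q : rat, `|ratr q - x ord0 i| < n.+1%:R^-1.
  move=> i.
  have [q] := rat_in_itvoo (ltr_pwDr n0 (lexx (x ord0 i))).
  rewrite in_itv/= => /andP[q1 q2]; exists q.
  by rewrite ltr_distl q2 andbT (lt_trans _ q1)// ltrBlDr ltrDl.
exists ((\row_i q i), n); split; last first.
  move=> y /= /(rV_ballP _ _ cn0) H; apply: He; apply/(rV_ballP _ _ e0) => i.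
  have := H i; have := Hq i; rewrite !mxE => H1 H2.
  rewrite (le_lt_trans (ler_distD (ratr (q i)) _ _))//.
  move: Hn; rewrite ltr_pdivlMr// mulrC => Hn.
  rewrite (splitr e) ltrD//; last exact: (lt_trans H2).
  by rewrite distrC (lt_trans H1)// (le_lt_trans cn).
by apply/(rV_ballP _ _ n0) => i; rewrite !mxE.
Qed.

Lemma open_rV_measurable A : open A -> measurable A.
Proof.
move=> oA.
pose Q (p : 'rV[rat]_N * nat) : set 'rV[R]_N :=
  ball (\row_i ratr (p.1 ord0 i) : 'rV[R]_N) (p.2.+1%:R^-1 : R).
have -> : A = \bigcup_(p in [set p | Q p `<=` A]) Q p.
  apply/seteqP; split => x; last by move=> [p]; apply.
  move=> Ax; have [p [xp pA]] := rat_ball_dense (lexx 1) oA Ax.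
  by exists p => //; rewrite mul1r in pA.
rewrite bigcup_mkcond; apply: countable_bigcupT_measurable => //.
by move=> p; case: ifPn => _ //; exact: measurable_rV_ball.
Qed.

Lemma closed_rV_measurable A : closed A -> measurable A.
Proof.
move=> cA; rewrite -(setCK A); apply: measurableC; apply: open_rV_measurable.
exact: closed_openC.
Qed.

Lemma continuous_rV_measurable (f : 'rV[R]_N -> R) :
  continuous f -> measurable_fun setT f.
Proof.
move=> cf; apply: (measurability _ (RGenOpens.measurableE R)) => //.
move=> _ [_ [a [b ->] <-]]; rewrite setTI.
by apply: open_rV_measurable; apply: open_comp => // x _; exact: cf.
Qed.

Lemma aff1E h x : aff (const_mx 1) h x = x + h.
Proof. by apply/rowP => i; rewrite !mxE mul1r. Qed.

Lemma borel_lebesgue_shift h A : measurable A ->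
  mu ((fun x => x + h) @^-1` A) = mu A.
Proof.
move=> mA; have -> : (fun x => x + h) = aff (const_mx 1) h.
  by apply/funext => x; rewrite aff1E.
rewrite borel_lebesgue_affine//; last by move=> i; rewrite mxE.
by rewrite big1 ?mul1e// => i _; rewrite mxE invr1.
Qed.

Lemma measurable_shift h : measurable_fun setT (fun x => x + h).
Proof.
rewrite (_ : (fun x => x + h) = aff (const_mx 1) h); first exact: measurable_aff.
by apply/funext => x; rewrite aff1E.
Qed.

Lemma measurable_preshift h A : measurable A ->
  measurable ((fun x => x + h) @^-1` A).
Proof.
by move=> mA; rewrite -[X in measurable X]setTI; exact: measurable_shift.
Qed.

Lemma mu_bounded_fin A x r : A `<=` ball x r -> measurable A ->
  (mu A < +oo)%E.
Proof.
have [r0|r0] := ltP 0 r.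
  move=> Ar mA; apply: (@le_lt_trans _ _ (mu (ball x r))).
    by apply: le_measure => //; rewrite inE //; exact: measurable_rV_ball.
  by rewrite borel_lebesgue_ball// ltry.
move=> Ar _; rewrite (_ : A = set0) ?measure0 ?ltry//.
by apply/seteqP; split => // y /Ar [r1 _]; move: r0; rewrite leNgt r1.
Qed.

End lebesgue_space.

(** * Borel kernels and the completion *)

Section completion.
Context {R : realType} {N : nat}.
Local Notation mu := (borel_lebesgue_rV N).
Local Notation nu := (@lebesgue_rV R N).
Implicit Types (A E : set 'rV[R]_N).

Lemma lebesgue_of_borel A : measurable A -> lebesgue_measurable A.
Proof. exact: caratheodory_measurable_mu_ext. Qed.

Lemma lebesgue_measurableD A E :
  lebesgue_measurable A -> lebesgue_measurable E -> lebesgue_measurable (A `\` E).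
Proof.
move=> mA mE.
exact: (@measurableD _ (lebesgue_rV_type N) A E mA mE).
Qed.

Lemma volume_borel A : measurable A -> volume A = mu A.
Proof. exact: measurable_mu_extE. Qed.

Lemma le_volume A E : A `<=` E -> (volume A <= volume E)%E.
Proof. exact: le_mu_ext. Qed.

Lemma volume_ge0 A : (0 <= volume A)%E.
Proof. exact: mu_ext_ge0. Qed.

Lemma le_volumeU A E : (volume (A `|` E) <= volume A + volume E)%E.
Proof. exact: (outer_measureU2 (mu_ext mu) A E). Qed.

Lemma volumeU_null A E : volume A = 0%E -> volume E = 0%E -> volume (A `|` E) = 0%E.
Proof.
move=> A0 E0; apply/eqP; rewrite eq_le volume_ge0 andbT.
by have := le_volumeU A E; rewrite A0 E0 adde0.
Qed.

(** [volume] is an outer measure, so [A] is arbitrary here: covers optimal up to 1/(n+1) are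
    intersected. *)
Lemma borel_hull A : (volume A < +oo)%E ->
  exists G, [/\ measurable G, A `<=` G & mu G = volume A].
Proof.
move=> Afin.
have Afn : volume A \is a fin_num by rewrite ge0_fin_numE// volume_ge0.
have H n : exists G, [/\ measurable G, A `<=` G &
    (mu G <= volume A + n.+1%:R^-1%:E)%E].
  have n0 : (0 : R) < n.+1%:R^-1 by rewrite invr_gt0.
  have [_ [F [mF AF] <-] HF] := lb_ereal_inf_adherent n0 Afn.
  exists (\bigcup_k F k); split => //; first exact: bigcupT_measurable.
  apply: le_trans (ltW HF).
  by apply: measure_sigma_subadditive => //; exact: bigcupT_measurable.
have [G HG] := boolp.choice H.
have mG : measurable (\bigcap_n G n).
  by apply: bigcapT_measurable => n; have [] := HG n.
have AG : A `<=` \bigcap_n G n by move=> x Ax n _; have [_ + _] := HG n; apply.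
exists (\bigcap_n G n); split => //.
apply/eqP; rewrite eq_le; apply/andP; split; last first.
  by rewrite -volume_borel//; exact: le_volume.
apply/lee_addgt0Pr => e e0.
have [n Hn] : exists n : nat, n.+1%:R^-1 < e.
  by have /ltr_add_invr := e0; move=> [k]; rewrite add0r; exists k.
have [mGn _ HGn] := HG n.
apply: (@le_trans _ _ (mu (G n))).
  by apply: le_measure; rewrite ?inE//; exact: bigcap_inf.
by rewrite (le_trans HGn)// leeD// lee_fin ltW.
Qed.

(** Inside the ball [B n], removing a Borel hull of [B n \ E] leaves a Borel subset of [E]; working
    in balls keeps the measures finite, so that they can be subtracted. This is the passage from
    Lebesgue measurable sets to Borel ones, where Tonelli and pushforwards apply. *)
Lemma borel_kernel E : lebesgue_measurable E ->
  exists A, [/\ measurable A, A `<=` E & volume (E `\` A) = 0%E].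
Proof.
move=> mE.
pose B n : set 'rV[R]_N := ball 0 n.+1%:R.
have mB n : measurable (B n) by exact: measurable_rV_ball.
have lB n : lebesgue_measurable (B n) by exact: lebesgue_of_borel.
have Bfin n : (volume (B n) < +oo)%E.
  rewrite volume_borel//; exact: (@mu_bounded_fin _ _ _ 0 n.+1%:R).
have H n : exists G, [/\ measurable G, B n `\` E `<=` G & mu G = volume (B n `\` E)].
  by apply: borel_hull; apply: le_lt_trans (Bfin n); exact: le_volume.
have [G HG] := boolp.choice H.
exists (\bigcup_n (B n `\` G n)); split.
- by apply: bigcupT_measurable => n; apply: measurableD => //; have [] := HG n.
- move=> x [n _ [Bx Gx]]; apply: contrapT => Ex; apply: Gx.
  by have [_ + _] := HG n; apply.
have N0 n : volume (G n `\` (B n `\` E)) = 0%E.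
  have [mG BG GE] := HG n.
  have lG : lebesgue_measurable (G n) by exact: lebesgue_of_borel.
  have lBE : lebesgue_measurable (B n `\` E) by exact: lebesgue_measurableD.
  have vG : (volume (G n) < +oo)%E.
    rewrite volume_borel// GE; apply: le_lt_trans (Bfin n); exact: le_volume.
  rewrite /volume (measureD lG lBE vG) setIidr//.
  rewrite -[LHS]/(volume (G n) - volume (B n `\` E))%E volume_borel// GE subee// ge0_fin_numE ?volume_ge0//.
  by apply: le_lt_trans (Bfin n); exact: le_volume.
have sub : E `\` \bigcup_n (B n `\` G n) `<=` \bigcup_n (G n `\` (B n `\` E)).
  move=> x [Ex NUx].
  have [n Hn] : exists n : nat, `|x| < n.+1%:R.
    exists (Num.bound `|x|); rewrite (lt_le_trans (archi_boundP _))//.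
    by rewrite ler_nat.
  exists n => //; have Bx : B n x by rewrite /B -ball_normE /= sub0r normrN.
  split; last by case.
  by apply: contrapT => Gx; apply: NUx; exists n.
apply/eqP; rewrite eq_le volume_ge0 andbT.
apply: (le_trans (le_volume sub)).
apply: (le_trans (outer_measure_sigma_subadditive (mu_ext mu) _)).
rewrite eseries0// => n _ _; exact: N0.
Qed.

(** The identity from the completed space to the Borel one is measurable and pushes the completed
    measure forward to [mu], which transfers integrals of Borel functions. *)
Let id_leb : lebesgue_rV_type (R:=R) N -> 'rV[R]_N := fun x => x.

Let measurable_id_leb : measurable_fun setT id_leb.
Proof. by move=> _ A mA; rewrite setTI; exact: lebesgue_of_borel. Qed.

Lemma lebesgue_measurable_fun (f : 'rV[R]_N -> \bar R) :
  measurable_fun setT f -> measurable_fun setT (f : lebesgue_rV_type N -> \bar R).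
Proof. by move=> mf; apply: (measurableT_comp mf measurable_id_leb). Qed.

Lemma ge0_integral_lebesgue_borel A (f : 'rV[R]_N -> \bar R) :
  measurable A -> measurable_fun setT f -> (forall x, (0 <= f x)%E) ->
  (\int[nu]_(x in A) f x = \int[mu]_(x in A) f x)%E.
Proof.
move=> mA mf f0.
rewrite -[LHS]/(\int[nu]_(x in id_leb @^-1` A) (f \o id_leb) x)%E.
rewrite -(@ge0_integral_pushforward _ _ _ _ _ id_leb _ nu)//; last first.
  exact: measurable_funTS.
apply: eq_measure_integral => //= B mB _.
by rewrite /pushforward -[LHS]/(volume B) volume_borel.
Qed.

Lemma integral_lebesgue_borel A (f : 'rV[R]_N -> R) :
  measurable A -> measurable_fun setT f ->
  (\int[nu]_(x in A) (f x)%:E = \int[mu]_(x in A) (f x)%:E)%E.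
Proof.
move=> mA mf; rewrite integralE [RHS]integralE.
have mF : measurable_fun setT (EFin \o f) by exact/measurable_EFinP.
congr (_ - _)%E; apply: ge0_integral_lebesgue_borel => //.
- exact: measurable_funepos.
- exact: measurable_funeneg.
Qed.

Lemma integral_lebesgue_kernel A E (f : 'rV[R]_N -> R) :
  measurable A -> lebesgue_measurable E -> A `<=` E ->
  volume (E `\` A) = 0%E -> measurable_fun setT f ->
  (\int[nu]_(x in E) (f x)%:E = \int[mu]_(x in A) (f x)%:E)%E.
Proof.
move=> mA mE AE E0 mf; rewrite -integral_lebesgue_borel//.
have lA := lebesgue_of_borel mA.
have lf : measurable_fun setT (EFin \o f : lebesgue_rV_type N -> \bar R).
  by apply: lebesgue_measurable_fun; exact/measurable_EFinP.
have mEA : lebesgue_measurable (E `\` A) by exact: lebesgue_measurableD.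
rewrite integralE [RHS]integralE.
by congr (_ - _)%E; rewrite (ge0_negligible_integral mEA mE)//; rewrite ?setDD ?setIidr//;
  apply: measurable_funTS; [exact: measurable_funepos|exact: measurable_funeneg].
Qed.

Lemma volume_kernel A E : measurable A -> A `<=` E -> volume (E `\` A) = 0%E ->
  volume E = mu A.
Proof.
move=> mA AE E0; rewrite -volume_borel//; apply/eqP; rewrite eq_le (le_volume AE) andbT.
by have := le_volumeU A (E `\` A); rewrite setDUK// E0 adde0.
Qed.

End completion.

(** * Smooth functions *)

Section smooth_real.
Context {R : realType}.
Implicit Types (f g : R -> R).

Fixpoint is_C1k (k : nat) f : Prop :=
  match k with
  | 0 => continuous f
  | k'.+1 => (forall x, derivable f x 1) /\ is_C1k k' (derive1 f)
  end.

Lemma derivable_continuous f : (forall x, derivable f x 1) -> continuous f.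
Proof.
by move=> df x; apply: differentiable_continuous; exact/derivable1_diffP.
Qed.

Lemma is_C1kW k f : is_C1k k.+1 f -> is_C1k k f.
Proof.
elim: k f => [|k IH] f [df Hf]; first exact: derivable_continuous.
by split => //; exact: IH.
Qed.

Lemma is_C1kD k f g : is_C1k k f -> is_C1k k g -> is_C1k k (f \+ g).
Proof.
elim: k f g => [|k IH] f g.
  by move=> cf cg x; exact: (cvgD (cf x) (cg x)).
move=> [df Hf] [dg Hg]; split.
  by move=> x; exact: derivableD.
rewrite (_ : (derive1 (f \+ g)) = (derive1 f) \+ (derive1 g)); first exact: IH.
by apply/funext => x; rewrite /= !derive1E deriveD.
Qed.

Lemma is_C1k_cst k (c : R) : is_C1k k (cst c).
Proof.
elim: k c => [|k IH] c; first by move=> x; exact: cvg_cst.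
split; first by move=> x; exact: derivable_cst.
by rewrite (_ : (derive1 (cst c)) = cst 0) //; apply/funext => x; rewrite derive1_cst.
Qed.

Lemma is_C1kM k f g : is_C1k k f -> is_C1k k g -> is_C1k k (f \* g).
Proof.
elim: k f g => [|k IH] f g.
  by move=> cf cg x; exact: (cvgM (cf x) (cg x)).
move=> Hf Hg; have [[df Hf'] [dg Hg']] := (Hf, Hg); split.
  by move=> x; exact: derivableM.
rewrite (_ : (derive1 (f \* g)) = (f \* (derive1 g)) \+ (g \* (derive1 f))).
  by apply: is_C1kD; apply: IH => //; exact: is_C1kW.
by apply/funext => x; rewrite /= !derive1E deriveM.
Qed.

Lemma is_C1k_comp k f g : is_C1k k f -> is_C1k k g -> is_C1k k (f \o g).
Proof.
elim: k f g => [|k IH] f g.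
  by move=> cf cg x; apply: continuous_comp; [exact: cg|exact: cf].
move=> Hf Hg; have [[df Hf'] [dg Hg']] := (Hf, Hg).
have dfg x : derivable (f \o g) x 1.
  by apply/derivable1_diffP/differentiable_comp; exact/derivable1_diffP.
split => //.
rewrite (_ : (derive1 (f \o g)) = ((derive1 f) \o g) \* (derive1 g)).
  by apply: is_C1kM => //; apply: IH => //; exact: is_C1kW.
by apply/funext => x; rewrite /= derive1_comp.
Qed.

End smooth_real.

Section smooth_rV.
Context {R : realType} {N : nat}.
Implicit Types (f g : 'rV[R]_N -> R) (x v d h : 'rV[R]_N).

Lemma is_CkS_cont f : (forall x, differentiable f x) -> continuous f.
Proof. by move=> df x; exact: differentiable_continuous. Qed.

Lemma is_CkW k f : is_Ck k.+1 f -> is_Ck k f.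
Proof.
elim: k f => [|k IH] f [df Hf]; first exact: is_CkS_cont.
by split => // i; apply: IH; exact: Hf.
Qed.

Lemma partial_cst i (c : R) : partial i (cst c : 'rV[R]_N -> R) = cst 0.
Proof. by apply/funext => x; rewrite /partial derive_cst. Qed.

Lemma is_Ck_cst k (c : R) : is_Ck k (cst c : 'rV[R]_N -> R).
Proof.
elim: k c => [|k IH] c; first by apply: cst_continuous.
split; first by move=> x; exact: differentiable_cst.
by move=> i; rewrite partial_cst.
Qed.

Lemma partialD i f g : (forall x, differentiable f x) ->
  (forall x, differentiable g x) -> partial i (f \+ g) = partial i f \+ partial i g.
Proof.
move=> df dg; apply/funext => x; rewrite /partial /=.
by rewrite deriveD//; exact: diff_derivable.
Qed.

Lemma is_CkD k f g : is_Ck k f -> is_Ck k g -> is_Ck k (f \+ g).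
Proof.
elim: k f g => [|k IH] f g.
  by move=> /= cf cg x; exact: (cvgD (cf x) (cg x)).
move=> [df Hf] [dg Hg]; split.
  by move=> x; exact: differentiableD.
by move=> i; rewrite partialD//; apply: IH; [exact: Hf|exact: Hg].
Qed.

Lemma partialM i f g : (forall x, differentiable f x) ->
  (forall x, differentiable g x) ->
  partial i (f \* g) = (f \* partial i g) \+ (g \* partial i f).
Proof.
move=> df dg; apply/funext => x; rewrite /partial /=.
by rewrite deriveM//; exact: diff_derivable.
Qed.

Lemma is_CkM k f g : is_Ck k f -> is_Ck k g -> is_Ck k (f \* g).
Proof.
elim: k f g => [|k IH] f g.
  by move=> /= cf cg x; exact: (cvgM (cf x) (cg x)).
move=> Hf Hg; have [[df Hf'] [dg Hg']] := (Hf, Hg); split.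
  by move=> x; exact: differentiableM.
move=> i; rewrite partialM//.
apply: is_CkD; apply: IH.
- exact: is_CkW.
- exact: Hg'.
- exact: is_CkW.
- exact: Hf'.
Qed.

Lemma is_Ck_sum k (I : Type) (s : seq I) (F : I -> 'rV[R]_N -> R) :
  (forall i, is_Ck k (F i)) -> is_Ck k (fun x => \sum_(i <- s) F i x).
Proof.
move=> HF; elim: s => [|a s IH].
  rewrite (_ : (fun x => _) = cst 0); first exact: is_Ck_cst.
  by apply/funext => x; rewrite big_nil.
rewrite (_ : (fun x => _) = F a \+ (fun x => \sum_(i <- s) F i x)).
  exact: is_CkD.
by apply/funext => x; rewrite big_cons.
Qed.

Lemma derive_coord i v x : 'D_v (fun y : 'rV[R]_N => y ord0 i) x = v ord0 i.
Proof.
have @f : {linear 'rV[R]_N -> R}.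
  by exists (fun y : 'rV[R]_N => y ord0 i); do 2![eexists]; do ?[constructor];
     rewrite ?mxE// => ? *; rewrite ?mxE//; move=> ?; rewrite !mxE.
rewrite (_ : (fun _ => _) = f) //.
have df : differentiable f x by apply: linear_differentiable; exact: coord_continuous.
by rewrite deriveE// diff_lin//; exact: coord_continuous.
Qed.

Lemma is_Ck_coord k i : is_Ck k (fun x => x ord0 i).
Proof.
case: k => [|k]; first exact: coord_continuous.
split; first by move=> x; exact: differentiable_coord.
move=> j; rewrite (_ : partial j _ = cst ((delta_mx ord0 j : 'rV[R]_N) ord0 i)); first exact: is_Ck_cst.
by apply/funext => x; rewrite /partial derive_coord.
Qed.

Lemma partial_comp i (s : R -> R) f x : (forall y, derivable s y 1) ->
  (forall x, differentiable f x) ->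
  partial i (s \o f) x = (derive1 s) (f x) * partial i f x.
Proof.
move=> ds df; rewrite /partial /=.
have dsf : differentiable s (f x) by exact/derivable1_diffP.
rewrite deriveE; last exact: differentiable_comp.
rewrite diff_comp//= [in RHS]deriveE// deriv1E; last exact: ds.
by rewrite mulrC.
Qed.

Lemma is_Ck_comp k (s : R -> R) f : is_C1k k s -> is_Ck k f -> is_Ck k (s \o f).
Proof.
elim: k s f => [|k IH] s f.
  by move=> /= cs cf x; apply: continuous_comp; [exact: cf|exact: cs].
move=> Hs Hf; have [[ds Hs'] [df Hf']] := (Hs, Hf); split.
  by move=> x; apply: differentiable_comp => //; exact/derivable1_diffP.
move=> i; rewrite (_ : partial i _ = ((derive1 s) \o f) \* partial i f).
  by apply: is_CkM; [apply: IH => //; exact: is_CkW|exact: Hf'].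
by apply/funext => x; rewrite partial_comp.
Qed.

Lemma derive_partial f x v : differentiable f x ->
  'D_v f x = \sum_i v ord0 i * partial i f x.
Proof.
move=> df; rewrite deriveE// {1}(row_sum_delta v) linear_sum.
by apply: eq_bigr => i _; rewrite linearZ /= /partial deriveE.
Qed.

Lemma differentiable_aff d h x : differentiable (aff d h) x.
Proof.
rewrite (_ : aff d h = \sum_(i < N) (fun y : 'rV[R]_N =>
    (d ord0 i * y ord0 i + h ord0 i) *: (delta_mx ord0 i : 'rV[R]_N))).
  apply: differentiable_sum => i; apply: differentiableZl.
  apply: differentiableD; last exact: differentiable_cst.
  by apply: differentiableM; [exact: differentiable_cst|exact: differentiable_coord].
apply/funext => y; rewrite fct_sumE [LHS]row_sum_delta.
by apply: eq_bigr => i _; rewrite mxE.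
Qed.

(** A directional derivative depends only on the increments along a line; this handles affine
    substitutions, also between different spaces. *)
Lemma eq_derive (V : normedModType R) (W : normedModType R) (f : V -> R) (g : W -> R)
    (x v : V) (y w : W) :
  (forall t : R, f (t *: v + x) - f x = g (t *: w + y) - g y) ->
  'D_v f x = 'D_w g y.
Proof.
move=> fg; rewrite /derive.
have -> : (fun h : R => h^-1 *: ((f \o shift x) (h *: v) - f x)) =
          (fun h : R => h^-1 *: ((g \o shift y) (h *: w) - g y)).
  by apply/funext => t /=; rewrite fg.
by [].
Qed.

Lemma partial_aff i f d h x : (forall y, differentiable f y) ->
  partial i (f \o aff d h) x = d ord0 i * partial i f (aff d h x).
Proof.
move=> df; rewrite /partial.
have -> : 'D_(delta_mx ord0 i) (f \o aff d h) x =
    'D_(d ord0 i *: delta_mx ord0 i) f (aff d h x).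
  apply: eq_derive => t /=; congr (f _ - _).
  by apply/rowP => j; rewrite !mxE eqxx /=; case: eqP => [->|_] /=; ring.
by rewrite !deriveE// linearZ.
Qed.

Lemma is_Ck_aff k f d h : is_Ck k f -> is_Ck k (f \o aff d h).
Proof.
elim: k f => [|k IH] f.
  move=> /= cf x; apply: continuous_comp; last exact: cf.
  exact/differentiable_continuous/differentiable_aff.
move=> [df Hf]; split.
  by move=> x; apply: differentiable_comp => //; exact: differentiable_aff.
move=> i; rewrite (_ : partial i _ = cst (d ord0 i) \* (partial i f \o aff d h)).
  by apply: is_CkM; [exact: is_Ck_cst|apply: IH; exact: Hf].
by apply/funext => x; rewrite partial_aff.
Qed.

Lemma is_derive_line f x v (s : R) : (forall y, differentiable f y) ->
  is_derive s 1 (fun t : R => f (x + t *: v)) ('D_v f (x + s *: v)).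
Proof.
move=> df.
have dl (t : R) : differentiable (fun t : R => x + t *: v) t.
  apply: differentiableD; first exact: differentiable_cst.
  exact: differentiableZl.
split; first exact/derivable1_diffP/(differentiable_comp (dl s)).
apply: eq_derive => t /=; congr (f _ - _).
by rewrite scalerDl [t *: 1]mulr1 addrCA.
Qed.

End smooth_rV.

(** * A smooth step function *)

Section flat.
Context {R : realType}.
Implicit Types (x t s : R) (n k : nat).

(** The functions x^-n exp(-1/x), extended by 0. The derivative of each is a combination of others
    in the family, so smoothness is proved by induction on the order for all [n] together. *)
Definition flat n x : R := if 0 < x then x^-1 ^+ n * expR (- x^-1) else 0.

Lemma flat_le0 n x : x <= 0 -> flat n x = 0.
Proof. by rewrite /flat ltNge => ->. Qed.

Lemma flat_ge0 n x : 0 <= flat n x.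
Proof.
rewrite /flat; case: ifPn => // x0.
by rewrite mulr_ge0 ?expR_ge0// exprn_ge0// invr_ge0 ltW.
Qed.

Lemma flat_gt0 n x : 0 < x -> 0 < flat n x.
Proof.
by move=> x0; rewrite /flat x0 mulr_gt0 ?expR_gt0// exprn_gt0// invr_gt0.
Qed.

(** With y = 1/x, this is exp(y) >= y^(n+1)/(n+1)!. It makes the difference quotients at 0 tend to
    0. *)
Lemma flat_bound n x : flat n x <= (n.+1)`!%:R * `|x|.
Proof.
have f0 : (0 : R) < (n.+1)`!%:R by rewrite ltr0n fact_gt0.
have [x0|x0] := leP x 0; first by rewrite flat_le0// mulr_ge0.
rewrite /flat x0 gtr0_norm// expRN -ler_pdivrMl//.
have y0 : 0 < x^-1 by rewrite invr_gt0.
set y := x^-1 in y0 *; have -> : x = y^-1 by rewrite invrK.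
have H := expR_ge1Dxn n (ltW y0).
have e0 := expR_gt0 y.
rewrite mulrA ler_pdivrMr// ler_pdivlMl//; apply: le_trans H.
rewrite (_ : _ * _ = y ^+ n.+1 / (n.+1)`!%:R) ?lerDr//.
by rewrite exprS; ring.
Qed.

Lemma is_derive_flat n x :
  is_derive x 1 (flat n) (flat n.+2 x - n%:R * flat n.+1 x).
Proof.
have [x0|x0|x0] := ltgtP x 0.
- rewrite !flat_le0 ?ltW// mulr0 subr0.
  have H : is_derive x 1 (cst 0 : R -> R) 0 by exact: is_derive_cst.
  apply: near_eq_is_derive H.
  near=> t; rewrite /= flat_le0// ltW//; near: t; exact: lt_nbhsl.
- have x00 : x != 0 by rewrite gt_eqF.
  have dV : is_derive x 1 (fun t : R => t^-1) (- x ^- 2).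
    apply: (is_derive_eq (is_deriveV x00 (is_derive_id x 1))).
    by rewrite /GRing.scale/= mulr1.
  have dE : is_derive x 1 (fun t : R => expR (- t^-1)) (expR (- x^-1) * x ^- 2).
    apply: (is_derive_eq (is_derive1_comp (is_derive_expR _) (is_deriveN dV))).
    by rewrite opprK mulrC.
  have H := is_deriveM (is_deriveX n dV) dE.
  have E : \forall t \near x, ((fun t : R => t^-1) ^+ n * (fun t : R => expR (- t^-1))) t = flat n t.
    near=> t; rewrite /flat ifT ?exprfctE//; near: t; exact: lt_nbhsr.
  apply: (is_derive_eq (near_eq_is_derive E H)).
  rewrite /flat x0 /GRing.scale /=.
  rewrite exprfctE -!exprVn; clear; move: (x^-1) (expR _) => y e.
  by case: n => [|n] /=; rewrite !exprS ?expr0; ring.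
- rewrite x0 !flat_le0// mulr0 subr0.
  have H : (fun h : R => h^-1 *: (flat n (h *: 1 + 0) - flat n 0)) @ 0^' --> (0 : R).
    apply/cvgr0Pnorm_le => e e0.
    have f0 : (0 : R) < (n.+2)`!%:R by rewrite ltr0n fact_gt0.
    near=> h.
    rewrite addr0 [h *: 1]mulr1 [flat n 0]flat_le0// subr0.
    have [h0|h0] := leP h 0; first by rewrite flat_le0// scaler0 normr0 ltW.
    (* The difference quotient at 0 is the next member of the family, so [flat_bound] applies to
       it. *)
    have -> : h^-1 *: flat n h = flat n.+1 h by rewrite /flat h0 exprS /GRing.scale/= mulrA.
    rewrite ger0_norm ?flat_ge0// (le_trans (flat_bound _ _))//.
    rewrite -ler_pdivlMl// mulrC; near: h.
    by apply: dnbhs0_le; rewrite divr_gt0.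
  by split; [apply/cvg_ex; exists 0|exact: cvg_lim].
Unshelve. all: by end_near. Qed.

Lemma derive1_flat n : derive1 (flat n) = flat n.+2 \+ (cst (- n%:R) \* flat n.+1).
Proof.
apply/funext => x; rewrite derive1E.
by have [_ ->] := is_derive_flat n x; rewrite /= mulNr.
Qed.

Lemma is_C1k_flat k n : is_C1k k (flat n).
Proof.
elim: k n => [|k IH] n.
  by apply: derivable_continuous => x; have [] := is_derive_flat n x.
split; first by move=> x; have [] := is_derive_flat n x.
rewrite derive1_flat; apply: is_C1kD; first exact: IH.
by apply: is_C1kM; [exact: is_C1k_cst|exact: IH].
Qed.

(* Composing [flat 0] with an affine function of itself avoids quotients. *)
Definition step s : R := flat 0 (1 - flat 0 s / flat 0 1) / flat 0 1.

Lemma is_C1k_step k : is_C1k k step.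
Proof.
pose u := cst 1 \+ (cst (- (flat 0 1)^-1) \* flat 0).
have -> : step = cst ((flat 0 1)^-1) \* (flat 0 \o u).
  by apply/funext => s; rewrite /step /u /= mulNr [LHS]mulrC [flat 0 s / _]mulrC.
apply: is_C1kM; first exact: is_C1k_cst.
apply: is_C1k_comp; first exact: is_C1k_flat.
apply: is_C1kD; first exact: is_C1k_cst.
by apply: is_C1kM; [exact: is_C1k_cst|exact: is_C1k_flat].
Qed.

Let flat01 : 0 < flat 0 1. Proof. exact: flat_gt0. Qed.

Lemma flat0_homo s t : s <= t -> flat 0 s <= flat 0 t.
Proof.
move=> st; rewrite /flat; case: ifPn => s0; last first.
  case: ifPn => // t0; by rewrite expr0 mul1r expR_ge0.
rewrite (lt_le_trans s0 st) !expr0 !mul1r ler_expR lerN2 lef_pV2// posrE//.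
exact: lt_le_trans st.
Qed.

Lemma step_le0 s : s <= 0 -> step s = 1.
Proof. by move=> s0; rewrite /step (flat_le0 _ s0) mul0r subr0 divff ?gt_eqF. Qed.

Lemma step_ge1 s : 1 <= s -> step s = 0.
Proof.
move=> s1; rewrite /step flat_le0 ?mul0r// subr_le0 ler_pdivlMr// mul1r.
exact: flat0_homo.
Qed.

Lemma step_ge0 s : 0 <= step s.
Proof. by rewrite /step divr_ge0 ?flat_ge0. Qed.

Lemma step_le1 s : step s <= 1.
Proof.
rewrite /step ler_pdivrMr// mul1r; apply: flat0_homo.
by rewrite gerBl divr_ge0 ?flat_ge0.
Qed.

Lemma step_derive_bound : exists2 A : R, 0 < A & forall s, `|derive1 step s| <= A.
Proof.
have c1 : continuous (derive1 step).
  by have [_] := is_C1k_step 1.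
have [|a _ Ha] := @EVT_max R (fun s => `|derive1 step s|) 0 1 ler01.
  apply: continuous_subspaceT => x.
  by apply: continuous_comp; [exact: c1|exact: norm_continuous].
exists (`|derive1 step a| + 1); first by rewrite ltr_wpDl.
move=> s; have [s0|s0] := ltP s 0.
  have E : \forall t \near s, step t = (cst 1 : R -> R) t.
    near=> t; rewrite step_le0// ltW//; near: t; exact: lt_nbhsl.
  by rewrite derive1E (near_eq_derive _ E) derive_cst normr0 addr_ge0.
have [s1|s1] := ltP 1 s.
  have E : \forall t \near s, step t = (cst 0 : R -> R) t.
    near=> t; rewrite step_ge1// ltW//; near: t; exact: lt_nbhsr.
  by rewrite derive1E (near_eq_derive _ E) derive_cst normr0 addr_ge0.
rewrite (le_trans (Ha s _)) ?lerDl// in_itv/= s0.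
Unshelve. all: by end_near. Qed.

End flat.

(** * Cutoff functions *)

Section cutoff.
Context {R : realType} {N : nat}.
Implicit Types (x c : 'rV[R]_N) (a b r : R).

(** The squared Euclidean distance, a polynomial and hence smooth also at its center; radial cutoffs
    are built by interpolating between squared radii. *)
Definition sqd c x : R := \sum_i (x ord0 i - c ord0 i) ^+ 2.

Lemma sqd_ge0 c x : 0 <= sqd c x.
Proof. by rewrite /sqd sumr_ge0// => i _; exact: sqr_ge0. Qed.

Lemma is_Ck_sqd k c : is_Ck k (sqd c).
Proof.
apply: is_Ck_sum => i.
pose u := (fun x : 'rV[R]_N => x ord0 i) \+ (cst (- c ord0 i) : 'rV[R]_N -> R).
have Hu : is_Ck k u by apply: is_CkD; [exact: is_Ck_coord|exact: is_Ck_cst].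
rewrite (_ : (fun x => _) = u \* u); first exact: is_CkM.
by apply/funext => x; rewrite /u /= expr2.
Qed.

Lemma partial_sqd i c x : partial i (sqd c) x = 2 * (x ord0 i - c ord0 i).
Proof.
have dc j y : differentiable (fun x : 'rV[R]_N => x ord0 j - c ord0 j) y.
  by apply: differentiableB; [exact: differentiable_coord|exact: differentiable_cst].
have dj j y v : 'D_v (fun x : 'rV[R]_N => x ord0 j - c ord0 j) y = v ord0 j.
  rewrite -(derive_coord j v y); apply: eq_derive => t.
  by rewrite opprB addrA subrK.
pose u j : 'rV[R]_N -> R := fun x => x ord0 j - c ord0 j.
have du j y v : 'D_v (u j \* u j) y = 2 * (v ord0 j * u j y).
  rewrite deriveM; [|exact/diff_derivable/dc|exact/diff_derivable/dc].
  by rewrite dj /GRing.scale/=; ring.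
have -> : sqd c = \sum_(j < N) (u j \* u j).
  by apply/funext => y; rewrite fct_sumE; apply: eq_bigr => j _; rewrite /u /= expr2.
rewrite /partial derive_sum; last first.
  by move=> j; apply: diff_derivable; apply: differentiableM; exact: dc.
rewrite (bigD1 i)//= big1 ?addr0 => [|j ji].
  by rewrite du mxE !eqxx mul1r.
by rewrite du mxE eqxx (negbTE ji) mul0r mulr0.
Qed.

Lemma eballE c r x : 0 <= r -> eball c r x <-> sqd c x < r ^+ 2.
Proof.
move=> r0; rewrite /eball /= /enorm.
have -> : \sum_i ((x - c) ord0 i) ^+ 2 = sqd c x.
  by apply: eq_bigr => i _; rewrite !mxE.
have -> : (Num.sqrt (sqd c x) < r) = (sqd c x < r ^+ 2).
  rewrite -(@ltr_pXn2r _ 2 _ (Num.sqrt _))// ?nnegrE ?sqrtr_ge0//.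
  by rewrite sqr_sqrtr// sqd_ge0.
by [].
Qed.

Lemma sqd_sup c x r : 0 <= r -> sqd c x < r ^+ 2 -> forall i, `|c ord0 i - x ord0 i| < r.
Proof.
move=> r0 H i; rewrite distrC -(@ltr_pXn2r _ 2)// ?nnegrE// real_normK ?num_real//.
apply: le_lt_trans H; rewrite /sqd (bigD1 i)//= lerDl sumr_ge0// => j _.
exact: sqr_ge0.
Qed.

Lemma sup_sqd c x r : (forall i, `|c ord0 i - x ord0 i| <= r) ->
  sqd c x <= N%:R * r ^+ 2.
Proof.
move=> H; rewrite mulr_natl -[N in X in _ <= X]card_ord -sumr_const.
apply: ler_sum => i _; rewrite -[leLHS]real_normK ?num_real// distrC.
by rewrite lerXn2r ?nnegrE ?(le_trans _ (H i)).
Qed.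

Definition cutoff c a b x : R := step ((sqd c x - a ^+ 2) / (b ^+ 2 - a ^+ 2)).

Lemma is_Ck_cutoff k c a b : is_Ck k (cutoff c a b).
Proof.
pose u := (cst ((b ^+ 2 - a ^+ 2)^-1) : 'rV[R]_N -> R) \* (sqd c \+ cst (- a ^+ 2)).
have -> : cutoff c a b = step \o u.
  by apply/funext => x; rewrite /cutoff /u /= mulrC.
apply: is_Ck_comp; first exact: is_C1k_step.
apply: is_CkM; first exact: is_Ck_cst.
by apply: is_CkD; [exact: is_Ck_sqd|exact: is_Ck_cst].
Qed.

Lemma cutoff01 c a b x : 0 <= cutoff c a b x <= 1.
Proof. by rewrite /cutoff step_ge0 step_le1. Qed.

Lemma cutoff_in c a b x : 0 <= a -> a < b -> sqd c x <= a ^+ 2 -> cutoff c a b x = 1.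
Proof.
move=> a0 ab H; rewrite /cutoff step_le0// pmulr_lle0 ?subr_le0//.
by rewrite invr_gt0 subr_gt0 ltrXn2r// ltW.
Qed.

Lemma cutoff_out c a b x : 0 <= a -> a < b -> b ^+ 2 <= sqd c x -> cutoff c a b x = 0.
Proof.
move=> a0 ab H; rewrite /cutoff step_ge1// ler_pdivlMr ?mul1r ?lerD2r//.
by rewrite subr_gt0 ltrXn2r// ltW.
Qed.

Lemma partial_cutoff i c a b x :
  partial i (cutoff c a b) x =
  derive1 step ((sqd c x - a ^+ 2) / (b ^+ 2 - a ^+ 2)) *
    (2 * (x ord0 i - c ord0 i) / (b ^+ 2 - a ^+ 2)).
Proof.
pose u := (cst ((b ^+ 2 - a ^+ 2)^-1) : 'rV[R]_N -> R) \* (sqd c \+ cst (- a ^+ 2)).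
have -> : cutoff c a b = step \o u.
  by apply/funext => y; rewrite /cutoff /u /= mulrC.
have [dsq _] := is_Ck_sqd 1 c.
have dsa y : differentiable (sqd c \+ cst (- a ^+ 2)) y.
  by apply: differentiableD; [exact: dsq|exact: differentiable_cst].
have du y : differentiable u y.
  by apply: differentiableM; [exact: differentiable_cst|exact: dsa].
rewrite partial_comp//; last first.
  by have [+ _] := is_C1k_step (R := R) 1.
rewrite /u partialM// partialD//.
rewrite /= !partial_cst /= partial_sqd addr0 mulr0 addr0.
by rewrite ![(b ^+ 2 - a ^+ 2)^-1 * _]mulrC.
Qed.

End cutoff.

(** * Exhaustion in measure and smooth approximation of indicators *)

Section exhaustion.
Context d (T : measurableType d) (R : realType).
Variable mu : {measure set T -> \bar R}.

(** Continuity from above: the tails decrease to the empty set. It serves whenever finitely many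
    pieces must carry almost all of a finite volume. *)
Lemma bigcup_exhaust (B : nat -> set T) (e : R) :
  (forall n, measurable (B n)) -> (mu (\bigcup_n B n) < +oo)%E -> 0 < e ->
  exists n, (mu (\bigcup_n B n `\` \big[setU/set0]_(k < n) B k) <= e%:E)%E.
Proof.
move=> mB Bfin e0.
pose F n := \bigcup_n B n `\` \big[setU/set0]_(k < n) B k.
have mF n : measurable (F n).
  apply: measurableD; first exact: bigcupT_measurable.
  by apply: bigsetU_measurable => k _.
have capF : \bigcap_n F n = set0.
  apply/seteqP; split => // x Fx; have [[n _ Bx] _] := Fx 0%N Logic.I.
  have [_] := Fx n.+1 Logic.I; apply.
  by rewrite -bigcup_mkord; exists n => //=.
have cvg : mu \o F @ \oo --> 0%E.
  rewrite -(measure0 mu) -capF; apply: nonincreasing_cvg_mu => //.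
  - apply: le_lt_trans Bfin; apply: le_measure; rewrite ?inE//.
      exact: bigcupT_measurable.
    exact: subDsetl.
  - by rewrite capF.
  - move=> n m nm; apply/subsetPset; apply: setDS.
    rewrite -!bigcup_mkord; apply: bigcup_sub => k /= kn.
    by apply: (@bigcup_sup _ _ k) => //=; exact: leq_trans kn nm.
have : \forall n \near \oo, (mu (F n) < e%:E)%E.
  have Hn : nbhs (0%:E : \bar R) [set y | (y < e%:E)%E].
    exact: (@nbhs_open_ereal_lt R 0 (fun=> e)).
  exact: (cvg _ Hn).
by move=> [n _ /(_ n (leqnn n)) Hn]; exists n; exact: ltW.
Qed.

End exhaustion.

Section smooth_approximation.
Context {R : realType} {N : nat}.
Local Notation mu := (borel_lebesgue_rV N).
Implicit Types (f g h phi psi : 'rV[R]_N -> R) (A B U W : set 'rV[R]_N) (e : R).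

Definition smooth01 phi := (forall k, is_Ck k phi) /\ forall x, 0 <= phi x <= 1.

Definition supported_in W phi :=
  exists K, [/\ compact K, K `<=` W & forall x, ~ K x -> phi x = 0].

Lemma smooth01_measurable phi : smooth01 phi -> measurable_fun setT phi.
Proof. by move=> [c _]; exact: (continuous_rV_measurable (c 0%N)). Qed.

Lemma smooth01_cst (b : bool) : smooth01 (cst b%:R).
Proof.
split=> [k|x]; first exact: is_Ck_cst.
by rewrite /cst /=; case: b; rewrite ?lexx ?ler01.
Qed.

Lemma smooth01M phi psi : smooth01 phi -> smooth01 psi -> smooth01 (phi \* psi).
Proof.
move=> [s1 H1] [s2 H2]; split=> [k|x]; first exact: is_CkM.
have /andP[? ?] := H1 x; have /andP[? ?] := H2 x.
by rewrite /= mulr_ge0//= mulr_ile1.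
Qed.

Lemma smooth01C phi : smooth01 phi -> smooth01 (fun x => 1 - phi x).
Proof.
move=> [s1 H1]; split=> [k|x]; last first.
  by have /andP[? ?] := H1 x; rewrite subr_ge0 gerBl; apply/andP.
rewrite (_ : (fun x => _) = cst 1 \+ (cst (-1) \* phi)).
  by apply: is_CkD; [exact: is_Ck_cst|apply: is_CkM; [exact: is_Ck_cst|exact: s1]].
by apply/funext => x; rewrite /= mulN1r.
Qed.

Lemma smooth01U phi psi : smooth01 phi -> smooth01 psi ->
  smooth01 (fun x => 1 - (1 - phi x) * (1 - psi x)).
Proof. by move=> H1 H2; apply: smooth01C; apply: smooth01M; exact: smooth01C. Qed.

Lemma integral_le_add U f g h (a b : R) : measurable U ->
  measurable_fun setT f -> measurable_fun setT g -> measurable_fun setT h ->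
  (forall x, 0 <= f x) -> (forall x, 0 <= g x) -> (forall x, 0 <= h x) ->
  (forall x, U x -> f x <= g x + h x) ->
  (\int[mu]_(x in U) (g x)%:E <= a%:E)%E -> (\int[mu]_(x in U) (h x)%:E <= b%:E)%E ->
  (\int[mu]_(x in U) (f x)%:E <= (a + b)%:E)%E.
Proof.
move=> mU mf mg mh f0 g0 h0 fgh Ha Hb.
have mF u : measurable_fun setT u -> measurable_fun U (EFin \o u).
  by move=> mu'; apply: measurable_funTS; exact/measurable_EFinP.
apply: (@le_trans _ _ (\int[mu]_(x in U) ((g x)%:E + (h x)%:E))%E).
  apply: ge0_le_integral => //.
  - by move=> x _; rewrite lee_fin.
  - exact: mF.
  - by apply: emeasurable_funD; exact: mF.
rewrite ge0_integralD//; first by rewrite EFinD leeD.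
- by move=> x _; rewrite lee_fin.
- exact: mF.
- by move=> x _; rewrite lee_fin.
- exact: mF.
Qed.

(** Measurability is part of the definition so that the approximable sets form a sigma-algebra, to
    be compared with the Borel one. *)
Definition approx U A := measurable A /\ forall e, 0 < e -> exists phi,
  smooth01 phi /\ (\int[mu]_(x in U) (`|phi x - \1_A x|)%:E <= e%:E)%E.

Lemma measurable_dist phi A : measurable A -> measurable_fun setT phi ->
  measurable_fun setT (fun x => `|phi x - \1_A x|).
Proof.
move=> mA mphi; apply: measurableT_comp => //.
by apply: measurable_funB => //; exact: measurable_indic.
Qed.

Lemma approxC U A : approx U A -> approx U (~` A).
Proof.
move=> [mA HA]; split; first exact: measurableC.
move=> e /HA[phi [sphi Hphi]]; exists (fun x => 1 - phi x); split.
  exact: smooth01C.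
apply: le_trans Hphi; apply: le_of_eq.
apply: eq_integral => x _; congr EFin.
rewrite !indicE in_setC; case: (x \in A) => /=; rewrite -normrN; congr Num.norm; ring.
Qed.

Lemma approxU U A B : measurable U -> approx U A -> approx U B -> approx U (A `|` B).
Proof.
move=> mU [mA HA] [mB HB]; split; first exact: measurableU.
move=> e e0; have e20 : 0 < e / 2 by rewrite divr_gt0.
have [phi [sphi Hphi]] := HA _ e20; have [psi [spsi Hpsi]] := HB _ e20.
exists (fun x => 1 - (1 - phi x) * (1 - psi x)); split; first exact: smooth01U.
rewrite (splitr e); apply: integral_le_add Hphi Hpsi => //.
- apply: measurable_dist; first exact: measurableU.
  by apply: smooth01_measurable; exact: smooth01U.
- by apply: measurable_dist => //; exact: smooth01_measurable.
- by apply: measurable_dist => //; exact: smooth01_measurable.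
- move=> x _; have [_ /(_ x)/andP[p0 p1]] := sphi; have [_ /(_ x)/andP[q0 q1]] := spsi.
  rewrite !indicE in_setU; set a := _%:R; set b : R := (x \in A)%:R; set c : R := (x \in B)%:R.
  (* The two indicators are replaced one at a time; each error is multiplied by a factor in
     [0, 1]. *)
  have -> : 1 - (1 - phi x) * (1 - psi x) - a = (phi x - b) * (1 - psi x) + (psi x - c) * (1 - b).
    by rewrite /a /b /c; case: (x \in A); case: (x \in B) => /=; ring.
  have b01 : 0 <= 1 - b <= 1.
    by rewrite /b; case: (x \in A); rewrite /= ?subrr ?subr0 ?lexx ?ler01.
  case/andP: b01 => b0 b1.
  rewrite (le_trans (ler_normD _ _))// !normrM lerD// ler_piMr//.
    by rewrite ger0_norm ?subr_ge0// gerBl.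
  by rewrite ger0_norm.
Qed.

Lemma approx_bigsetU U (A : nat -> set 'rV[R]_N) n : measurable U ->
  (forall k, approx U (A k)) -> approx U (\big[setU/set0]_(k < n) A k).
Proof.
move=> mU HA; elim: n => [|n IH]; last by rewrite big_ord_recr; exact: approxU.
rewrite big_ord0; split => // e e0; exists (cst 0); split.
  exact: (smooth01_cst false).
rewrite (_ : (\int[mu]_(x in U) _)%E = 0%E) ?lee_fin ?ltW//.
by apply: integral0_eq => x _; rewrite indic0 /= subrr normr0.
Qed.

Lemma approx_bigcup U (A : nat -> set 'rV[R]_N) : measurable U -> (mu U < +oo)%E ->
  (forall k, approx U (A k)) -> approx U (\bigcup_k A k).
Proof.
move=> mU Ufin HA; have mA k : measurable (A k) by case: (HA k).
have mAU : measurable (\bigcup_k A k) by exact: bigcupT_measurable.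
split => // e e0; have e20 : 0 < e / 2 by rewrite divr_gt0.
have [|||n Hn] := @bigcup_exhaust _ _ _ mu (fun k => U `&` A k) (e / 2).
- by move=> k; exact: measurableI.
- rewrite -setI_bigcupr; apply: le_lt_trans Ufin.
  by apply: le_measure; rewrite ?inE//; exact: measurableI.
- by [].
have [mB /(_ _ e20)[phi [sphi Hphi]]] := @approx_bigsetU U A n mU HA.
exists phi; split => //; rewrite (splitr e).
pose D := \bigcup_k (U `&` A k) `\` \big[setU/set0]_(k < n) (U `&` A k).
have mD : measurable D.
  apply: measurableD; first by apply: bigcupT_measurable => k; exact: measurableI.
  by apply: bigsetU_measurable => k _; exact: measurableI.
apply: (integral_le_add mU _ _ _ _ _ _ _ Hphi (h := \1_D)).
- by apply: measurable_dist => //; exact: smooth01_measurable.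
- by apply: measurable_dist => //; exact: smooth01_measurable.
- exact: measurable_indic.
- by [].
- by [].
- by move=> x; rewrite indicE.
- move=> x Ux; have [xB|xB] := pselect ((\big[setU/set0]_(k < n) A k) x).
    have xU : (\bigcup_k A k) x.
      by move: xB; rewrite -bigcup_mkord => -[k _ Akx]; exists k.
    by rewrite !indicE (mem_set xB) (mem_set xU) lerDl.
  rewrite !indicE (memNset xB) subr0.
  have [[k _ Akx]|xA] := pselect ((\bigcup_k A k) x); last first.
    by rewrite (memNset xA) subr0 lerDl.
  have xU : (\bigcup_k A k) x by exists k.
  have xD : D x.
    split; first by exists k.
    rewrite -(bigcup_mkord n (fun k => U `&` A k)) => -[j jn [_ Aj]]; apply: xB.
    by rewrite -bigcup_mkord; exists j.
  rewrite (mem_set xU) (mem_set xD).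
  by rewrite (le_trans (ler_normB _ _))// normr1.
- rewrite integral_indic//; apply: le_trans Hn; apply: le_measure; rewrite ?inE//.
  exact: measurableI.
Qed.

Lemma eball_compact (c : 'rV[R]_N) (r : R) : compact [set x | sqd c x <= r ^+ 2].
Proof.
apply: bounded_closed_compact.
  exists (`|c| + `|r| + 1); split; first by rewrite num_real.
  move=> M HM x /= Hx; rewrite -(subrK c x) addrC (le_trans (ler_normD _ _))//.
  apply: le_trans (ltW HM); rewrite -addrA lerD2l.
  apply: rV_norm_leP => [|i]; first by rewrite addr_ge0.
  have H : sqd c x < (`|r| + 1) ^+ 2.
    apply: (le_lt_trans Hx); rewrite -real_normK ?num_real//.
    by rewrite ltrXn2r// ?ltrDl.
  have := @sqd_sup _ _ c x (`|r| + 1) (addr_ge0 (normr_ge0 r) ler01) H i.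
  by rewrite distrC !mxE => /ltW.
rewrite (_ : mkset _ = sqd c @^-1` [set y | y <= r ^+ 2]) //.
apply: closed_comp; last exact: closed_le.
by move=> x _; exact: (is_Ck_sqd 0 c x).
Qed.

(** [W] is a countable union of rational balls whose enlargements stay in [W]. Finitely many of them
    cover [W] up to volume [e], and one minus the product of the functions 1 - cutoff is a smooth
    union of their cutoffs. *)
Lemma open_exhaust W e : open W -> (mu W < +oo)%E -> 0 < e ->
  exists phi, [/\ smooth01 phi, supported_in W phi &
    (\int[mu]_(x in W) (`|phi x - 1|)%:E <= e%:E)%E].
Proof.
move=> oW Wfin e0; have mW := open_rV_measurable oW.
(* The sup ball of radius rho lies in the Euclidean ball of radius (N+1) rho, where the cutoff is 1;
   the support of the cutoff, of Euclidean radius 2(N+1) rho, lies in the sup ball of radius 3(N+1)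
   rho. *)
pose c : R := 3 * N.+1%:R.
have N1 : (1 : R) <= N.+1%:R by rewrite ler1n.
have c1 : 1 <= c by rewrite /c; lra.
pose q (p : 'rV[rat]_N * nat) : 'rV[R]_N := \row_i ratr (p.1 ord0 i).
pose rho (p : 'rV[rat]_N * nat) : R := p.2.+1%:R^-1.
have rho0 p : 0 < rho p by rewrite /rho invr_gt0.
pose P (p : 'rV[rat]_N * nat) := ball (q p) (c * rho p) `<=` W.
pose kap (p : 'rV[rat]_N * nat) := cutoff (q p) (N.+1%:R * rho p) (2 * (N.+1%:R * rho p)).
pose Bp (p : 'rV[rat]_N * nat) := [set x | sqd (q p) x <= (N.+1%:R * rho p) ^+ 2].
pose K (p : 'rV[rat]_N * nat) := [set x | sqd (q p) x <= (2 * (N.+1%:R * rho p)) ^+ 2].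
have KW p : P p -> K p `<=` W.
  move=> Pp x Kx; apply: Pp.
  have cp : 0 < c * rho p by rewrite mulr_gt0// (lt_le_trans _ c1).
  apply/(rV_ballP _ _ cp) => i.
  apply: sqd_sup; first exact: ltW.
  apply: (le_lt_trans Kx); have := rho0 p => r0.
  have Nr : 0 < N.+1%:R * rho p by rewrite mulr_gt0.
  rewrite ltrXn2r//; rewrite /c; lra.
pose o (k : nat) : option ('rV[rat]_N * nat) := unpickle k.
pose kk k := if o k is Some p then (if `[<P p>] then kap p else cst 0) else cst 0.
pose BB k := if o k is Some p then (if `[<P p>] then Bp p else set0) else set0.
have skk k : smooth01 (kk k).
  rewrite /kk; case: (o k) => [p|]; last exact: (smooth01_cst false).
  case: asboolP => _; last exact: (smooth01_cst false).
  by split=> [n|x]; [exact: is_Ck_cutoff|exact: cutoff01].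
have supkk k : supported_in W (kk k).
  have cst0 : supported_in W (cst 0).
    by exists set0; split => //; exact: compact0.
  rewrite /kk; case: (o k) => [p|] //; case: asboolP => // Pp.
  exists (K p); split; [exact: eball_compact|exact: KW|].
  move=> x /negP; rewrite -ltNge => Kx; apply: cutoff_out; last exact: ltW.
    by rewrite mulr_ge0// ltW.
  by rewrite ltr_pMl ?ltr1n// mulr_gt0.
have BB1 k x : BB k x -> kk k x = 1.
  rewrite /BB /kk; case: (o k) => [p|] //; case: asboolP => // Pp Bx.
  apply: cutoff_in => //; first by rewrite mulr_ge0// ltW.
  by rewrite ltr_pMl ?ltr1n// mulr_gt0.
have mBB k : measurable (BB k).
  rewrite /BB; case: (o k) => [p|] //; case: asboolP => // Pp.
  by apply: closed_rV_measurable; apply: compact_closed => //; exact: eball_compact.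
have BBW : \bigcup_k BB k = W.
  apply/seteqP; split => x.
    move=> [k _]; rewrite /BB; case: (o k) => [p|] //; case: asboolP => // Pp Bx.
    apply: (KW p Pp); apply: (le_trans Bx); have := rho0 p => r0.
    have Nr : 0 < N.+1%:R * rho p by rewrite mulr_gt0.
    rewrite lerXn2r ?nnegrE//; lra.
  move=> Wx; have [p [xp pW]] := rat_ball_dense c1 oW Wx.
  exists (pickle p) => //; rewrite /BB /o pickleK asboolT//.
  apply: (le_trans (sup_sqd (r := rho p) _)).
    move=> i; move: xp => /rV_ballP; rewrite -/(q p) => H; apply/ltW/H; exact: rho0.
  rewrite exprMn ler_wpM2r ?sqr_ge0//.
  by rewrite -natrX ler_nat (leq_trans (leqnSn N))// leq_pmulr.
have [|||n Hn] := @bigcup_exhaust _ _ _ mu BB e => //; first by rewrite BBW.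
pose Phi n x := 1 - \prod_(k < n) (1 - kk k x).
have PhiS m : Phi m.+1 = fun x => 1 - (1 - Phi m x) * (1 - kk m x).
  by apply/funext => x; rewrite /Phi big_ord_recr /=; ring.
have sPhi m : smooth01 (Phi m) /\ supported_in W (Phi m).
  elim: m => [|m [IH1 [K1 [cK1 K1W K10]]]].
    have -> : Phi 0%N = cst 0 by apply/funext => x; rewrite /Phi big_ord0 subrr.
    split; first exact: (smooth01_cst false).
    by exists set0; split => //; exact: compact0.
  rewrite PhiS; split; first exact: smooth01U.
  have [K2 [cK2 K2W K20]] := supkk m; exists (K1 `|` K2); split.
  - exact: compactU.
  - by move=> x [/K1W|/K2W].
  - by move=> x /not_orP[k1 k2]; rewrite K10// K20// subr0 mulr1 subrr.
have [s1 s2] := sPhi n; exists (Phi n); split => //.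
apply: le_trans Hn; rewrite BBW.
have mD : measurable (W `\` \big[setU/set0]_(k < n) BB k).
  by apply: measurableD => //; apply: bigsetU_measurable.
apply: (@le_trans _ _
    (\int[mu]_(x in W) (\1_(W `\` \big[setU/set0]_(k < n) BB k) x)%:E)%E); last first.
  by rewrite integral_indic// setIidl//; exact: subDsetl.
apply: ge0_le_integral => //.
- apply/measurable_EFinP; apply: measurable_funTS; apply: measurableT_comp => //.
  by apply: measurable_funB => //; exact: smooth01_measurable.
- by apply/measurable_EFinP; apply: measurable_funTS; exact: measurable_indic.
move=> x Wx; rewrite lee_fin indicE.
have [xB|xB] := pselect ((\big[setU/set0]_(k < n) BB k) x); last first.
  rewrite mem_set//=; have /andP[p0 p1] := s1.2 x.
  by rewrite distrC ger0_norm ?subr_ge0// gerBl.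
rewrite (_ : Phi n x = 1) ?subrr ?normr0//.
move: xB; rewrite -bigcup_mkord => -[k /= kn Bk].
by rewrite /Phi (bigD1 (Ordinal kn))//= BB1// subrr mul0r subr0.
Qed.

Lemma approx_open U A : open U -> (mu U < +oo)%E -> open A -> approx U A.
Proof.
move=> oU Ufin oA; have mA := open_rV_measurable oA; split=> // e e0.
have mU := open_rV_measurable oU.
have oUA : open (U `&` A) by exact: openI.
have UAfin : (mu (U `&` A) < +oo)%E.
  by apply: le_lt_trans Ufin; apply: le_measure; rewrite ?inE//; exact: measurableI.
have [phi [s1 [K [cK KUA K0]] Hphi]] := open_exhaust oUA UAfin e0.
exists phi; split => //.
have mP := smooth01_measurable s1.
apply: le_trans Hphi; rewrite integral_mkcond [leRHS]integral_mkcond.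
apply: le_of_eq; congr (integral _ _ _).
apply/funext => x; rewrite !patchE indicE in_setI.
have [Ux|Ux] := boolP (x \in U) => //=.
have [Ax|Ax] := boolP (x \in A) => //=.
rewrite K0 ?subrr ?normr0// => /KUA[_ /mem_set]; by rewrite (negbTE Ax).
Qed.

(** The approximable sets form a sigma-algebra; it contains the preimages of open intervals under
    the coordinates, which generate the Borel sets. *)
Lemma approx_measurable U A : open U -> (mu U < +oo)%E -> measurable A -> approx U A.
Proof.
move=> oU Ufin; have mU := open_rV_measurable oU.
have sigma : sigma_algebra setT (approx U).
  split.
  - by have := @approx_bigsetU U (fun=> setT) 0 mU; rewrite big_ord0; apply => k; apply: approx_open => //; exact: openT.
  - by move=> B HB; rewrite setTD; exact: approxC.
  - by move=> F HF; exact: approx_bigcup.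
suff : @measurable _ 'rV[R]_N `<=` approx U by apply.
apply: smallest_sub => // B; rewrite -bigcup_seq => -[i _ [Y mY <-]]; rewrite setTI.
have sigmaY : sigma_algebra setT [set Y : set R | approx U ((fun x : 'rV[R]_N => x ord0 i) @^-1` Y)].
  case: sigma => s0 sC sU; split => /=.
  - by rewrite preimage_set0.
  - by move=> Z HZ; rewrite setTD -preimage_setC -setTD; exact: sC.
  - by move=> F HF; rewrite preimage_bigcup; exact: sU.
suff : (RGenOpens.G (R := R)).-sigma.-measurable `<=`
    [set Y : set R | approx U ((fun x : 'rV[R]_N => x ord0 i) @^-1` Y)].
  by apply; rewrite -(RGenOpens.measurableE R).
apply: smallest_sub => // Z [a [b ->]] /=; apply: approx_open => //.
apply: open_comp => // x _; exact: coord_continuous.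
Qed.

(** A product of two functions: one approximates the indicator, the other exhausts [U] and supplies
    the compact support inside [U]. *)
Lemma approx_indic U A e : open U -> (mu U < +oo)%E -> measurable A -> A `<=` U ->
  0 < e -> exists phi, [/\ smooth01 phi, supported_in U phi &
    (\int[mu]_(x in U) (`|phi x - \1_A x|)%:E <= e%:E)%E].
Proof.
move=> oU Ufin mA AU e0; have e20 : 0 < e / 2 by rewrite divr_gt0.
have mU := open_rV_measurable oU.
have [Phi [s1 [K [cK KU K0]] H1]] := open_exhaust oU Ufin e20.
have [_ /(_ _ e20)[psi [s2 H2]]] := approx_measurable oU Ufin mA.
exists (Phi \* psi); split; first exact: smooth01M.
  by exists K; split => // x Kx; rewrite /= K0// mul0r.
rewrite (splitr e); apply: integral_le_add H1 H2 => //.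
- by apply: measurable_dist => //; apply: smooth01_measurable; exact: smooth01M.
- apply: measurableT_comp => //; apply: measurable_funB => //.
  exact: smooth01_measurable.
- by apply: measurable_dist => //; exact: smooth01_measurable.
- move=> x _ /=; rewrite (_ : _ - _ = (Phi x - 1) * psi x + (psi x - \1_A x)); last by ring.
  rewrite (le_trans (ler_normD _ _))// lerD2r normrM ler_piMr//.
  by have /andP[? ?] := s2.2 x; rewrite ger0_norm.
Qed.

End smooth_approximation.

(** * Real integrals of bounded functions of compact support *)

Section compactly_supported.
Context {R : realType} {N : nat}.
Local Notation mu := (borel_lebesgue_rV N).
Implicit Types (f g : 'rV[R]_N -> R) (A B E S : set 'rV[R]_N) (c p : R).

(** On this class the real-valued integral [intg] is finite and linear. It contains the divergences
    of test fields, the derivatives of compactly supported smooth functions and the indicators of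
    bounded Borel sets. *)
Definition bcs f := measurable_fun setT f /\
  exists M r : R, forall x, `|f x| <= M /\ (f x != 0 -> ball 0 r x).

Lemma bcs_integrable f A : bcs f -> measurable A -> mu.-integrable A (EFin \o f).
Proof.
move=> [mf [M [r H]]] mA; have mB := @measurable_rV_ball R N 0 r.
apply: (@integrableS _ _ _ _ setT) => //.
rewrite (_ : EFin \o f = (EFin \o f) \_ (ball 0 r)); last first.
  apply/funext => x; rewrite patchE; case: ifPn => //= /negP xB.
  congr EFin; apply/eqP; apply/negPn/negP => fx; apply: xB.
  by apply/mem_set; exact: (H x).2.
apply/(integrable_mkcond _ mB).
apply: measurable_bounded_integrable => //.
- exact: (mu_bounded_fin (x := 0) (r := r)).
- exact: measurable_funTS.
- exists M; split; first by rewrite num_real.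
  by move=> M' MM' x _ /=; rewrite (le_trans (H x).1)// ltW.
Qed.

Lemma bcs_comb f g c : bcs f -> bcs g -> bcs (fun x => c * f x + g x).
Proof.
move=> [mf [M [r H]]] [mg [M' [r' H']]]; split.
  by apply: measurable_funD => //; apply: measurable_funM.
exists (`|c| * M + M'), (Num.max r r') => x; split.
  rewrite (le_trans (ler_normD _ _))// normrM lerD//.
    by rewrite ler_wpM2l//; exact: (H x).1.
  exact: (H' x).1.
move=> fg; have [fx|fx] := eqVneq (f x) 0; last first.
  by apply: (@le_ball _ _ _ r); [rewrite le_max lexx|exact: (H x).2].
apply: (@le_ball _ _ _ r'); first by rewrite le_max lexx orbT.
by apply: (H' x).2; move: fg; rewrite fx mulr0 add0r.
Qed.

Lemma bcsM f g (M : R) : bcs f -> measurable_fun setT g ->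
  (forall x, `|g x| <= M) -> bcs (fun x => f x * g x).
Proof.
move=> [mf [M' [r H]]] mg Hg; split; first exact: measurable_funM.
exists (M' * M), r => x; split.
  by rewrite normrM ler_pM//; exact: (H x).1.
by move=> fgx; apply: (H x).2; apply: contraNneq fgx => ->; rewrite mul0r.
Qed.

Lemma bcs0 : bcs (cst 0).
Proof.
split; first exact: measurable_cst.
by exists 0, 0 => x; rewrite /cst normr0 eqxx.
Qed.

Lemma bcsD f g : bcs f -> bcs g -> bcs (f \+ g).
Proof.
move=> bf bg; rewrite (_ : f \+ g = fun x => 1 * f x + g x); first exact: bcs_comb.
by apply/funext => x; rewrite /= mul1r.
Qed.

Lemma bcsZ f c : bcs f -> bcs (fun x => c * f x).
Proof.
move=> bf; have := bcs_comb c bf bcs0.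
by congr bcs; apply/funext => x; rewrite /= addr0.
Qed.

Lemma bcsB f g : bcs f -> bcs g -> bcs (f \- g).
Proof.
move=> bf bg; have := bcs_comb (-1) bg bf.
by congr bcs; apply/funext => x; rewrite /= mulN1r addrC.
Qed.

Lemma bcs_indic S r : measurable S -> S `<=` ball 0 r -> bcs \1_S.
Proof.
move=> mS Sr; split; first exact: measurable_indic.
exists 1, r => x; rewrite indicE; split.
  by case: (_ \in _); rewrite ?normr1 ?normr0.
by have [/set_mem/Sr//|_] := boolP (x \in S); rewrite eqxx.
Qed.

Lemma compact_ball K : compact K -> exists2 r : R, 0 < r & K `<=` ball (0 : 'rV[R]_N) r.
Proof.
move=> /compact_bounded[M [_ HM]]; exists (`|M| + 2).
  by rewrite ltr_wpDl.
move=> x Kx; rewrite -ball_normE /= sub0r normrN.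
apply: (@le_lt_trans _ _ (`|M| + 1)); last by rewrite ltrD2l ltr1n.
by apply: HM => //; rewrite (le_lt_trans (ler_norm _))// ltrDl.
Qed.

Lemma continuous_supp_bounded f K : continuous f -> compact K ->
  (forall x, ~ K x -> f x = 0) -> exists2 M : R, 0 <= M & forall x, `|f x| <= M.
Proof.
move=> cf cK f0.
have cfK : compact (f @` K).
  by apply: continuous_compact => //; exact: continuous_subspaceT.
have [M [_ HM]] := compact_bounded cfK.
exists (`|M| + 1) => [|x]; first by rewrite addr_ge0.
have [Kx|Kx] := pselect (K x); last by rewrite f0// normr0 addr_ge0.
by apply: HM; [rewrite (le_lt_trans (ler_norm _))// ltrDl|exists x].
Qed.

Lemma bcs_continuous f K : continuous f -> compact K ->
  (forall x, ~ K x -> f x = 0) -> bcs f.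
Proof.
move=> cf cK f0; split; first exact: continuous_rV_measurable.
have [M _ HM] := continuous_supp_bounded cf cK f0.
have [r _ Kr] := compact_ball cK.
exists M, r => x; split => // fx; apply: Kr; apply: contrapT => /f0 fx0.
by rewrite fx0 eqxx in fx.
Qed.

Definition intg E f : R := Rintegral mu E f.

Lemma intgD E f g : measurable E -> bcs f -> bcs g ->
  intg E (f \+ g) = intg E f + intg E g.
Proof. by move=> mE bf bg; apply: RintegralD => //; exact: bcs_integrable. Qed.

Lemma intgB E f g : measurable E -> bcs f -> bcs g ->
  intg E (f \- g) = intg E f - intg E g.
Proof. by move=> mE bf bg; apply: RintegralB => //; exact: bcs_integrable. Qed.

Lemma intgZ E f c : measurable E -> bcs f ->
  intg E (fun x => c * f x) = c * intg E f.
Proof. by move=> mE bf; apply: RintegralZl => //; exact: bcs_integrable. Qed.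

Lemma le_intg E f g : measurable E -> bcs f -> bcs g ->
  (forall x, E x -> f x <= g x) -> intg E f <= intg E g.
Proof. by move=> mE bf bg fg; apply: le_Rintegral => //; exact: bcs_integrable. Qed.

Lemma intg_indic S E r : measurable S -> S `<=` ball 0 r -> measurable E ->
  intg E \1_S = fine (mu (S `&` E)).
Proof.
move=> mS Sr mE; rewrite /intg /Rintegral; congr fine.
exact: integral_indic.
Qed.

Lemma intg_mkcond E f : intg E f = intg setT (fun x => f x * \1_E x).
Proof.
rewrite /intg Rintegral_mkcond; apply: eq_Rintegral => x _.
by rewrite patchE indicE; case: (_ \in _); rewrite ?mulr1 ?mulr0.
Qed.

Lemma bcs_restr f E : bcs f -> measurable E -> bcs (fun x => f x * \1_E x).
Proof.
move=> bf mE; apply: (bcsM (M := 1)) => //.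
by move=> x; rewrite indicE; case: (_ \in _); rewrite ?normr1 ?normr0.
Qed.

Lemma intg_bound S E f (M r : R) : measurable S -> S `<=` ball 0 r -> measurable E ->
  bcs f -> (forall x, E x -> `|f x| <= M * \1_S x) -> 0 <= M ->
  `|intg E f| <= M * fine (mu (E `&` S)).
Proof.
move=> mS Sr mE bf fM M0.
have bS := bcs_indic mS Sr; have bMS := bcsZ M bS.
have -> : M * fine (mu (E `&` S)) = intg E (fun x => M * \1_S x).
  by rewrite intgZ// (intg_indic mS Sr)// setIC.
rewrite ler_norml; apply/andP; split; last first.
  by apply: le_intg => // x Ex; rewrite (le_trans (ler_norm _))// fM.
have -> : - intg E (fun x => M * \1_S x) = intg E (fun x => (- M) * \1_S x).
  by rewrite !intgZ// mulNr.
apply: le_intg => //; first exact: bcsZ.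
by move=> x Ex; rewrite mulNr lerNl (le_trans _ (fM x Ex))// -normrN ler_norm.
Qed.

Lemma intgU A B f : measurable A -> measurable B -> A `&` B = set0 -> bcs f ->
  intg (A `|` B) f = intg A f + intg B f.
Proof.
move=> mA mB AB bf; apply: Rintegral_setU => //.
  by apply: bcs_integrable => //; exact: measurableU.
by rewrite disj_set2E AB.
Qed.

Lemma ge0_integral_aff (d h : 'rV[R]_N) A (g : 'rV[R]_N -> \bar R) :
  (forall i, 0 < d ord0 i) -> measurable A -> measurable_fun setT g ->
  (forall x, (0 <= g x)%E) ->
  (\int[mu]_(x in aff d h @^-1` A) (g \o aff d h) x =
   (\prod_i (d ord0 i)^-1)%:E * \int[mu]_(x in A) g x)%E.
Proof.
move=> d0 mA mg g0.
have c0 : 0 <= \prod_i (d ord0 i)^-1 by apply: prodr_ge0 => i _; rewrite invr_ge0 ltW.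
rewrite -(@ge0_integral_pushforward _ _ _ _ _ (aff d h) _ mu)//; last 2 first.
- exact: measurable_aff.
- exact: measurable_funTS.
rewrite -(ge0_integral_mscale mu mA (NngNum c0))//; last exact: measurable_funTS.
apply: eq_measure_integral; first exact: measurable_aff.
move=> mf B mB _; rewrite /mscale /pushforward /=.
exact: borel_lebesgue_affine.
Qed.

Lemma bcs_aff (d h : 'rV[R]_N) f : (forall i, 0 < d ord0 i) -> bcs f ->
  bcs (f \o aff d h).
Proof.
move=> d0 [mf [M [r H]]]; split; first exact: measurableT_comp mf (measurable_aff d h).
pose r' := \sum_i ((`|r| + `|h ord0 i|) / d ord0 i) + 1.
exists M, r' => x; split; first exact: (H _).1.
move=> /(H _).2 Hx; have r0 : 0 < r by case: Hx.
have r'0 : 0 < r'.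
  rewrite ltr_wpDl// sumr_ge0// => i _.
  by rewrite divr_ge0 ?addr_ge0// ltW.
apply/(rV_ballP _ _ r'0) => i.
have /(rV_ballP _ _ r0)/(_ i) := Hx; rewrite !mxE !sub0r !normrN => Hi.
apply: (@le_lt_trans _ _ ((`|r| + `|h ord0 i|) / d ord0 i)).
  rewrite ler_pdivlMr// -[X in _ * X](gtr0_norm (d0 i)) -normrM mulrC.
  rewrite -[X in `|X|](addrK (h ord0 i)) (le_trans (ler_normB _ _))// lerD2r.
  by rewrite (le_trans (ltW Hi))// ler_norm.
rewrite /r' (bigD1 i)//= -addrA ltrDl ltr_wpDl// sumr_ge0// => j _.
by rewrite divr_ge0 ?addr_ge0// ltW.
Qed.

Lemma intg_aff (d h : 'rV[R]_N) A f : (forall i, 0 < d ord0 i) -> measurable A ->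
  bcs f ->
  intg (aff d h @^-1` A) (f \o aff d h) = (\prod_i (d ord0 i)^-1) * intg A f.
Proof.
move=> d0 mA bf; have [mf _] := bf.
have mF : measurable_fun setT (EFin \o f) by exact/measurable_EFinP.
have iA := bcs_integrable bf mA.
have ifp := integrable_funepos mA iA; have ifn := integrable_funeneg mA iA.
have fp := integrable_fin_num mA ifp; have fn := integrable_fin_num mA ifn.
rewrite /intg /Rintegral.
rewrite [X in fine X]integralE [X in _ = _ * fine X]integralE.
rewrite -[fun x => ((f \o aff d h) x)%:E]/((EFin \o f) \o aff d h).
rewrite -[fun x => (f x)%:E]/(EFin \o f) funepos_comp funeneg_comp.
rewrite !ge0_integral_aff//; [|exact: measurable_funeneg|exact: measurable_funepos].
by rewrite -(fineK fp) -(fineK fn) -!EFinM -!EFinB /= mulrBr.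
Qed.

End compactly_supported.

(** * Perimeter *)

Section perimeter_bounds.
Context {R : realType} {N : nat}.
Local Notation mu := (borel_lebesgue_rV N).
Local Notation L := (N.+1%:R : R).
Implicit Types (f g phi : 'rV[R]_N -> R) (A B C E K S U : set 'rV[R]_N) (c p t : R).
Implicit Types (xi : 'rV[R]_N -> 'rV[R]_N) (x y v w h : 'rV[R]_N).

Lemma derive_off_support f K v x : closed K -> (forall y, ~ K y -> f y = 0) ->
  ~ K x -> 'D_v f x = 0.
Proof.
move=> cK f0 Kx.
have E : \forall y \near x, f y = (cst 0 : 'rV[R]_N -> R) y.
  have : nbhs x (~` K) by apply: open_nbhs_nbhs; split => //; exact: closed_openC.
  by apply: filterS => y; exact: f0.
by rewrite (near_eq_derive _ E) derive_cst.
Qed.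

Lemma test_field_coord0 C xi i x : test_field C xi -> ~ field_support xi x ->
  xi x ord0 i = 0.
Proof.
move=> _ Hx; have [->|xi0] := eqVneq (xi x) 0; first by rewrite mxE.
by exfalso; apply: Hx; exact: subset_closure.
Qed.

Lemma divergence_continuous C xi : test_field C xi -> continuous (divergence xi).
Proof.
move=> [sxi _ _ _]; have : is_Ck 0 (divergence xi); last by [].
rewrite (_ : divergence xi = fun x => \sum_i partial i (fun y => xi y ord0 i) x) //.
by apply: is_Ck_sum => i; have [_] := sxi i 1%N; exact.
Qed.

Lemma divergence_off_support C xi x : test_field C xi -> ~ field_support xi x ->
  divergence xi x = 0.
Proof.
move=> txi Hx; rewrite /divergence big1// => i _; rewrite /partial.
apply: (derive_off_support (K := field_support xi)) => //.
  exact: closed_closure.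
by move=> y; exact: test_field_coord0 txi.
Qed.

Lemma bcs_divergence C xi : test_field C xi -> bcs (divergence xi).
Proof.
move=> txi; have [_ cK _ _] := txi.
apply: bcs_continuous cK _; first exact: divergence_continuous txi.
by move=> x; exact: divergence_off_support txi.
Qed.

Lemma test_field0 C : test_field C (fun _ => 0).
Proof.
have s0 : field_support (fun _ : 'rV[R]_N => 0 : 'rV[R]_N) = set0.
  rewrite /field_support (_ : [set x | _] = set0) ?closure0//.
  by apply/seteqP; split => // x /=; rewrite eqxx.
split; rewrite ?s0//.
- move=> i k; rewrite (_ : (fun x => _) = cst 0); first exact: is_Ck_cst.
  by apply/funext => x; rewrite mxE.
- exact: compact0.
- move=> x; rewrite /enorm big1 ?sqrtr0 ?ler01// => i _.
  by rewrite mxE expr0n.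
Qed.

Lemma divergence0 : divergence (fun _ : 'rV[R]_N => 0 : 'rV[R]_N) = cst 0.
Proof.
apply/funext => x; rewrite /divergence big1// => i _.
rewrite (_ : (fun y => _) = cst 0) ?partial_cst//.
by apply/funext => y; rewrite mxE.
Qed.

Definition perim_le C E p := forall xi, test_field C xi -> intg E (divergence xi) <= p.

Lemma perim_le_ge0 C E p : perim_le C E p -> 0 <= p.
Proof.
move=> /(_ _ (@test_field0 C)); rewrite divergence0 /intg /Rintegral.
by rewrite integral0_eq.
Qed.

Lemma perimeterE C E A : lebesgue_measurable E -> measurable A -> A `<=` E ->
  volume (E `\` A) = 0%E ->
  perimeter C E = ereal_sup [set (intg A (divergence xi))%:E | xi in test_field C].
Proof.
move=> mE mA AE E0; rewrite /perimeter; congr ereal_sup; apply: eq_imagel => xi txi.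
have bd := bcs_divergence txi; have [md _] := bd.
rewrite (integral_lebesgue_kernel mA mE)// /intg /Rintegral fineK//.
exact: (integrable_fin_num mA (bcs_integrable bd mA)).
Qed.

Lemma perimeter_leP C E A p : lebesgue_measurable E -> measurable A -> A `<=` E ->
  volume (E `\` A) = 0%E -> (perimeter C E <= p%:E)%E <-> perim_le C A p.
Proof.
move=> mE mA AE E0; rewrite (perimeterE C mE mA AE E0); split => [H xi txi|H].
  rewrite -lee_fin; apply: le_trans H; apply: ereal_sup_ubound.
  by exists xi.
by apply: ub_ereal_sup => _ [xi txi <-]; rewrite lee_fin; exact: H.
Qed.

Lemma perimeter_borel_leP C A p : measurable A ->
  (perimeter C A <= p%:E)%E <-> perim_le C A p.
Proof.
move=> mA; apply: perimeter_leP => //; first exact: lebesgue_of_borel.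
by rewrite setDv volume_borel// measure0.
Qed.

Lemma perimeter_ge0 C E : lebesgue_measurable E -> (0 <= perimeter C E)%E.
Proof.
move=> mE; have [A [mA AE E0]] := borel_kernel mE.
rewrite (perimeterE C mE mA AE E0); apply: ereal_sup_ubound.
exists (fun _ => 0); first exact: test_field0.
by rewrite divergence0 /intg /Rintegral integral0_eq.
Qed.

(** [L] = N + 1 is a crude substitute for the square root of N when the sup norm is compared with
    the Euclidean one; it is positive in every dimension. *)
Lemma enorm_le1 w : (forall i, `|w ord0 i| <= L^-1) -> enorm w <= 1.
Proof.
move=> H; rewrite /enorm -[leRHS]sqrtr1; apply: ler_wsqrtr.
apply: (@le_trans _ _ (\sum_(i < N) (L^-1) ^+ 2)).
  apply: ler_sum => i _; rewrite -[leLHS]real_normK ?num_real//.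
  by rewrite lerXn2r ?nnegrE ?invr_ge0.
rewrite sumr_const card_ord -[leLHS]mulr_natl exprVn ler_pdivrMr ?exprn_gt0// mul1r.
by rewrite -natrX ler_nat expnS expn1 (leq_trans (leqnSn N))// leq_pmulr.
Qed.

Lemma direction_test C phi K w : smooth01 phi -> compact K -> K `<=` interior C ->
  (forall x, ~ K x -> phi x = 0) -> enorm w <= 1 ->
  test_field C (fun x => phi x *: w).
Proof.
move=> [sphi H01] cK KC phi0 w1.
have sub : field_support (fun x => phi x *: w) `<=` K.
  have clK : closed K by apply: compact_closed.
  rewrite /field_support [X in _ `<=` X](closure_id K).1//.
  apply: closureS => x /=; apply: contraNP => /phi0 ->; by rewrite scale0r.
split.
- move=> i k; rewrite (_ : (fun x => _) = phi \* cst (w ord0 i)).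
    by apply: is_CkM; [exact: sphi|exact: is_Ck_cst].
  by apply/funext => x; rewrite mxE.
- by apply: subclosed_compact cK sub; exact: closed_closure.
- exact: subset_trans sub KC.
- move=> x; have /andP[p0 p1] := H01 x; apply: le_trans w1.
  rewrite /enorm; apply: ler_wsqrtr; apply: ler_sum => i _.
  by rewrite mxE exprMn ler_piMl ?sqr_ge0// expr_le1.
Qed.

Lemma divergence_direction phi w : smooth01 phi ->
  divergence (fun x => phi x *: w) = fun x => 'D_w phi x.
Proof.
move=> [sphi _]; have [dphi _] := sphi 1%N.
apply/funext => x; rewrite derive_partial// /divergence.
apply: eq_bigr => i _.
rewrite (_ : (fun y => _) = cst (w ord0 i) \* phi).
  by rewrite partialM// partial_cst /= mulr0 addr0.
by apply/funext => y; rewrite mxE mulrC.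
Qed.

Lemma is_Ck_derive k phi h : is_Ck k.+1 phi -> is_Ck k (fun x => 'D_h phi x).
Proof.
move=> [dphi Hp]; rewrite (_ : (fun x => _) = fun x => \sum_i h ord0 i * partial i phi x).
  by apply: is_Ck_sum => i; apply: is_CkM; [exact: is_Ck_cst|exact: Hp].
by apply/funext => x; rewrite derive_partial.
Qed.

(** The field phi h / (L t) is admissible, because [L * t] bounds the Euclidean norm of [h], and its
    divergence is the derivative of phi along [h] divided by L t. *)
Lemma derive_direction_le C E p phi K h t : perim_le C E p -> measurable E ->
  smooth01 phi -> compact K -> K `<=` interior C ->
  (forall x, ~ K x -> phi x = 0) -> 0 < t -> (forall i, `|h ord0 i| <= t) ->
  intg E (fun x => 'D_h phi x) <= L * t * p.
Proof.
move=> pE mE sphi cK KC phi0 t0 ht.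
have Lt0 : 0 < L * t by rewrite mulr_gt0.
pose w := (L * t)^-1 *: h.
have w1 : enorm w <= 1.
  apply: enorm_le1 => i; rewrite mxE normrM gtr0_norm ?invr_gt0// invfM -mulrA.
  by rewrite ler_piMr ?invr_ge0// ler_pdivrMl// mulr1.
have txi := direction_test sphi cK KC phi0 w1.
have := pE _ txi; have bd := bcs_divergence txi.
rewrite -(ler_pM2l Lt0) -intgZ// divergence_direction//.
congr (intg _ _ <= _); apply/funext => x.
have [dphi _] := sphi.1 1%N.
rewrite !derive_partial// mulr_sumr; apply: eq_bigr => i _.
by rewrite /w mxE -[_^-1 * _ * _]mulrA mulVKf// gt_eqF.
Qed.

(** * Translation estimates *)

Lemma line_MVT phi x v e : (forall y, differentiable phi y) -> 0 <= e ->
  exists c : R, 0 <= c <= e /\ phi (x + e *: v) - phi x = e * 'D_v phi (x + c *: v).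
Proof.
move=> dphi e0.
have [||c ce H] := @MVT_segment R (fun s => phi (x + s *: v))
    (fun s => 'D_v phi (x + s *: v)) 0 e e0.
- by move=> s _; exact: is_derive_line.
- apply: continuous_subspaceT => s; apply: differentiable_continuous.
  by apply/derivable1_diffP; have [] := is_derive_line x v s dphi.
exists c; split; first by move: ce; rewrite in_itv.
by move: H; rewrite scale0r addr0 subr0 mulrC.
Qed.

Lemma derive_oppv phi x v : differentiable phi x -> 'D_(- v) phi x = - 'D_v phi x.
Proof.
move=> dphi; rewrite !derive_partial// -sumrN.
by apply: eq_bigr => i _; rewrite mxE mulNr.
Qed.

(** Two uses of the mean value theorem. The error is quadratic in [e], so that the sum over n steps
    of length 1/n is of order 1/n. *)
Lemma second_order_le phi x v (e M : R) : is_Ck 2 phi ->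
  (forall y, `|'D_v (fun z => 'D_v phi z) y| <= M) -> 0 <= e ->
  phi x - phi (x + e *: v) <= e * 'D_(- v) phi x + M * e ^+ 2.
Proof.
move=> sphi HM e0; have [dphi _] := sphi.
have [dDphi _] := is_Ck_derive v sphi.
have [c [/andP[c0 ce] Hc]] := line_MVT x v dphi e0.
have [c' [/andP[c'0 c'c] Hc']] := line_MVT x v dDphi c0.
rewrite -opprB Hc derive_oppv//.
set a : R := 'D_v phi (x + c *: v) in Hc Hc' *; set b : R := 'D_v phi x in Hc' *.
have : `|a - b| <= e * M.
  by rewrite Hc' normrM ler_pM// ger0_norm.
rewrite ler_norml => /andP[H1 _].
have : e * (b - a) <= e * (e * M) by rewrite ler_wpM2l//; lra.
rewrite mulrBr expr2 mulrN; lra.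
Qed.

Lemma aff1_scale s v : aff (const_mx 1) (s *: v) = fun x => x + s *: v.
Proof. by apply/funext => x; rewrite aff1E. Qed.

Lemma compact_shift K v : compact K -> compact [set x | K (x + v)].
Proof.
move=> cK; rewrite (_ : mkset _ = (fun y => y - v) @` K).
  apply: continuous_compact => //; apply: continuous_subspaceT => y.
  have -> : +%R^~ (- v) = aff (const_mx 1) (- v).
    by apply/funext => z; rewrite aff1E.
  exact/differentiable_continuous/differentiable_aff.
apply/seteqP; split => x /=.
  by move=> Kx; exists (x + v) => //; rewrite addrK.
by move=> [y Ky <-]; rewrite subrK.
Qed.

Lemma second_derive_bounded phi K v : is_Ck 2 phi -> compact K ->
  (forall x, ~ K x -> phi x = 0) ->
  exists2 M : R, 0 <= M & forall y, `|'D_v (fun z => 'D_v phi z) y| <= M.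
Proof.
move=> sphi cK phi0; have clK : closed K by apply: compact_closed.
apply: (continuous_supp_bounded _ cK).
  exact: (is_Ck_derive v (is_Ck_derive v sphi)).
move=> x Kx; apply: (@derive_off_support (fun z => 'D_v phi z) K) => // y Ky.
exact: (@derive_off_support phi K).
Qed.

(** The translation by [v] is divided into n small ones. Each costs its share of the flux bound plus
    a quadratic error, provided that all the intermediate translates of phi remain supported in the
    interior of [C]. *)
Lemma shift_le C E p phi K v t : perim_le C E p -> measurable E ->
  smooth01 phi -> compact K -> (forall x, ~ K x -> phi x = 0) ->
  (forall x (s : R), 0 <= s <= 1 -> K (x + s *: v) -> interior C x) ->
  0 < t -> (forall i, `|v ord0 i| <= t) ->
  intg E phi - intg E (fun x => phi (x + v)) <= L * t * p.
Proof.
move=> pE mE sphi cK phi0 KC t0 vt.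
have cphi := sphi.1 0%N.
have [M M0 HM] := second_derive_bounded v (sphi.1 2%N) cK phi0.
have [r0 r00 Kr0] := compact_ball cK.
pose r := r0 + `|v|.
pose ph s := fun x => phi (x + s *: v).
have phE s : ph s = phi \o aff (const_mx 1) (s *: v) by rewrite aff1_scale.
have sph s : smooth01 (ph s).
  split=> [k|x]; last exact: sphi.2.
  by rewrite phE; apply: is_Ck_aff; exact: sphi.1.
pose Ks s := [set x | K (x + s *: v)].
have cKs s : compact (Ks s) by exact: compact_shift.
have ph0 s x : ~ Ks s x -> ph s x = 0 by exact: phi0.
have bph s : bcs (ph s).
  apply: (bcs_continuous _ (cKs s)); first exact: ((sph s).1 0%N).
  exact: ph0.
have Ksr (s : R) : 0 <= s <= 1 -> Ks s `<=` ball 0 r.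
  move=> /andP[s0 s1] x /Kr0; rewrite -!ball_normE /= !sub0r !normrN => Hx.
  rewrite -[x](addrK (s *: v)) (le_lt_trans (ler_normB _ _))//.
  by rewrite ltr_leD// normrZ ger0_norm// ler_piMl.
pose S : set 'rV[R]_N := ball 0 r.
pose V := fine (mu (S `&` E)).
have V0 : 0 <= V by exact: fine_ge0.
have mB : measurable S by exact: measurable_rV_ball.
have bB : bcs (\1_S) by exact: (@bcs_indic _ _ _ r).
have stepH (s e : R) : 0 <= s -> 0 <= e -> s + e <= 1 ->
    intg E (ph s) - intg E (ph (s + e)) <= e * (L * t * p) + M * e ^+ 2 * V.
  move=> s0 e0 se1.
  have s01 : 0 <= s <= 1 by rewrite s0; lra.
  have bD : bcs (fun x => 'D_(- v) (ph s) x).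
    apply: (bcs_continuous _ (cKs s)).
      exact: (is_Ck_derive (- v) ((sph s).1 1%N)).
    have clK : closed (Ks s) by apply: compact_closed.
    by move=> x Kx; apply: (@derive_off_support (ph s) (Ks s)) => // y; exact: ph0.
  have Dle : intg E (fun x => 'D_(- v) (ph s) x) <= L * t * p.
    apply: (derive_direction_le pE mE (sph s) (cKs s) _ _ t0) => //.
    - by move=> x; exact: KC.
    - exact: ph0.
    by move=> i; rewrite mxE normrN.
  rewrite -intgB//.
  apply: (@le_trans _ _ (intg E ((fun x => e * 'D_(- v) (ph s) x) \+
      (fun x => (M * e ^+ 2) * \1_S x)))).
    apply: le_intg => //; [exact: bcsB|by apply: bcsD; exact: bcsZ|].
    move=> x _ /=; rewrite indicE.
    have -> : ph (s + e) x = phi (x + s *: v + e *: v) by rewrite /ph scalerDl addrA.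
    have -> : 'D_(- v) (ph s) x = 'D_(- v) phi (x + s *: v).
      by apply: eq_derive => u; rewrite /ph addrA.
    have [Bx|Bx] := boolP (x \in S).
      have -> : M * e ^+ 2 * (true%:R : R) = M * e ^+ 2 by rewrite mulr1n mulr1.
      exact: (second_order_le (x + s *: v) (sphi.1 2%N) HM e0).
    have nK u : 0 <= u <= 1 -> ~ Ks u x.
      by move=> u01 /(Ksr u u01) /mem_set; rewrite (negbTE Bx).
    have -> : M * e ^+ 2 * (false%:R : R) = 0 by rewrite mulr0n mulr0.
    have E1 : ph s x = 0 by exact: (ph0 s x (nK s s01)).
    have E2 : phi (x + s *: v + e *: v) = 0.
      rewrite -addrA -scalerDl; apply: phi0; apply: (nK (s + e)).
      by rewrite se1 addr_ge0.
    have E3 : 'D_(- v) phi (x + s *: v) = 0.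
      apply: (@derive_off_support phi K) => //; last exact: (nK s).
      exact: compact_closed.
    by rewrite E1 E2 E3 subrr mulr0 addr0.
  rewrite intgD//; [|exact: bcsZ|exact: bcsZ].
  rewrite intgZ// intgZ// (intg_indic mB (r := r))// lerD//.
  by rewrite ler_wpM2l.
(* Telescoping over n equal steps: the linear terms add up to L t p, the quadratic errors to M V /
   n. *)
have Hn n : (0 < n)%N -> intg E (ph 0) - intg E (ph 1) <= L * t * p + M * V / n%:R.
  move=> n0; have n0' : (0 : R) < n%:R by rewrite ltr0n.
  have Hk k : (k <= n)%N -> intg E (ph 0) - intg E (ph (k%:R / n%:R)) <=
      k%:R * (n%:R^-1 * (L * t * p) + M * n%:R^-1 ^+ 2 * V).
    elim: k => [|k IH] kn; first by rewrite !mul0r subrr.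
    have k0 : (0 : R) <= k%:R / n%:R by rewrite divr_ge0.
    have i0 : (0 : R) <= n%:R^-1 by rewrite invr_ge0.
    have kE : k%:R / n%:R + n%:R^-1 = k.+1%:R / n%:R :> R by rewrite -natr1 mulrDl mul1r.
    have := stepH _ _ k0 i0; rewrite kE => /(_ _)H.
    have {}H := H (_ : k.+1%:R / n%:R <= 1).
    rewrite ler_pdivrMr// mul1r ler_nat in H; have {}H := H kn.
    have -> : k.+1%:R * (n%:R^-1 * (L * t * p) + M * n%:R^-1 ^+ 2 * V) =
        k%:R * (n%:R^-1 * (L * t * p) + M * n%:R^-1 ^+ 2 * V) +
        (n%:R^-1 * (L * t * p) + M * n%:R^-1 ^+ 2 * V) by rewrite -natr1 mulrDl mul1r.
    by have := lerD (IH (ltnW kn)) H; rewrite addrA subrK.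
  have := Hk n (leqnn n); rewrite divff ?gt_eqF// => H; apply: (le_trans H).
  rewrite mulrDr mulrA divff ?gt_eqF// mul1r lerD2l.
  by apply: le_of_eq; field; rewrite gt_eqF.
have -> : intg E phi = intg E (ph 0).
  by congr intg; apply/funext => x; rewrite /ph scale0r addr0.
have -> : intg E (fun x => phi (x + v)) = intg E (ph 1).
  by congr intg; apply/funext => x; rewrite /ph scale1r.
apply/ler_addgt0Pr => e e0.
have [n Hn'] : exists n : nat, M * V / n.+1%:R <= e.
  exists (Num.bound (M * V / e)).
  have b0 : 0 <= M * V / e by rewrite divr_ge0 ?mulr_ge0// ltW.
  rewrite ler_pdivrMr// -ler_pdivrMl// mulrC ltW//.
  by apply: (lt_le_trans (archi_boundP b0)); rewrite ler_nat.
by rewrite (le_trans (Hn n.+1 _))// lerD2l.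
Qed.

Local Notation B0 r := (ball (0%R : 'rV[R]_N) (r%R : R)).

Lemma le_mu_bigcup (W : nat -> set 'rV[R]_N) (c : \bar R) : (forall n, measurable (W n)) ->
  (forall n m, (n <= m)%N -> W n `<=` W m) ->
  (forall n, (mu (W n) <= c)%E) -> (mu (\bigcup_n W n) <= c)%E.
Proof.
move=> mW hW H.
have cv : mu \o W @ \oo --> mu (\bigcup_n W n).
  apply: nondecreasing_cvg_mu => //; first exact: bigcup_measurable.
  by move=> n m nm; apply/subsetPset; exact: hW.
rewrite -(cvg_lim _ cv)//; apply: lime_le; first by apply/cvg_ex; exists (mu (\bigcup_n W n)).
by apply: nearW => n; exact: H.
Qed.

Lemma bigcup_setI_ball A : \bigcup_n (A `&` B0 n%:R) = A.
Proof.
apply/seteqP; split => x; first by move=> [n _ []].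
move=> Ax; exists (Num.bound `|x|) => //; split => //.
by rewrite -ball_normE /= sub0r normrN archi_boundP.
Qed.

Lemma le_mu_balls A (c : \bar R) : measurable A ->
  (forall n : nat, (mu (A `&` B0 n%:R) <= c)%E) -> (mu A <= c)%E.
Proof.
move=> mA H; rewrite -[X in mu X](bigcup_setI_ball A); apply: le_mu_bigcup => // [n|n m nm].
  by apply: measurableI => //; exact: measurable_rV_ball.
by apply: setIS; apply: le_ball; rewrite ler_nat.
Qed.

Definition convex_interior C := forall x y (s : R),
  interior C x -> interior C y -> 0 <= s <= 1 -> interior C (x + s *: (y - x)).

Lemma measurable_interior C : measurable (interior C).
Proof. by apply: open_rV_measurable; exact: open_interior. Qed.

(** A smooth phi close to the indicator of the set, supported where both x and x + h are interior to
    [C], is tested with [shift_le] in the direction -h. Convexity keeps the intermediate translates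
    inside, and a change of variables turns the translated integral over [E] into an integral over E
    - h. *)
Lemma translation_le C E p h t : convex_interior C -> perim_le C E p -> measurable E ->
  0 < t -> (forall i, `|h ord0 i| <= t) ->
  (mu [set x | [/\ interior C x, E x, interior C (x + h)%R & ~ E (x + h)%R]]
    <= (L * t * p)%:E)%E.
Proof.
move=> cC pE mE t0 ht.
pose E' := (fun x => x + h) @^-1` E.
pose C' := (fun x => x + h) @^-1` (interior C).
have mI := measurable_interior C.
have mE' : measurable E' by exact: measurable_preshift.
have mC' : measurable C' by exact: measurable_preshift.
have -> : [set x | [/\ interior C x, E x, interior C (x + h) & ~ E (x + h)]] =
    (interior C `&` E) `&` (C' `\` E').
  by apply/seteqP; split => x [] => [? ? ? ?|[? ?] [? ?]]; [split; split|split].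
apply: le_mu_balls.
  by apply: measurableI; [exact: measurableI|exact: measurableD].
move=> n; set A := _ `&` B0 _.
have mA : measurable A.
  apply: measurableI; last exact: measurable_rV_ball.
  by apply: measurableI; [exact: measurableI|exact: measurableD].
have [n0|n0] := leqP n 0%N.
  rewrite (_ : A = set0) ?measure0 ?lee_fin.
    by rewrite !mulr_ge0 ?(ltW t0)//; exact: perim_le_ge0 pE.
  apply/seteqP; split => // x [_ [b0 _]]; move: b0 n0.
  by rewrite leqn0 => + /eqP n0; rewrite n0 ltxx.
pose U := interior C `&` C' `&` B0 n%:R.
have oU : open U.
  apply: openI; last exact: ball_open.
  apply: openI; first exact: open_interior.
  apply: open_comp; last exact: open_interior.
  move=> x _; have -> : +%R^~ h = aff (const_mx 1) h.
    by apply/funext => z; rewrite aff1E.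
  exact/differentiable_continuous/differentiable_aff.
have Ub : U `<=` B0 n%:R by move=> x [].
have mU := open_rV_measurable oU.
have Ufin : (mu U < +oo)%E by exact: mu_bounded_fin Ub mU.
have AU : A `<=` U by move=> x [[[? ?] [? ?]] ?]; split.
have Afin : (mu A < +oo)%E by apply: mu_bounded_fin mA; exact: subset_trans AU Ub.
apply/lee_addgt0Pr => e e0; rewrite -EFinD.
have [phi [sphi [K [cK KU K0]] Hphi]] := approx_indic oU Ufin mA AU e0.
have bphi : bcs phi by apply: (bcs_continuous (sphi.1 0%N) cK).
have bA : bcs \1_A by apply: (@bcs_indic _ _ _ n%:R) => //; exact: subset_trans AU Ub.
have bd : bcs (fun x => `|phi x - \1_A x|).
  have [md [M [r Hb]]] := bcsB bphi bA; split.
    by apply: measurableT_comp md.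
  by exists M, r => x; rewrite normr_id normr_eq0; exact: Hb.
have H1 : intg E phi - intg E' phi <= L * t * p.
  have := @shift_le C E p phi K (- h) t pE mE sphi cK K0.
  have -> : (fun x => phi (x + - h)) = phi \o aff (const_mx 1) (- h).
    by apply/funext => x; rewrite /= aff1E.
  have -> : intg E (phi \o aff (const_mx 1) (- h)) = intg E' phi.
    rewrite (_ : E = aff (const_mx 1) (- h) @^-1` E').
      rewrite intg_aff//; last by move=> i; rewrite mxE.
      by rewrite big1 ?mul1r// => i _; rewrite mxE invr1.
    by apply/seteqP; split => x; rewrite /E' /= aff1E subrK.
  apply => //.
    move=> x s s01 /KU[[KI KC'] _].
    have := cC _ _ s KI KC' s01.
    have -> : x + s *: - h + h - (x + s *: - h) = h by rewrite addrAC subrr add0r.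
    by rewrite scalerN subrK.
  by move=> i; rewrite mxE normrN.
have Hd : intg setT (fun x => `|phi x - \1_A x|) <= e.
  have -> : (fun x => `|phi x - \1_A x|) = (fun x => `|phi x - \1_A x| * \1_U x).
    apply/funext => x; rewrite [\1_U x]indicE.
    have [Ux|Ux] := pselect (U x); first by rewrite (mem_set Ux) mulr1.
    have Ax : ~ A x by move=> /AU.
    have Kx : ~ K x by move=> /KU.
    by rewrite (memNset Ux) indicE (memNset Ax) K0// subrr normr0 mul0r.
  rewrite -intg_mkcond /intg /Rintegral -lee_fin fineK//.
  exact: (integrable_fin_num mU (bcs_integrable bd mU)).
have b1 := bcs_restr bphi mE; have b2 := bcs_restr bphi mE'.
rewrite -(fineK (_ : mu A \is a fin_num)) ?lee_fin; last by rewrite ge0_fin_numE.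
have -> : fine (mu A) = intg setT \1_A.
  by rewrite (intg_indic mA (subset_trans AU Ub))// setIT.
(* Pointwise, 1_A <= phi (1_E - 1_E') + |phi - 1_A|: on the support of phi the set [A] is E minus
   E', and the negative contribution of E' minus E is absorbed by the last term, since 1_A vanishes
   there. *)
apply: (@le_trans _ _ (intg setT (((fun x => phi x * \1_E x) \- (fun x => phi x * \1_E' x)) \+
   (fun x => `|phi x - \1_A x|)))).
  apply: le_intg => //; first by apply: bcsD => //; exact: bcsB.
  move=> x _ /=; have /andP[p0 p1] := sphi.2 x.
  have [Kx|Kx] := pselect (K x); last first.
    rewrite K0// !mul0r subrr add0r sub0r normrN [in leRHS]ger0_norm//.
  have [[Ix C'x] Bx] := KU x Kx.
  have AE : A x <-> E x /\ ~ E' x.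
    by split => [[[[_ ?] [_ ?]] _]|[? ?]].
  rewrite !indicE; have [Ex|Ex] := pselect (E x); have [E'x|E'x] := pselect (E' x).
  - have Ax : ~ A x by move=> /AE[].
    rewrite (mem_set Ex) (mem_set E'x) (memNset Ax) subrr add0r; exact: normr_ge0.
  - have Ax : A x by apply/AE.
    rewrite (mem_set Ex) (memNset E'x) (mem_set Ax) /= mulr1 mulr0 subr0.
    rewrite distrC ger0_norm ?subr_ge0//; lra.
  - have Ax : ~ A x by move=> /AE[].
    rewrite (memNset Ex) (mem_set E'x) (memNset Ax) /= mulr1 mulr0 subr0 ger0_norm//; lra.
  - have Ax : ~ A x by move=> /AE[].
    rewrite (memNset Ex) (memNset E'x) (memNset Ax) subrr add0r; exact: normr_ge0.
rewrite intgD//; last exact: bcsB.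
rewrite intgB// -!intg_mkcond; exact: lerD.
Qed.

(* Tonelli on the set of pairs (x, h) with x in S, |h| < d and x + h in B. *)
Lemma tonelli_shift S B (d c M : R) : measurable S -> measurable B -> 0 < d -> 0 <= c ->
  (forall h, B0 d h -> (mu [set x | S x /\ B (x + h)%R] <= M%:E)%E) ->
  (forall x, S x -> (c%:E <= mu (ball x d `&` B))%E) ->
  (c%:E * mu S <= ((2 * d) ^+ N * M)%:E)%E.
Proof.
move=> mS mB d0 c0 HM Hc.
pose D : set ('rV[R]_N * 'rV[R]_N) := [set z | [/\ S z.1, B0 d z.2 & B (z.1 + z.2)]].
have madd : measurable_fun setT (fun z : 'rV[R]_N * 'rV[R]_N => z.1 + z.2).
  apply: measurable_fun_rV => i.
  rewrite (_ : _ \o _ = (rV_coord i \o fst) \+ (rV_coord i \o snd)).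
    apply: measurable_funD; apply: measurableT_comp => //; exact: measurable_rV_coord.
  by apply/funext => z; rewrite /= /rV_coord mxE.
have mD : measurable D.
  have -> : D = (S `*` B0 d) `&` ((fun z => z.1 + z.2) @^-1` B).
    by apply/seteqP; split => z [] => [? ? ?|[? ?] ?]; split.
  apply: measurableI; first by apply: measurableX => //; exact: measurable_rV_ball.
  by rewrite -[X in measurable X]setTI; exact: madd.
have E := indic_fubini_tonelli mu mu mD.
rewrite indic_fubini_tonelli_FE// indic_fubini_tonelli_GE// in E.
apply: (@le_trans _ _ (\int[mu]_x (mu \o xsection D) x)%E).
  rewrite -[X in (_ * mu X)%E](setIT S) -integral_indic// -ge0_integralZl//; last first.
    exact/measurable_EFinP/measurable_indic.
  apply: ge0_le_integral => //.
  - by move=> x _; rewrite mule_ge0.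
  - apply: measurable_funeM; exact/measurable_EFinP/measurable_indic.
  - exact: measurable_fun_xsection.
  move=> x _; rewrite indicE /=.
  have [Sx|Sx] := pselect (S x); last by rewrite (memNset Sx) mule0.
  rewrite (mem_set Sx) mule1; apply: (le_trans (Hc x Sx)).
  have -> : xsection D x = (fun h => h + x) @^-1` (ball x d `&` B).
    rewrite /xsection; apply/seteqP; split => h /=.
      rewrite in_setE => -[/= _ bh Bh]; split; last by rewrite addrC.
      by move: bh; rewrite -!ball_normE /= sub0r normrN opprD addrCA subrr addr0 normrN.
    move=> [bh Bh]; rewrite in_setE; split => //=; last by rewrite addrC.
    by move: bh; rewrite -!ball_normE /= sub0r normrN opprD addrCA subrr addr0 normrN.
  rewrite borel_lebesgue_shift//; apply: measurableI => //; exact: measurable_rV_ball.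
rewrite E.
apply: (@le_trans _ _ (\int[mu]_h (M%:E * (\1_(B0 d) h)%:E))%E); last first.
  rewrite ge0_integralZl//; last 2 first.
  - by apply/measurable_EFinP; apply: measurable_indic; exact: measurable_rV_ball.
  - have := HM 0 (ballxx 0 d0); apply: le_trans; exact: measure_ge0.
  rewrite integral_indic//; last exact: measurable_rV_ball.
  rewrite setIT mulrC EFinM -(borel_lebesgue_ball (0 : 'rV[R]_N) d0); exact: lexx.
apply: ge0_le_integral => //.
- exact: measurable_fun_ysection.
- apply: measurable_funeM; apply/measurable_EFinP; apply: measurable_indic; exact: measurable_rV_ball.
move=> h _; rewrite indicE /=.
have [bh|bh] := pselect (B0 d h); last first.
  rewrite (memNset bh) mule0 (_ : ysection D h = set0) ?measure0//.
  apply/seteqP; split => // x; rewrite /ysection /= in_setE => -[] //.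
rewrite (mem_set bh) mule1; apply: le_trans (HM h bh); apply: le_measure.
- by rewrite inE; exact: measurable_ysection.
- rewrite inE; apply: measurableI => //; exact: measurable_preshift.
- by move=> x; rewrite /ysection /= in_setE => -[].
Qed.

(** * Nonlocal estimates *)

(** Pairs (x, h) with x in [S] and x + h in the complement are counted twice: each x has at least
    volume [c] of such h, while each of the h, which fill a cube of volume (2d)^N, has at most
    volume L d p of such x. *)
Lemma nonlocal_out C E S p (d c : R) : convex_interior C -> perim_le C E p ->
  measurable E -> measurable S -> S `<=` interior C `&` E -> 0 < d -> 0 <= c ->
  (forall x, S x -> (c%:E <= mu (ball x d `&` (interior C `\` E)))%E) ->
  (c%:E * mu S <= ((2 * d) ^+ N * (L * d * p))%:E)%E.
Proof.
move=> cC pE mE mS SE d0 c0 Hc.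
have mI := measurable_interior C.
apply: (tonelli_shift mS _ d0 c0 _ Hc); first exact: measurableD.
move=> h /(rV_ballP _ _ d0) hd.
have ht i : `|h ord0 i| <= d by have := hd i; rewrite mxE sub0r normrN => /ltW.
apply: le_trans (translation_le cC pE mE d0 ht); apply: le_measure; rewrite ?inE.
- apply: measurableI => //; apply: measurable_preshift; exact: measurableD.
- rewrite (_ : mkset _ = (interior C `&` E) `&`
     ((fun x => x + h) @^-1` (interior C `\` E))).
    apply: measurableI; first exact: measurableI.
    by apply: measurable_preshift; exact: measurableD.
  by apply/seteqP; split => x [] => [? ? ? ?|[? ?] [? ?]]; [split; split|split].
- by move=> x [/SE[? ?] [? ?]]; split.
Qed.

(** The same count with the two sides exchanged: the translation by -h starts in [E] and lands in
    [S]. *)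
Lemma nonlocal_in C E S p (d c : R) : convex_interior C -> perim_le C E p ->
  measurable E -> measurable S -> S `<=` interior C `\` E -> 0 < d -> 0 <= c ->
  (forall x, S x -> (c%:E <= mu (ball x d `&` (interior C `&` E)))%E) ->
  (c%:E * mu S <= ((2 * d) ^+ N * (L * d * p))%:E)%E.
Proof.
move=> cC pE mE mS SE d0 c0 Hc.
have mI := measurable_interior C.
apply: (tonelli_shift mS _ d0 c0 _ Hc); first exact: measurableI.
move=> h /(rV_ballP _ _ d0) hd.
have ht i : `|(- h) ord0 i| <= d by have := hd i; rewrite !mxE sub0r => /ltW.
pose F := [set x | [/\ interior C x, E x, interior C (x - h) & ~ E (x - h)]].
have mF : measurable F.
  rewrite (_ : F = (interior C `&` E) `&`
     ((fun x => x - h) @^-1` (interior C `\` E))).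
    apply: measurableI; first exact: measurableI.
    by apply: measurable_preshift; exact: measurableD.
  by apply/seteqP; split => x [] => [? ? ? ?|[? ?] [? ?]]; [split; split|split].
apply: le_trans (translation_le cC pE mE d0 ht); rewrite -/F.
rewrite -(borel_lebesgue_shift h mF); apply: le_measure; rewrite ?inE.
- apply: measurableI => //; apply: measurable_preshift; exact: measurableI.
- exact: measurable_preshift.
- by move=> x [/SE[? ?] [? ?]]; split; rewrite ?addrK.
Qed.

End perimeter_bounds.

(** * Cutting and stretching *)

Section bisection.
Context {R : realType}.

(** One half of an interval always has slope at most that of the whole; keeping it repeatedly gives
    nested intervals shrinking to [t]. Applied to the volume inside spheres, this plays the role of
    choosing a radius with a good derivative. *)
Lemma bisect (m : R -> R) (a b : R) : a < b ->
  exists t, a <= t <= b /\ forall e : R, 0 < e -> exists a' b' : R,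
    [/\ a <= a' <= t, t <= b' <= b, a' < b' & b' - a' <= e] /\
    m b' - m a' <= (m b - m a) / (b - a) * (b' - a').
Proof.
move=> ab; set s := (m b - m a) / (b - a).
pose F (q : R * R) := let c := (q.1 + q.2) / 2 in
  if m c - m q.1 <= s * (c - q.1) then (q.1, c) else (c, q.2).
pose u n := iter n F (a, b).
have uS n : u n.+1 = F (u n) by [].
have inv n : [/\ (u n).1 < (u n).2, (u n).2 - (u n).1 = (b - a) / 2 ^+ n &
    m (u n).2 - m (u n).1 <= s * ((u n).2 - (u n).1)].
  elim: n => [|n [IH1 IH2 IH3]].
    by rewrite /u /= expr0 divr1; split => //; rewrite /s divfK// gt_eqF// subr_gt0.
  rewrite uS /F; case: ifPn => [H|] /=.
    split; [lra| |by []].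
    by rewrite exprSr invfM mulrA -IH2; lra.
  rewrite -ltNge => H; split; [lra| |lra].
  by rewrite exprSr invfM mulrA -IH2; lra.
have monoS n : (u n).1 <= (u n.+1).1 /\ (u n.+1).2 <= (u n).2.
  by have [H _ _] := inv n; rewrite uS /F; case: ifPn => _ /=; split; lra.
have mono n k : (u n).1 <= (u (n + k)%N).1 /\ (u (n + k)%N).2 <= (u n).2.
  elim: k => [|k [IH1 IH2]]; first by rewrite addn0.
  rewrite addnS; have [H1 H2] := monoS (n + k)%N; split.
    exact: le_trans IH1 H1.
  exact: le_trans H2 IH2.
have cross n k : (u n).1 <= (u k).2.
  have [H1 _] := mono n k; have [_ H2] := mono k n.
  have [H3 _ _] := inv (n + k)%N.
  by rewrite (le_trans H1)// (le_trans (ltW H3))// addnC.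
pose A := [set (u n).1 | n in [set: nat]].
have supA : has_sup A.
  split; first by exists (u 0%N).1; exists 0%N.
  by exists (u 0%N).2 => _ [n _ <-].
pose t := sup A.
have t1 n : (u n).1 <= t by apply: ub_le_sup; [case: supA|exists n].
have t2 n : t <= (u n).2 by apply: ge_sup; [case: supA|move=> _ [k _ <-]].
exists t; split; first by rewrite (t1 0%N) (t2 0%N).
move=> e e0.
have ba0 : 0 < b - a by rewrite subr_gt0.
have [n Hn] : exists n : nat, (b - a) / 2 ^+ n <= e.
  exists (Num.bound ((b - a) / e)).
  have b0 : 0 <= (b - a) / e by rewrite divr_ge0// ltW.
  rewrite ler_pdivrMr ?exprn_gt0// -ler_pdivrMl// mulrC ltW//.
  apply: (lt_le_trans (archi_boundP b0)).
  by rewrite -natrX ler_nat ltnW// ltn_expl.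
have [I1 I2 I3] := inv n; exists (u n).1, (u n).2; split => //.
have [M1 M2] := mono 0%N n; rewrite add0n in M1 M2.
by split => //; [rewrite t1 andbT|rewrite t2|rewrite I2].
Qed.

(** Outside ]0, 1[ the function [step] attains its maximum 1 or its minimum 0, which covers the
    endpoints as well. *)
Lemma step_derive_out (s : R) : s <= 0 \/ 1 <= s -> derive1 (@step R) s = 0.
Proof.
have ds x : derivable (@step R) x 1 := (@is_C1k_step R 1).1 x.
have ss : s \in `](s - 1), (s + 1)[ by rewrite in_itv /=; apply/andP; split; lra.
have s11 : s - 1 <= s + 1 by lra.
rewrite derive1E; case=> H.
  have Hm (x : R) : x \in `](s - 1), (s + 1)[ -> step x <= step s.
    by move=> _; rewrite (step_le0 H) step_le1.
  by have [_ ->] := derive1_at_max s11 (fun x _ => ds x) ss Hm.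
have Hm (x : R) : x \in `](s - 1), (s + 1)[ -> step s <= step x.
  by move=> _; rewrite (step_ge1 H) step_ge0.
by have [_ ->] := derive1_at_min s11 (fun x _ => ds x) ss Hm.
Qed.

End bisection.

Section cut.
Context {R : realType} {N : nat}.
Local Notation mu := (borel_lebesgue_rV N).
Local Notation L := (N.+1%:R : R).
Implicit Types (A B C E K S U : set 'rV[R]_N) (p s t : R).
Implicit Types (c x y v w h : 'rV[R]_N).

Definition EB c t : set 'rV[R]_N := [set x | sqd c x < t ^+ 2].

Lemma measurable_EB c t : measurable (EB c t).
Proof.
apply: open_rV_measurable; rewrite (_ : EB c t = sqd c @^-1` [set y | y < t ^+ 2]) //.
apply: open_comp; last exact: open_lt.
by move=> x _; exact: (is_Ck_sqd 0 c x).
Qed.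

Lemma EB_homo c s t : 0 <= s -> s <= t -> EB c s `<=` EB c t.
Proof.
move=> s0 st x /lt_le_trans; apply; rewrite lerXn2r// nnegrE//.
exact: le_trans st.
Qed.

Lemma EB_bounded c t : exists r : R, EB c t `<=` ball 0 r.
Proof.
have [r _ Hr] := compact_ball (@eball_compact _ _ c t).
by exists r => x /ltW /Hr.
Qed.

Lemma EB_ball c t : 0 < t -> EB c t `<=` ball c t.
Proof.
move=> t0 x Hx; apply/(rV_ballP _ _ t0) => i.
exact: (sqd_sup (ltW t0) Hx).
Qed.

Lemma ball_EB c t : 0 < t -> ball c (t / L) `<=` EB c t.
Proof.
move=> t0 x; have tL : 0 < t / L by rewrite divr_gt0.
move=> /(rV_ballP _ _ tL) H; rewrite /EB /=.
apply: (@le_lt_trans _ _ (N%:R * (t / L) ^+ 2)).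
  by apply: sup_sqd => i; exact: ltW.
rewrite expr_div_n mulrCA gtr_pMr ?exprn_gt0// ltr_pdivrMr ?exprn_gt0// mul1r.
by rewrite -natrX ltr_nat expnS expn1 (leq_trans (ltnSn N))// leq_pmulr.
Qed.

Lemma enorm_coord w i : enorm w <= 1 -> `|w ord0 i| <= 1.
Proof.
move=> H; apply: le_trans H; rewrite /enorm -sqrtr_sqr; apply: ler_wsqrtr.
by rewrite (bigD1 i)//= lerDl sumr_ge0// => j _; exact: sqr_ge0.
Qed.

Lemma test_field_mix C psi xi1 xi2 : smooth01 psi -> test_field C xi1 ->
  test_field C xi2 -> test_field C (fun x => psi x *: xi1 x + (1 - psi x) *: xi2 x).
Proof.
move=> spsi [s1 c1 k1 n1] [s2 c2 k2 n2].
have sub : field_support (fun x => psi x *: xi1 x + (1 - psi x) *: xi2 x) `<=`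
    field_support xi1 `|` field_support xi2.
  rewrite /field_support -closureU; apply: closureS => x /=.
  have [->|] := eqVneq (xi1 x) 0; last by left.
  have [->|] := eqVneq (xi2 x) 0; last by right.
  by rewrite !scaler0 addr0 eqxx.
split.
- move=> i k; rewrite (_ : (fun x => _) =
    (psi \* (fun x => xi1 x ord0 i)) \+ ((fun x => 1 - psi x) \* (fun x => xi2 x ord0 i))).
    apply: is_CkD; apply: is_CkM => //; [exact: spsi.1|].
    exact: (smooth01C spsi).1.
  by apply/funext => x; rewrite !mxE.
- apply: subclosed_compact sub; [exact: closed_closure|exact: compactU].
- by move=> x /sub [/k1|/k2].
move=> x; have /andP[p0 p1] := spsi.2 x.
rewrite /enorm -[leRHS]sqrtr1; apply: ler_wsqrtr.
have F1 : \sum_i (xi1 x ord0 i) ^+ 2 <= 1.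
  have := n1 x; rewrite /enorm -{1}sqrtr1 ler_psqrt// qualifE /= ?sumr_ge0// => i _.
  exact: sqr_ge0.
have F2 : \sum_i (xi2 x ord0 i) ^+ 2 <= 1.
  have := n2 x; rewrite /enorm -{1}sqrtr1 ler_psqrt// qualifE /= ?sumr_ge0// => i _.
  exact: sqr_ge0.
apply: (@le_trans _ _ (psi x * \sum_i (xi1 x ord0 i) ^+ 2 +
    (1 - psi x) * \sum_i (xi2 x ord0 i) ^+ 2)); last first.
  have := ler_wpM2l p0 F1; have q0 : 0 <= 1 - psi x by rewrite subr_ge0.
  by have := ler_wpM2l q0 F2; lra.
rewrite !mulr_sumr -big_split /=; apply: ler_sum => i _; rewrite !mxE.
move: (xi1 x ord0 i : R) (xi2 x ord0 i : R) => u v; set q := psi x in p0 p1 *.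
have : 0 <= q * (1 - q) * (u - v) ^+ 2.
  by rewrite mulr_ge0 ?sqr_ge0// mulr_ge0// subr_ge0.
by rewrite -subr_ge0 => /le_trans; apply; apply: le_of_eq; ring.
Qed.

Lemma divergence_mix C psi xi1 xi2 x : smooth01 psi -> test_field C xi1 ->
  test_field C xi2 ->
  divergence (fun x => psi x *: xi1 x + (1 - psi x) *: xi2 x) x =
  psi x * divergence xi1 x + (1 - psi x) * divergence xi2 x +
  \sum_i partial i psi x * (xi1 x ord0 i - xi2 x ord0 i).
Proof.
move=> spsi [s1 _ _ _] [s2 _ _ _].
have [dp _] := spsi.1 1%N.
rewrite /divergence !mulr_sumr -!big_split /=; apply: eq_bigr => i _.
have [d1 _] := s1 i 1%N; have [d2 _] := s2 i 1%N.
have -> : (fun y => (psi y *: xi1 y + (1 - psi y) *: xi2 y) ord0 i) =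
    (psi \* (fun x => xi1 x ord0 i)) \+
    ((cst 1 \+ (cst (-1) \* psi)) \* (fun x => xi2 x ord0 i)).
  by apply/funext => y; rewrite !mxE /= mulN1r.
have dm1 y : differentiable (cst (-1) \* psi : 'rV[R]_N -> R) y.
  by apply: differentiableM; [exact: differentiable_cst|exact: dp].
have dm2 y : differentiable (cst 1 \+ (cst (-1) \* psi) : 'rV[R]_N -> R) y.
  by apply: differentiableD; [exact: differentiable_cst|exact: dm1].
rewrite partialD; last 2 first.
- by move=> y; apply: differentiableM; [exact: dp|exact: d1].
- by move=> y; apply: differentiableM; [exact: dm2|exact: d2].
rewrite partialM// partialM// partialD// partialM//.
rewrite !partial_cst /= ; ring.
Qed.

Lemma cutoff_gradient_bound : exists2 A0 : R, 0 < A0 &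
  forall c (a b : R) x v w, 0 <= a -> a < b -> enorm v <= 1 -> enorm w <= 1 ->
  `|\sum_i partial i (cutoff c a b) x * (v ord0 i - w ord0 i)| <=
    A0 / (b - a) * \1_(EB c b `\` EB c a) x.
Proof.
have [A0 A00 HA0] := @step_derive_bound R.
(* In each coordinate the derivative is at most A0 2b / (b^2 - a^2) <= 2 A0 / (b - a) and the two
   fields differ by at most 2; then at most [L] coordinates are summed. *)
exists (4 * L * A0) => [|c a b x v w a0 ab v1 w1]; first by rewrite !mulr_gt0.
have b0 : 0 < b by exact: le_lt_trans ab.
have ab2 : 0 < b ^+ 2 - a ^+ 2 by rewrite subr_gt0 ltrXn2r// ltW.
have ba0 : 0 < b - a by rewrite subr_gt0.
have [Sx|Sx] := pselect ((EB c b `\` EB c a) x); last first.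
  rewrite indicE (memNset Sx) mulr0 big1 ?normr0// => i _.
  rewrite partial_cutoff step_derive_out ?mul0r//.
  have [xa|xa] := ltP (sqd c x) (a ^+ 2).
    by left; rewrite pmulr_lle0 ?invr_gt0// subr_le0 ltW.
  right; rewrite ler_pdivlMr// mul1r lerD2r leNgt; apply/negP => xb.
  by apply: Sx; split => //=; apply/negP; rewrite -leNgt.
rewrite indicE (mem_set Sx) mulr1.
have xb : sqd c x < b ^+ 2 by case: Sx.
apply: (@le_trans _ _ (\sum_(i < N) 4 * A0 / (b - a))); last first.
  rewrite sumr_const card_ord -[leLHS]mulr_natl mulrA ler_pM2r ?invr_gt0//.
  rewrite mulrA [4 * L]mulrC ler_pM2r// ler_pM2r// ler_nat.
  exact: leqnSn.
apply: (le_trans (ler_norm_sum _ _ _)); apply: ler_sum => i _.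
rewrite partial_cutoff !normrM.
have h1 : `|v ord0 i - w ord0 i| <= 2.
  rewrite (le_trans (ler_normB _ _))//.
  by have := lerD (enorm_coord i v1) (enorm_coord i w1).
have h2 : `|x ord0 i - c ord0 i| <= b.
  by rewrite distrC ltW// (sqd_sup (ltW b0) xb).
have h3 : `|(b ^+ 2 - a ^+ 2)^-1| = (b - a)^-1 * (b + a)^-1.
  by rewrite gtr0_norm ?invr_gt0// -invfM subr_sqr.
rewrite h3 (@ger0_norm _ 2)//.
have h4 : b * (b + a)^-1 <= 1 by rewrite ler_pdivrMr ?mul1r ?lerDl// ltr_wpDr.
have i1 : 0 <= (b - a)^-1 by rewrite invr_ge0 ltW.
have i2 : 0 <= (b + a)^-1 by rewrite invr_ge0 addr_ge0// ltW.
apply: (@le_trans _ _ (A0 * (2 * b * ((b - a)^-1 * (b + a)^-1)) * 2)).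
  apply: ler_pM => //; first by rewrite !mulr_ge0.
  apply: ler_pM => //; first by rewrite !mulr_ge0.
  by rewrite ler_wpM2r ?mulr_ge0// ler_wpM2l.
have -> : A0 * (2 * b * ((b - a)^-1 * (b + a)^-1)) * 2 =
    4 * A0 / (b - a) * (b * (b + a)^-1) by ring.
by rewrite ler_piMr// !mulr_ge0// ltW.
Qed.

(** The field psi xi1 + (1 - psi) xi2 is admissible for [E]. It differs from using xi1 inside the
    sphere and xi2 outside only in the shell between radii [a] and [b], where the error consists of
    the gradient of psi and of the difference of the divergences. *)
Lemma soft_cut (A0 : R) C E p c a t b xi1 xi2 :
  (forall c (a b : R) x v w, 0 <= a -> a < b -> enorm v <= 1 -> enorm w <= 1 ->
  `|\sum_i partial i (cutoff c a b) x * (v ord0 i - w ord0 i)| <=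
    A0 / (b - a) * \1_(EB c b `\` EB c a) x) -> 0 < A0 ->
  perim_le C E p -> measurable E -> 0 <= a -> a < b -> a <= t <= b ->
  test_field C xi1 -> test_field C xi2 ->
  forall D : R, (forall x, `|divergence xi1 x - divergence xi2 x| <= D) ->
  intg (E `&` EB c t) (divergence xi1) + intg (E `\` EB c t) (divergence xi2) <=
  p + (A0 / (b - a) + D) * fine (mu (E `&` (EB c b `\` EB c a))).
Proof.
move=> HA A00 pE mE a0 ab /andP[ta tb] t1 t2 D HD.
have b0 : 0 < b by exact: le_lt_trans ab.
have D0 : 0 <= D by apply: le_trans (HD 0).
have ba0 : 0 < b - a by rewrite subr_gt0.
set psi := cutoff c a b.
have spsi : smooth01 psi by split=> [k|x]; [exact: is_Ck_cutoff|exact: cutoff01].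
pose eta x := psi x *: xi1 x + (1 - psi x) *: xi2 x.
have teta : test_field C eta by exact: test_field_mix.
have mEB s : measurable (EB c s) by exact: measurable_EB.
pose S := EB c b `\` EB c a.
have mS : measurable S by exact: measurableD.
have [r Sr] : exists r : R, S `<=` ball 0 r.
  by have [r Hr] := EB_bounded c b; exists r => x [/Hr].
have bd1 := bcs_divergence t1; have bd2 := bcs_divergence t2.
have bde := bcs_divergence teta.
have bS : bcs \1_S by apply: (@bcs_indic _ _ _ r).
have mEt : measurable (E `&` EB c t) by exact: measurableI.
have mEct : measurable (E `\` EB c t) by exact: measurableD.
have UE : (E `&` EB c t) `|` (E `\` EB c t) = E by rewrite setUIDK.
have DE : (E `&` EB c t) `&` (E `\` EB c t) = set0.
  by apply/seteqP; split => // x [[_ ?] [_ ?]].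
have He := pE _ teta.
pose g := (fun x => divergence eta x + (A0 / (b - a) + D) * \1_S x).
have bg : bcs g by apply: bcsD => //; exact: bcsZ.
have key x : (EB c t x -> divergence xi1 x <= g x) /\ (~ EB c t x -> divergence xi2 x <= g x).
  have H1 := HA c a b x (xi1 x) (xi2 x) a0 ab; move: H1; rewrite -/psi -/S => H1.
  have {}H1 := H1 (let: And4 _ _ _ n1 := t1 in n1 x) (let: And4 _ _ _ n2 := t2 in n2 x).
  have H2 := HD x; rewrite /g (divergence_mix x spsi t1 t2).
  move: H1 H2; set G := \sum_i _; move: (divergence xi1 x) (divergence xi2 x) => u v.
  rewrite indicE; have [Sx|Sx] := pselect (S x).
    rewrite (mem_set Sx) !mulr1 !ler_norml => /andP[G1 G2] /andP[D1 D2].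
    have /andP[p0 p1] := spsi.2 x.
    by split => _; nra.
  rewrite (memNset Sx) !mulr0 addr0 normr_le0 => /eqP -> _.
  have [xa|xa] := ltP (sqd c x) (a ^+ 2).
    have -> : psi x = 1 by apply: cutoff_in => //; exact: ltW.
    split => [_|]; first by rewrite mul1r subrr mul0r !addr0.
    by case; apply: EB_homo xa.
  have xb : b ^+ 2 <= sqd c x.
    rewrite leNgt; apply/negP => xb; apply: Sx; split => //=.
    by apply/negP; rewrite -leNgt.
  have -> : psi x = 0 by exact: cutoff_out.
  split => [xt|_]; last by rewrite mul0r subr0 mul1r add0r addr0.
  have xtb : EB c b x by apply: EB_homo xt => //; exact: le_trans ta.
  by move: xb; rewrite leNgt xtb.
apply: (@le_trans _ _ (intg E g)).
  rewrite -[in leRHS]UE intgU//; apply: lerD; apply: le_intg => // x [_ xt].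
    exact: (key x).1.
  exact: (key x).2.
rewrite intgD//; last exact: bcsZ.
rewrite intgZ// (intg_indic mS Sr)// [S `&` E]setIC.
by rewrite lerD2r.
Qed.

(** The estimate P(E in the ball) + P(E outside) <= P(E) + A0 |E in the larger ball| / (b - a),
    written on pairs of fields. The radius is chosen before the fields, so suprema over the two
    fields can be taken separately. *)
Definition cut_const (A0 : R) := forall C E p c (a b : R), perim_le C E p -> measurable E ->
  0 <= a -> a < b -> exists t, [/\ a <= t, t <= b &
    forall xi1 xi2, test_field C xi1 -> test_field C xi2 ->
    intg (E `&` EB c t) (divergence xi1) + intg (E `\` EB c t) (divergence xi2) <=
    p + A0 * fine (mu (E `&` EB c b)) / (b - a)].

(** [soft_cut] is applied in shells shrinking to the radius given by [bisect]. The gradient term is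
    then controlled by the average slope of the volume, and the divergence term vanishes with the
    width of the shell. *)
Lemma cut_constP : exists2 A0 : R, 0 < A0 & cut_const A0.
Proof.
have [A0 A00 HA] := cutoff_gradient_bound.
exists A0 => // C E p c a b pE mE a0 ab.
pose m t := fine (mu (E `&` EB c t)).
have mEB s : measurable (EB c s) by exact: measurable_EB.
have fm t : mu (E `&` EB c t) \is a fin_num.
  rewrite ge0_fin_numE//; have [r Hr] := EB_bounded c t.
  apply: (@mu_bounded_fin _ _ _ 0 r); last exact: measurableI.
  by move=> x [_ /Hr].
have [t [/andP[ta tb] Ht]] := bisect m ab.
exists t; split => // xi1 xi2 t1 t2.
have b1 := bcs_divergence t1; have b2 := bcs_divergence t2.
have [_ [D [r HD]]] := bcsB b1 b2.
have HD' x : `|divergence xi1 x - divergence xi2 x| <= D by have [] := HD x.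
have D0 : 0 <= D by apply: le_trans (HD' 0).
have ba0 : 0 < b - a by rewrite subr_gt0.
have ma0 s : 0 <= m s by exact: fine_ge0.
have ms : (m b - m a) / (b - a) <= m b / (b - a).
  by rewrite ler_pM2r ?invr_gt0// gerBl.
have mdiff s u : 0 <= s -> s <= u -> fine (mu (E `&` (EB c u `\` EB c s))) = m u - m s.
  move=> s0 su; have -> : E `&` (EB c u `\` EB c s) = (E `&` EB c u) `\` (E `&` EB c s).
    apply/seteqP; split => x; first by move=> [Ex [ux sx]]; split => // -[].
    by move=> [[Ex ux] sx]; split => //; split => // sx'; apply: sx.
  have sub : E `&` EB c s `<=` E `&` EB c u by apply: setIS; exact: EB_homo.
  rewrite measureD//; [|exact: measurableI|exact: measurableI|]; last first.
    by rewrite ltey_eq fm.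
  by rewrite (setIidr sub); exact: (fineB (fm u) (fm s)).
apply/ler_addgt0Pr => e e0.
have s0 : 0 <= m b / (b - a) by rewrite divr_ge0// ltW.
have K0 : 0 < D * (m b / (b - a)) + 1 by rewrite ltr_wpDl// mulr_ge0.
(* This width makes the term with [D] at most [e]. [D] depends on the fields, but the radius [t] has
   already been fixed. *)
have [a' [b' [[/andP[aa' a't] /andP[tb' b'b] a'b' b'a'] Hm]]] := Ht (e / (D * (m b / (b - a)) + 1)) (divr_gt0 e0 K0).
have a'0 : 0 <= a' by exact: le_trans aa'.
have := @soft_cut A0 C E p c a' t b' xi1 xi2 HA A00 pE mE a'0 a'b' _ t1 t2 D HD'.
rewrite a't tb' => /(_ isT) H; apply: (le_trans H); rewrite -addrA lerD2l.
rewrite mdiff//; last exact: ltW.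
have d0 : 0 < b' - a' by rewrite subr_gt0.
have Hm' : m b' - m a' <= m b / (b - a) * (b' - a').
  by apply: (le_trans Hm); rewrite ler_wpM2r// ltW.
have c0 : 0 <= A0 / (b' - a') + D by rewrite addr_ge0// divr_ge0// ltW.
apply: (le_trans (ler_wpM2l c0 Hm')); rewrite mulrDl.
have -> : A0 / (b' - a') * (m b / (b - a) * (b' - a')) = A0 * m b / (b - a).
  by field; rewrite !gt_eqF.
rewrite lerD2l mulrA; apply: (@le_trans _ _ ((D * (m b / (b - a)) + 1) * (b' - a'))).
  by rewrite ler_wpM2r ?(ltW d0)// lerDl.
by rewrite mulrC -ler_pdivlMr.
Qed.

(* The stretched set is written as the preimage under the inverse contraction. *)
Lemma stretch_le C E p (d h : 'rV[R]_N) : (forall i, 0 < d ord0 i <= 1) ->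
  (forall x, C x -> C (aff d h x)) -> measurable E -> perim_le C E p ->
  perim_le C (aff d h @^-1` E) ((\prod_i (d ord0 i)^-1) * p).
Proof.
move=> d01 CS mE pE xi txi; have [sxi cK KC n1] := txi.
have d0 i : 0 < d ord0 i by case/andP: (d01 i).
have d1 i : d ord0 i <= 1 by case/andP: (d01 i).
pose d' : 'rV[R]_N := \row_i (d ord0 i)^-1.
pose h' : 'rV[R]_N := \row_i (- h ord0 i / d ord0 i).
have dd' x : aff d h (aff d' h' x) = x.
  by apply/rowP => i; rewrite !mxE; field; rewrite gt_eqF.
have d'd x : aff d' h' (aff d h x) = x.
  by apply/rowP => i; rewrite !mxE; field; rewrite gt_eqF.
(* Multiplying each component by its contraction factor makes the divergence of [eta] that of xi
   composed with the inverse map; the factors are at most 1, so the norm does not increase. *)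
pose eta x : 'rV[R]_N := \row_i (d ord0 i * xi (aff d' h' x) ord0 i).
have ca u v : continuous (aff u v : 'rV[R]_N -> 'rV[R]_N).
  by move=> x; exact/differentiable_continuous/differentiable_aff.
have deta : divergence eta = divergence xi \o aff d' h'.
  apply/funext => x; rewrite /divergence /=; apply: eq_bigr => i _.
  have [di _] := sxi i 1%N.
  have -> : (fun y => eta y ord0 i) = cst (d ord0 i) \* ((fun y => xi y ord0 i) \o aff d' h').
    by apply/funext => y; rewrite mxE.
  rewrite partialM//; last first.
    by move=> y; apply: differentiable_comp; [exact: differentiable_aff|exact: di].
  rewrite partial_cst /= mulr0 addr0 partial_aff//.
  by rewrite mxE mulrA divff ?mul1r// gt_eqF.
have sub : field_support eta `<=` aff d' h' @^-1` field_support xi.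
  rewrite /field_support.
  have clo : closed (aff d' h' @^-1` closure [set x | xi x != 0]).
    by apply: closed_comp; [move=> x _; exact: ca|exact: closed_closure].
  rewrite [X in _ `<=` X](closure_id _).1//; apply: closureS => x /= ex.
  apply: subset_closure => /=; apply: contra_neq ex => ex.
  by apply/rowP => i; rewrite mxE ex !mxE mulr0.
have teta : test_field C eta.
  split.
  - move=> i k.
    rewrite (_ : (fun y => eta y ord0 i) =
        cst (d ord0 i) \* ((fun y => xi y ord0 i) \o aff d' h')).
      by apply: is_CkM; [exact: is_Ck_cst|apply: is_Ck_aff; exact: sxi].
    by apply/funext => y; rewrite mxE.
  - apply: subclosed_compact sub; first exact: closed_closure.
    rewrite (_ : _ @^-1` _ = aff d h @` field_support xi).
      by apply: continuous_compact => //; apply: continuous_subspaceT; exact: ca.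
    apply/seteqP; split => x /=; first by move=> H; exists (aff d' h' x).
    by move=> [y Hy <-]; rewrite d'd.
  - apply: (subset_trans sub).
    have oC : open (aff d' h' @^-1` interior C).
      by apply: open_comp; [move=> x _; exact: ca|exact: open_interior].
    have oCC : aff d' h' @^-1` interior C `<=` C.
      by move=> x /interior_subset /CS; rewrite dd'.
    move=> x /KC Hx; apply: (interiorS oCC).
    by rewrite ((interior_id _).1 oC).
  - move=> x; apply: le_trans (n1 (aff d' h' x)).
    rewrite /enorm; apply: ler_wsqrtr; apply: ler_sum => i _.
    by rewrite mxE exprMn ler_piMl ?sqr_ge0// expr_le1// ltW.
have c0 : 0 <= \prod_i (d ord0 i)^-1.
  by apply: prodr_ge0 => i _; rewrite invr_ge0 ltW.
have -> : divergence xi = divergence eta \o aff d h.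
  by apply/funext => x; rewrite deta /= d'd.
rewrite intg_aff//; last exact: bcs_divergence teta.
by rewrite ler_wpM2l//; exact: pE.
Qed.

End cut.

(** * Thick convex domains *)

Lemma measurable_symdiff d (T : measurableType d) (A B : set T) :
  measurable A -> measurable B -> measurable (A `+` B).
Proof. by move=> mA mB; apply: measurableU; exact: measurableD. Qed.

Ltac mset := solve [repeat first [done | exact: measurable_rV_ball | exact: measurable_EB |
  exact: measurable_interior | apply: measurable_symdiff | apply: measurableD |
  apply: measurableU | apply: measurableI]].

Section convex_domain.
Context {R : realType} {N : nat}.
Local Notation mu := (borel_lebesgue_rV N).
Local Notation L := (N.+1%:R : R).
Implicit Types (A B C E F K S U : set 'rV[R]_N) (p r s t h e : R).
Implicit Types (c x y z v w : 'rV[R]_N).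

Lemma mu_le A B : measurable A -> measurable B -> A `<=` B -> (mu A <= mu B)%E.
Proof. by move=> mA mB AB; apply: le_measure; rewrite ?inE. Qed.

Lemma mu_setU A B : measurable A -> measurable B -> (mu (A `|` B) <= mu A + mu B)%E.
Proof. by move=> mA mB; exact: measureU2. Qed.

Definition seg_convex C := forall x y s, C x -> C y -> 0 <= s <= 1 ->
  C (x + s *: (y - x)).

(** The homothety of center x and ratio s sends a ball around z inside [C] to a ball around the new
    point, again inside [C]. *)
Lemma seg_interior C x z s : seg_convex C -> C x -> interior C z -> 0 < s <= 1 ->
  interior C (x + s *: (z - x)).
Proof.
move=> cC Cx /nbhs_ballP[e /= e0 He] /andP[s0 s1].
apply/nbhs_ballP; exists (s * e) => /=; first by rewrite mulr_gt0.
move=> w; rewrite -ball_normE /= => Hw.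
have s00 : s != 0 by rewrite gt_eqF.
pose z' := x + s^-1 *: (w - x).
have -> : w = x + s *: (z' - x).
  by apply/rowP => i; rewrite /z' !mxE; field.
apply: cC => //; last by rewrite (ltW s0).
apply: He; rewrite -ball_normE /=.
have -> : z - z' = s^-1 *: (x + s *: (z - x) - w).
  by apply/rowP => i; rewrite /z' !mxE; field.
by rewrite normrZ gtr0_norm ?invr_gt0// mulrC ltr_pdivrMr// mulrC.
Qed.

Lemma seg_convex_interior C : seg_convex C -> convex_interior C.
Proof.
move=> cC x y s Ix Iy /andP[s0 s1].
have [s00|s00] := eqVneq s 0; first by rewrite s00 scale0r addr0.
apply: seg_interior => //; first exact: interior_subset.
by rewrite lt_neqAle eq_sym s00 s0.
Qed.

(* C is contained in every dilation of its interior about an interior point. *)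
Lemma boundary_null C : closed C -> seg_convex C -> interior C !=set0 ->
  mu (C `\` interior C) = 0%E.
Proof.
move=> clC cC [z Iz].
have mC := closed_rV_measurable clC; have mI := measurable_interior C.
apply/eqP; rewrite eq_le measure_ge0 andbT.
apply: le_mu_balls; first mset.
move=> n; pose r := n%:R + `|z| + 1 : R.
have r0 : 0 < r by rewrite /r ltr_wpDl// addr_ge0.
pose CB := C `&` ball z r; pose IB := interior C `&` ball z r.
have mB := measurable_rV_ball z r.
have mCB : measurable CB by mset.
have mIB : measurable IB by mset.
have fCB : mu CB \is a fin_num.
  rewrite ge0_fin_numE//; apply: (@mu_bounded_fin _ _ _ z r) => //.
  by move=> x [].
have fIB : mu IB \is a fin_num.
  rewrite ge0_fin_numE//; apply: (@mu_bounded_fin _ _ _ z r) => //.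
  by move=> x [].
have sub : IB `<=` CB by move=> x [/interior_subset ? ?].
have key s : 0 < s -> s < 1 -> fine (mu CB) <= s^-1 ^+ N * fine (mu IB).
  move=> s0 s1; pose d : 'rV[R]_N := const_mx s; pose h := (1 - s) *: z.
  have affE x : aff d h x = x + (1 - s) *: (z - x).
    by apply/rowP => i; rewrite !mxE; ring.
  have H : CB `<=` aff d h @^-1` IB.
    move=> x [Cx]; rewrite /= affE -ball_normE /= => Bx; split.
      by apply: seg_interior => //; lra.
    rewrite -ball_normE /=.
    have -> : z - (x + (1 - s) *: (z - x)) = s *: (z - x).
      by apply/rowP => i; rewrite !mxE; ring.
    rewrite normrZ gtr0_norm//; apply: le_lt_trans Bx.
    by rewrite ler_piMl// ltW.
  have d0 i : 0 < d ord0 i by rewrite mxE.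
  rewrite -lee_fin EFinM !fineK//.
  have -> : s^-1 ^+ N = \prod_(i < N) (d ord0 i)^-1.
    under eq_bigr do rewrite mxE.
    by rewrite prodr_const card_ord.
  rewrite -(borel_lebesgue_affine h d0 mIB); apply: mu_le => //.
  by rewrite -[X in measurable X]setTI; exact: measurable_aff.
have fle : fine (mu CB) <= fine (mu IB).
  have cv : (fun s : R => s^-1 ^+ N * fine (mu IB)) @ 1^'- --> 1^-1 ^+ N * fine (mu IB).
    apply: cvgM; last exact: cvg_cst.
    apply: cvg_at_left_filter.
    have : continuous_at (1:R) (fun s : R => s^-1 ^+ N).
      apply: (@continuous_comp _ _ _ (fun s : R => s^-1) (fun y : R => y ^+ N)).
        by apply: inv_continuous; rewrite oner_eq0.
      exact: exprn_continuous.
    by [].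
  rewrite invr1 expr1n mul1r in cv.
  rewrite -(cvg_lim (@Rhausdorff R) cv); apply: limr_ge.
    by apply/cvg_ex; exists (fine (mu IB)).
  near=> s; apply: key; near: s.
    exact: nbhs_left_gt.
  exact: nbhs_left_lt.
apply: (@le_trans _ _ (mu (CB `\` IB))).
  apply: mu_le => //.
  - apply: measurableI; [mset|mset].
  - mset.
  move=> x [[Cx Ix] Bx]; split; last by case.
  split => //; move: Bx; rewrite -!ball_normE /= sub0r normrN => Bx.
  rewrite (le_lt_trans (ler_normB _ _))// /r.
  by rewrite addrC -addrA ltr_leD// lerDl.
rewrite measureD//; last by rewrite ltey_eq fCB.
rewrite (setIidr sub).
have H : (mu CB <= mu IB)%E by rewrite -(fineK fCB) -(fineK fIB) lee_fin.
by rewrite sube_le0.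
Unshelve. all: by end_near. Qed.

(** [gd_thick] is an interior corkscrew condition, uniform up to scale [r0]; it bounds from below
    the volume of [C] near each of its points. [gd_line] permits stretching along the axis [i0], and
    [gd_shift] brings any point within [D] of the origin by a symmetry of [C]. *)
Record good_domain C (i0 : 'I_N) (k r0 D : R) : Prop := GoodDomain {
  gd_closed : closed C;
  gd_convex : seg_convex C;
  gd_interior : interior C !=set0;
  gd_k0 : 0 < k;
  gd_r0 : 0 < r0;
  gd_thick : forall x r, C x -> 0 < r -> r <= r0 ->
    exists z, ball z (k * r) `<=` ball x r `&` C;
  gd_line : forall x t, C x -> C (x + t *: delta_mx ord0 i0);
  gd_shift : forall x, C x -> exists v, (forall y, C y <-> C (y + v)) /\ ball 0 D (x + v)
}.

Section good.
Variables (C : set 'rV[R]_N) (i0 : 'I_N) (k r0 D : R).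
Hypothesis gC : good_domain C i0 k r0 D.

Let cI := seg_convex_interior (gd_convex gC).
Let mI := measurable_interior C.
Let mC := closed_rV_measurable (gd_closed gC).
Let theta : R := (2 * k) ^+ N.
Let theta0 : 0 < theta.
Proof. by rewrite exprn_gt0// mulr_gt0// (gd_k0 gC). Qed.

(** The quotient of (2r)^N L r, from the nonlocal estimate at scale r, by half of the guaranteed
    volume (2k)^N r^N, with one factor r left out. *)
Definition reg_const : R := 2 * 2 ^+ N * L / (2 * k) ^+ N.

Lemma reg_const_gt0 : 0 < reg_const.
Proof. by rewrite /reg_const divr_gt0// !mulr_gt0// exprn_gt0. Qed.

Lemma thick_measure x r : C x -> 0 < r -> r <= r0 ->
  ((theta * r ^+ N)%:E <= mu (ball x r `&` interior C))%E.
Proof.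
move=> Cx rp rr; have [z Hz] := gd_thick gC Cx rp rr.
have kr : 0 < k * r by rewrite mulr_gt0// (gd_k0 gC).
rewrite /theta -exprMn -mulrA -(borel_lebesgue_ball z kr).
apply: mu_le; [mset|mset|].
move=> y By; split; first by case: (Hz y By).
have oB : open (ball z (k * r)) by exact: ball_open.
have BC : ball z (k * r) `<=` C by move=> u /Hz[].
by apply: (interiorS BC); rewrite ((interior_id _).1 oB).
Qed.

Lemma mu_interior E : measurable E -> E `<=` C -> mu (E `&` interior C) = mu E.
Proof.
move=> mE EC; have N0 := boundary_null (gd_closed gC) (gd_convex gC) (gd_interior gC).
apply/eqP; rewrite eq_le; apply/andP; split.
  by apply: mu_le => //; mset.
rewrite -[X in (mu X <= _)%E](setUIDK E (interior C)).
have mEI : measurable (E `&` interior C) by mset.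
have mED : measurable (E `\` interior C) by mset.
apply: (le_trans (mu_setU mEI mED)).
rewrite -[leRHS]adde0 leeD2l// -N0; apply: mu_le => //.
  mset.
by move=> x [/EC Cx Ix]; split.
Qed.

(** Balls of radius [r] centered in [C] hold at least theta r^N of the interior of [C]. If [E] takes
    at most half of that, every point of [E] sees the other half outside [E], and the nonlocal
    estimate applies to all of [E]. The factor [r] in the conclusion is what forces concentration at
    small scales. *)
Lemma small_density_bound E p r : perim_le C E p -> measurable E -> E `<=` C ->
  (mu E < +oo)%E -> 0 < r -> r <= r0 ->
  (forall x, interior C x -> (mu (E `&` ball x r) <= (theta * r ^+ N / 2)%:E)%E) ->
  fine (mu E) <= reg_const * r * p.
Proof.
move=> pE mE EC Efin rp rr H.
have c0 : 0 < theta * r ^+ N / 2 by rewrite divr_gt0// mulr_gt0// exprn_gt0.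
have mEI : measurable (E `&` interior C) by mset.
have sEI : E `&` interior C `<=` interior C `&` E by rewrite setIC.
have Hc x : (E `&` interior C) x ->
    ((theta * r ^+ N / 2)%:E <= mu (ball x r `&` (interior C `\` E)))%E.
  move=> [Ex Ix]; have := thick_measure (EC x Ex) rp rr.
  have -> : ball x r `&` interior C = (ball x r `&` (interior C `\` E)) `|`
      (ball x r `&` interior C `&` E).
    apply/seteqP; split => y.
      by move=> [By Iy]; have [Ey|Ey] := pselect (E y); [right|left].
    by move=> [[By [Iy _]]|[[By Iy] _]].
  move=> Hth; have mB := measurable_rV_ball x r.
  have m1 : measurable (ball x r `&` (interior C `\` E)) by mset.
  have m2 : measurable (ball x r `&` interior C `&` E) by mset.
  have H2 : (mu (ball x r `&` interior C `&` E) <= (theta * r ^+ N / 2)%:E)%E.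
    apply: le_trans (H x Ix); apply: mu_le => //.
      mset.
    by move=> y [[? ?] ?].
  have := le_trans Hth (mu_setU m1 m2).
  move=> /le_trans /(_ (leeD2l _ H2)).
  rewrite -leeBlDr// -EFinB; congr (_ <= _)%E; congr EFin; lra.
have := nonlocal_out cI pE mE mEI sEI rp (ltW c0) Hc.
rewrite mu_interior// -(fineK (_ : mu E \is a fin_num)); last by rewrite ge0_fin_numE.
rewrite -EFinM lee_fin => H1.
rewrite -(ler_pM2l c0); apply: (le_trans H1).
apply: le_of_eq.
rewrite /reg_const exprMn -/theta; field.
by rewrite gt_eqF.
Qed.

End good.

(** * Density estimates *)

Definition almost_min C E p Q := forall F p', measurable F -> F `<=` E ->
  perim_le C (E `\` F) p' -> p <= p' + Q * fine (mu F).

Lemma mu_EB_fin A c t : measurable A -> mu (A `&` EB c t) \is a fin_num.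
Proof.
move=> mA; rewrite ge0_fin_numE//; have [r Hr] := EB_bounded c t.
apply: (@mu_bounded_fin _ _ _ 0 r); first by move=> x [_ /Hr].
mset.
Qed.

Lemma fine_mu_le A B : measurable A -> measurable B -> A `<=` B ->
  mu B \is a fin_num -> fine (mu A) <= fine (mu B).
Proof.
move=> mA mB AB fB; have leAB : (mu A <= mu B)%E by apply: le_measure; rewrite ?inE.
have fA : mu A \is a fin_num.
  by rewrite ge0_fin_numE// (le_lt_trans leAB)// -ge0_fin_numE.
by rewrite -lee_fin !fineK.
Qed.

(** A Caccioppoli inequality: the part inside a sphere is compared with its removal, and P(E)
    cancels between the cut and the almost minimality. *)
Lemma cut_min (A0 : R) C E p Q c (a b : R) : 0 < A0 -> @cut_const R N A0 ->
  0 <= Q -> perim_le C E p -> measurable E -> almost_min C E p Q ->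
  0 <= a -> a < b -> exists t, [/\ a <= t, t <= b &
  perim_le C (E `&` EB c t) ((A0 / (b - a) + Q) * fine (mu (E `&` EB c b)))].
Proof.
move=> A00 HA Q0 pE mE mn a0 ab; have [t [ta tb H]] := HA C E p c a b pE mE a0 ab.
exists t; split => // xi1 t1.
have mEt : measurable (E `&` EB c t) by mset.
have mEb : measurable (E `&` EB c b) by mset.
(* With the inner field xi1 fixed and the outer one arbitrary, the cut estimate bounds the perimeter
   of what remains, in terms of the flux of xi1. *)
have H2 : perim_le C (E `\` (E `&` EB c t))
    (p + A0 * fine (mu (E `&` EB c b)) / (b - a) - intg (E `&` EB c t) (divergence xi1)).
  move=> xi2 t2; have -> : E `\` (E `&` EB c t) = E `\` EB c t.
    by rewrite setDIr setDv set0U.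
  have := H xi1 xi2 t1 t2; move: (fine _) (intg _ _) (intg _ _) => u v w; lra.
have := mn _ _ mEt (@subIsetl _ _ _) H2.
have : Q * fine (mu (E `&` EB c t)) <= Q * fine (mu (E `&` EB c b)).
  apply: ler_wpM2l => //; apply: fine_mu_le => //; last exact: mu_EB_fin.
  by apply: setIS; apply: EB_homo => //; exact: le_trans ta.
rewrite mulrDl mulrAC; move: (fine _) (fine _) (intg _ _) => u v w; lra.
Qed.

(** The support of the measure A -> mu(E & A). It depends only on [E] modulo null sets and serves as
    the closed representative. *)
Definition msupp E : set 'rV[R]_N := [set x | forall r : R, 0 < r -> mu (E `&` ball x r) != 0%E].

Lemma ball_half x y r : ball x (r / 2) y -> ball y (r / 2) `<=` ball x r.
Proof. by move=> xy z yz; rewrite (splitr r); exact: ball_triangle xy yz. Qed.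

Lemma mu_null A B : measurable A -> measurable B -> A `<=` B -> mu B = 0%E -> mu A = 0%E.
Proof.
move=> mA mB AB B0; apply/eqP; rewrite eq_le measure_ge0 andbT -B0.
by apply: le_measure; rewrite ?inE.
Qed.

Lemma closed_msupp E : measurable E -> closed (msupp E).
Proof.
move=> mE; rewrite -[msupp E]setCK; apply: open_closedC; rewrite openE => x /=.
move=> /existsNP[r /not_implyP[r0 /negP/negPn/eqP H]].
apply/nbhs_ballP; exists (r / 2) => /=; first by rewrite divr_gt0.
move=> y xy /(_ (r / 2) (divr_gt0 r0 _)) /negP; apply => //; apply/eqP.
apply: mu_null H.
- mset.
- mset.
- by apply: setIS; exact: ball_half.
Qed.

Lemma msupp_sub C E : closed C -> E `<=` C -> msupp E `<=` C.
Proof.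
move=> cC EC x Ex; rewrite (closure_id C).1// => U /nbhs_ballP[r /= r0 rU].
have [E0|/set0P[y [Ey By]]] := eqVneq (E `&` ball x r) set0.
  by have := Ex r r0; rewrite E0 measure0 eqxx.
by exists y; split; [exact: EC|exact: rU].
Qed.

(** A point off the support lies in a rational ball where [E] is null, and there are countably many
    of these. *)
Lemma msupp_diff_null E : measurable E -> mu (E `\` msupp E) = 0%E.
Proof.
move=> mE.
pose B (q : 'rV[rat]_N * nat) : set 'rV[R]_N :=
  ball (\row_i ratr (q.1 ord0 i) : 'rV[R]_N) (q.2.+1%:R^-1 : R).
pose G n : set 'rV[R]_N := if unpickle n is Some q then
  (if mu (E `&` B q) == 0%E then E `&` B q else set0) else set0.
have mB q : measurable (E `&` B q) by mset.
have mG n : measurable (G n).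
  by rewrite /G; case: unpickle => // q; case: ifP.
have G0 n : mu (G n) = 0%E.
  by rewrite /G; case: unpickle => [q|]; [case: eqP => // _; exact: measure0|exact: measure0].
have mF : measurable (msupp E) by apply: closed_rV_measurable; exact: closed_msupp.
have sub : E `\` msupp E `<=` \bigcup_n G n.
  move=> x [Ex /existsNP[r /not_implyP[r0 /negP/negPn/eqP H]]].
  have [q [q1 q2]] := rat_ball_dense (lexx 1) (ball_open x r) (ballxx x r0).
  rewrite mul1r in q2; exists (pickle q) => //; rewrite /G pickleK ifT; first by split.
  apply/eqP; apply: mu_null H => //.
    mset.
  by apply: setIS.
apply: (mu_null _ _ sub); first mset.
  exact: bigcup_measurable.
apply/eqP; rewrite eq_le measure_ge0 andbT.
have : (mu (\bigcup_n G n) <= \sum_(n <oo) mu (G n))%E.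
  apply: generalized_Boole_inequality => //; exact: bigcup_measurable.
by rewrite eseries0// => n _ _; exact: G0.
Qed.

Section regular.
Variables (C : set 'rV[R]_N) (i0 : 'I_N) (k r0 D : R).
Hypothesis gC : good_domain C i0 k r0 D.
Variables (E : set 'rV[R]_N) (p Q : R).
Hypotheses (pE : perim_le C E p) (mE : measurable E) (EC : E `<=` C) (Q0 : 0 <= Q).
Hypotheses (Efin : (mu E < +oo)%E) (mn : almost_min C E p Q).

Let theta : R := (2 * k) ^+ N.
Let theta0 : 0 < theta.
Proof. by rewrite exprn_gt0// mulr_gt0// (gd_k0 gC). Qed.

(* De Giorgi iteration: the volume in a ball of radius rk = r (1/2 + 2^-k-1) is
   at most 2^-k(N+1) times the initial bound. *)
Lemma density_decay : exists2 sigma : R, 0 < sigma & exists2 rho : R, 0 < rho &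
  forall x r, 0 < r -> r <= rho ->
  fine (mu (E `&` EB x r)) <= theta / 2 * (sigma * r) ^+ N ->
  mu (E `&` EB x (r / 2)) = 0%E.
Proof.
have [A0 A00 HA] := @cut_constP R N.
set A1 := reg_const k.
have A10 : 0 < A1 := reg_const_gt0 gC.
(* [T] dominates the factor A1 (4 A0 + r Q u_n) of one iteration, in which shells have width r u_n /
   4 and r Q <= 1; then sigma = 1 / (2^(N+1) T) yields the gain 2^-(N+1). The last summand ensures
   sigma <= 1, which keeps the scale below [r0]. *)
pose T := A1 * (4 * A0 + 1) + 1.
have T1 : 1 <= T by rewrite lerDr mulr_ge0 ?ltW// addr_gt0// mulr_gt0.
have T0 : 0 < T by lra.
have e2 n : 1 <= 2 ^+ n :> R by rewrite exprn_ege1// ler1n.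
have e2' n : 0 < 2 ^+ n :> R by rewrite exprn_gt0.
pose sigma := (2 ^+ N.+1 * T)^-1.
have s0 : 0 < sigma by rewrite invr_gt0 mulr_gt0.
have s1 : sigma <= 1.
  by rewrite invf_le1 ?mulr_gt0// -[leLHS]mulr1 ler_pM.
have Q1 : 0 < Q + 1 by rewrite ltr_wpDl.
exists sigma => //; exists (Num.min r0 (Q + 1)^-1).
  by rewrite lt_min (gd_r0 gC) invr_gt0.
move=> x r rp; rewrite le_min => /andP[rr rQ] H0.
have Qr : r * Q <= 1.
  rewrite -(divff (lt0r_neq0 Q1)) mulrC -[leRHS]/((Q+1) / (Q+1)).
  by apply: ler_pM => //; [exact: ltW|rewrite lerDl].
pose u n : R := 2^-1 ^+ n.
have u0 n : 0 < u n by rewrite exprn_gt0.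
have u1 n : u n <= 1 by rewrite exprn_ile1 ?invr_ge0// invf_le1// ler1n.
have uS n : u n.+1 = u n / 2 by rewrite /u exprS mulrC.
pose rk n := r * (2^-1 + u n / 2).
pose m s := fine (mu (E `&` EB x s)).
have rk0 n : 0 < rk n by rewrite mulr_gt0// addr_gt0// divr_gt0.
have key n : m (rk n) <= theta / 2 * (sigma * r) ^+ N * u n ^+ N.+1.
  elim: n => [|n IH].
    have -> : rk 0 = r by rewrite /rk /u expr0; lra.
    by rewrite /u expr0 expr1n mulr1.
  have rkS : rk n - rk n.+1 = r * u n / 4 by rewrite /rk uS; field.
  have ru : 0 < r * u n by rewrite mulr_gt0.
  have [|t [ta tb Ht]] := cut_min x A00 HA Q0 pE mE mn (ltW (rk0 n.+1)) (_ : rk n.+1 < rk n).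
    by rewrite -subr_gt0 rkS divr_gt0.
  rewrite rkS in Ht.
  have t0 : 0 < t by exact: lt_le_trans ta.
  (* The scale at which the induction hypothesis says that [E] has at most half of the guaranteed
     volume in every ball: theta/2 (sigma r)^N u_n^(N+1) <= theta/2 s^N. *)
  pose s := sigma * r * u n.
  have s00 : 0 < s by rewrite !mulr_gt0.
  have mEt : measurable (E `&` EB x t) by mset.
  have mEb : measurable (E `&` EB x (rk n)) by mset.
  have sr : s <= r0.
    apply: le_trans rr; rewrite /s mulrAC ler_piMl ?(ltW rp)//.
    by rewrite mulr_ile1// ltW.
  have sub : E `&` EB x t `<=` E `&` EB x (rk n).
    by apply: setIS; apply: EB_homo => //; exact: ltW.
  have Hd : forall y, interior C y ->
      (mu ((E `&` EB x t) `&` ball y s) <= (theta * s ^+ N / 2)%:E)%E.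
    move=> y _; apply: (@le_trans _ _ (mu (E `&` EB x (rk n)))).
      apply: mu_le => //.
        mset.
      by move=> z [/sub].
    rewrite -(fineK (mu_EB_fin _ _ mE)) lee_fin; apply: (le_trans IH).
    rewrite /s !exprMn exprS.
    have -> : theta / 2 * (sigma ^+ N * r ^+ N) * (u n * u n ^+ N) =
      u n * (theta * (sigma ^+ N * r ^+ N * u n ^+ N) / 2) by ring.
    rewrite ler_piMl//; apply: divr_ge0 => //; apply: mulr_ge0; first exact: ltW.
    by rewrite !mulr_ge0 ?exprn_ge0 ?ltW.
  have tfin : (mu (E `&` EB x t) < +oo)%E by rewrite -ge0_fin_numE// mu_EB_fin.
  have := small_density_bound gC Ht mEt (subset_trans (@subIsetl _ _ _) EC) tfin s00 sr Hd.
  rewrite -/A1 -/(m t) -/(m (rk n)) => H1.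
  have mt : m (rk n.+1) <= m t.
    apply: fine_mu_le => //.
    - mset.
    - by apply: setIS; apply: EB_homo => //; exact: ltW.
    - exact: mu_EB_fin.
  have m0 : 0 <= m (rk n) by exact: fine_ge0.
  have H2 : A1 * s * (A0 / (r * u n / 4) + Q) <= (2 ^+ N.+1)^-1.
    have -> : A1 * s * (A0 / (r * u n / 4) + Q) =
        sigma * (A1 * (4 * A0 + r * Q * u n)).
      by rewrite /s; field; rewrite !gt_eqF.
    have -> : (2 ^+ N.+1)^-1 = sigma * T.
      by rewrite /sigma; field; rewrite !gt_eqF.
    rewrite ler_wpM2l ?(ltW s0)// /T.
    have : A1 * (4 * A0 + r * Q * u n) <= A1 * (4 * A0 + 1).
      rewrite ler_wpM2l ?(ltW A10)// lerD2l mulr_ile1 ?(ltW (u0 n))//.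
      by rewrite mulr_ge0// ltW.
    lra.
  apply: (le_trans mt); apply: (le_trans H1).
  rewrite mulrA; apply: (@le_trans _ _ ((2 ^+ N.+1)^-1 * m (rk n))).
    by rewrite ler_wpM2r.
  apply: (@le_trans _ _ ((2 ^+ N.+1)^-1 * (theta / 2 * (sigma * r) ^+ N * u n ^+ N.+1))).
    by rewrite ler_wpM2l ?invr_ge0 ?(ltW (e2' _)).
  have -> : u n.+1 ^+ N.+1 = u n ^+ N.+1 / 2 ^+ N.+1 by rewrite uS exprMn exprVn.
  by rewrite mulrC -!mulrA.
have key2 n : m (r / 2) <= theta / 2 * (sigma * r) ^+ N * u n.
  apply: (@le_trans _ _ (m (rk n))).
    apply: fine_mu_le.
    - mset.
    - mset.
    - apply: setIS; apply: EB_homo; first by rewrite divr_ge0// ltW.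
      by rewrite ler_wpM2l ?(ltW rp)// lerDl divr_ge0// ltW.
    - exact: mu_EB_fin.
  apply: (le_trans (key n)); rewrite ler_wpM2l//.
    apply: mulr_ge0; first by apply: divr_ge0 => //; exact: ltW.
    by rewrite exprn_ge0// mulr_ge0// ltW.
  by rewrite exprS ler_piMr ?(ltW (u0 n))// exprn_ile1 ?(ltW (u0 n)).
rewrite -(fineK (mu_EB_fin _ _ mE)); congr EFin; apply/eqP; rewrite -/(m _).
rewrite eq_le fine_ge0// andbT.
have cv : (fun n => theta / 2 * (sigma * r) ^+ N * u n) @ \oo --> (0 : R).
  rewrite -[X in _ --> X](mulr0 (theta / 2 * (sigma * r) ^+ N)).
  apply: cvgM; first exact: cvg_cst.
  apply: cvg_expr; by rewrite ger0_norm ?invr_ge0// invf_lt1// ltr1n.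
rewrite -(cvg_lim (@Rhausdorff R) cv); apply: limr_ge; first by apply/cvg_ex; exists 0.
by apply: nearW.
Qed.

(** Contrapositive of the decay: a volume below the threshold would vanish in the half ball, against
    the definition of the support. *)
Lemma msupp_density : exists2 beta : R, 0 < beta & exists2 rho : R, 0 < rho &
  forall x r, msupp E x -> 0 < r -> r <= rho ->
  beta * r ^+ N <= fine (mu (E `&` EB x r)).
Proof.
have [s s0 [rho rho0 H]] := density_decay.
exists ((2 * k) ^+ N / 2 * s ^+ N).
  by rewrite mulr_gt0 ?divr_gt0 ?exprn_gt0// mulr_gt0// (gd_k0 gC).
exists rho => // x r Ex rp rr; rewrite -mulrA -exprMn leNgt; apply/negP => /ltW /(H x r rp rr) H0.
have rL : 0 < r / 2 / L by rewrite !divr_gt0.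
have := Ex _ rL => /negP; apply; apply/eqP; apply: mu_null H0.
- mset.
- mset.
- by apply: setIS; apply: ball_EB; rewrite divr_gt0.
Qed.

(** By the density bound, a point of the support outside [E] sees at least b d^N of [E] at every
    small scale d, so the nonlocal estimate bounds the set of such points by a constant times d;
    then d tends to 0. *)
Lemma msupp_extra_null : mu (msupp E `\` E) = 0%E.
Proof.
have [b b0 [rho rho0 H]] := msupp_density.
have cF := closed_msupp mE; have mF := closed_rV_measurable cF.
have FC := msupp_sub (gd_closed gC) EC.
have mI := measurable_interior C.
have mS : measurable (msupp E `\` E) by mset.
have SC : msupp E `\` E `<=` C by move=> x [/FC].
rewrite -(mu_interior gC mS SC).
set S := _ `&` _.
have mSI : measurable S by mset.
have p0 : 0 <= p := perim_le_ge0 pE.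
have Hd d : 0 < d -> d <= rho -> (mu S <= (2 ^+ N * (L * p) / b * d)%:E)%E.
  move=> d0 dr; have c0 : 0 < b * d ^+ N by rewrite mulr_gt0// exprn_gt0.
  have SE : S `<=` interior C `\` E by move=> x [[_ ?] ?]; split.
  have Hc x : S x -> ((b * d ^+ N)%:E <= mu (ball x d `&` (interior C `&` E)))%E.
    move=> [[Fx _] _]; apply: (@le_trans _ _ (mu (E `&` EB x d))).
      by rewrite -(fineK (mu_EB_fin _ _ mE)) lee_fin; exact: H.
    have mEB : measurable (E `&` EB x d) by mset.
    rewrite -(mu_interior gC mEB); last by move=> y [/EC].
    apply: mu_le; [mset|mset|].
    by move=> y [[Ey /(EB_ball d0) ?] ?]; split.
  have := nonlocal_in (seg_convex_interior (gd_convex gC)) pE mE mSI SE d0 (ltW c0) Hc.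
  rewrite muleC -lee_pdivlMr// -EFinM; move=> /le_trans; apply; rewrite lee_fin.
  apply: le_of_eq; rewrite exprMn; field.
  by rewrite !gt_eqF// exprn_gt0.
have Sfin : mu S \is a fin_num.
  rewrite ge0_fin_numE//; apply: le_lt_trans (Hd rho rho0 (lexx _)) _; exact: ltry.
rewrite -(fineK Sfin); congr EFin; apply/eqP; rewrite eq_le fine_ge0// andbT.
set M := 2 ^+ N * (L * p) / b in Hd.
have M0 : 0 <= M by rewrite divr_ge0 ?mulr_ge0 ?exprn_ge0// ltW.
have M1 : 0 < M + 1 by rewrite ltr_wpDl.
apply/ler_addgt0Pr => e e0; rewrite add0r.
have d0 : 0 < Num.min rho (e / (M + 1)) by rewrite lt_min rho0 divr_gt0.
rewrite -lee_fin fineK//; apply: le_trans (Hd _ d0 _) _; first by rewrite ge_min lexx.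
rewrite lee_fin; apply: (@le_trans _ _ (M * (e / (M + 1)))).
  by rewrite ler_wpM2l// ge_min lexx orbT.
by rewrite mulrA ler_pdivrMr// mulrC ler_wpM2l ?(ltW e0)// lerDl.
Qed.

(** Outside a large ball [E] has less volume than one small ball centered at a point of the support
    must contain. *)
Lemma msupp_bounded : bounded_set (msupp E).
Proof.
have [b b0 [rho rho0 H]] := msupp_density.
pose r := Num.min rho 1.
have r0' : 0 < r by rewrite lt_min rho0 ltr01.
pose B n : set 'rV[R]_N := E `&` ball 0 n%:R.
have mB n : measurable (B n) by mset.
have UB : \bigcup_n B n = E by exact: bigcup_setI_ball.
have br : 0 < b * r ^+ N / 2 by rewrite divr_gt0// mulr_gt0// exprn_gt0.
have [n] := @bigcup_exhaust _ _ R mu B (b * r ^+ N / 2) mB (eq_ind_r (fun X => (mu X < +oo)%E) Efin UB) br.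
rewrite UB => Hn.
exists (n%:R + 1); split => // M HM x Fx /=; apply: le_trans (ltW HM); rewrite leNgt; apply/negP => Hx.
have rr : r <= rho by rewrite ge_min lexx.
have := H x r Fx r0' rr; rewrite leNgt => /negP; apply.
apply: (@le_lt_trans _ _ (b * r ^+ N / 2)); last first.
  by rewrite ltr_pdivrMr// mulr_natr mulr2n ltrDl mulr_gt0// exprn_gt0.
rewrite -lee_fin fineK; last exact: mu_EB_fin.
apply: le_trans Hn; apply: le_measure; rewrite ?inE.
- mset.
- by apply: measurableD => //; apply: bigsetU_measurable => i _; exact: mB.
move=> y [Ey /(EB_ball r0')]; rewrite -ball_normE /= => xy; split => //.
rewrite -bigcup_mkord => -[j /= jn [_]]; rewrite -ball_normE /= sub0r normrN => yj.
have yn : `|y| < n%:R by apply: (lt_le_trans yj); rewrite ler_nat ltnW.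
have r1 : r <= 1 by rewrite ge_min lexx orbT.
have : `|x| <= `|x - y| + `|y| by rewrite -{1}(subrK y x) ler_normD.
move: Hx; lra.
Qed.

(** [E] is a Borel kernel of [G]. A point off the support has a neighbourhood missing it, so its
    density is 0; a point of the support has lower density at least b / 2^N by the uniform bound. *)
Lemma msupp_represents G : lebesgue_measurable G -> E `<=` G -> volume (G `\` E) = 0%E ->
  represents G (msupp E).
Proof.
move=> mG EG G0.
have cF := closed_msupp mE; have mF := closed_rV_measurable cF.
have dF : mu (msupp E `\` E) = 0%E := msupp_extra_null.
have dE : mu (E `\` msupp E) = 0%E := msupp_diff_null mE.
have eEB x r : 0 < r -> eball x r = EB x r.
  by move=> r_gt0; apply/seteqP; split => y /(eballE _ _ (ltW r_gt0)).
split => //.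
- apply/eqP; rewrite eq_le volume_ge0 andbT.
  have sub : G `+` msupp E `<=` ((G `\` E) `|` (E `\` msupp E)) `|` (msupp E `\` E).
    move=> x [[Gx Fx]|[Fx Gx]].
      by left; have [Ex|Ex] := pselect (E x); [right|left].
    by right; split => // /EG.
  apply: (le_trans (le_volume sub)); rewrite volumeU_null//.
    apply: volumeU_null => //; rewrite volume_borel//; mset.
  by rewrite volume_borel//; mset.
- move=> x Hx; apply: contrapT => Fx.
  have [r /= rp Hr] : exists2 r : R, 0 < r & ball x r `<=` ~` msupp E.
    have : nbhs x (~` msupp E) by apply: open_nbhs_nbhs; split => //; exact: closed_openC.
    by move=> /nbhs_ballP[r /= rp Hr]; exists r.
  have : (0 : R) = 1.
    rewrite -(cvg_lim (@Rhausdorff R) Hx); apply/esym/lim_near_cst => //.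
    near=> s; rewrite (_ : msupp E `&` eball x s = set0).
      by rewrite volume_borel// measure0 mul0r.
    have s0 : 0 < s by near: s; exact: nbhs_right_gt.
    apply/seteqP; split => // y; rewrite eEB// => -[Fy /(EB_ball s0) xy].
    apply: (Hr y) => //; apply: le_ball xy; near: s; exact: nbhs_right_le.
  by move/eqP; rewrite eq_sym oner_eq0.
- move=> x Hx Fx; have [b b0 [rho rho0 H]] := msupp_density.
  have : b / 2 ^+ N <= 0.
    rewrite -(cvg_lim (@Rhausdorff R) Hx); apply: limr_ge.
      by apply/cvg_ex; exists 0.
    near=> s; have s0 : 0 < s by near: s; exact: nbhs_right_gt.
    have sr : s <= rho by near: s; exact: nbhs_right_le.
    have mFs : measurable (msupp E `&` EB x s) by mset.
    have mEs : measurable (E `&` EB x s) by mset.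
    have mB := measurable_EB x s.
    rewrite eEB// !volume_borel//.
    have fB : mu (EB x s) \is a fin_num by have := mu_EB_fin x s measurableT; rewrite setTI.
    have E1 : (mu (E `&` EB x s) <= mu (msupp E `&` EB x s))%E.
      have sub : E `&` EB x s `<=` (msupp E `&` EB x s) `|` (E `\` msupp E).
        by move=> y [Ey By]; have [Fy|Fy] := pselect (msupp E y); [left|right].
      have mD : measurable (E `\` msupp E) by mset.
      apply: (@le_trans _ _ (mu ((msupp E `&` EB x s) `|` (E `\` msupp E)))).
        by apply: mu_le => //; mset.
      apply: (le_trans (mu_setU mFs mD)).
      by rewrite -[leRHS]adde0; apply: leeD2l; exact: le_of_eq.
    have E2 : b * s ^+ N <= fine (mu (msupp E `&` EB x s)).
      apply: (le_trans (H x s Fx s0 sr)).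
      by rewrite -lee_fin !fineK//; exact: mu_EB_fin.
    have E3 : fine (mu (EB x s)) <= (2 * s) ^+ N.
      rewrite -lee_fin fineK// -(borel_lebesgue_ball x s0).
      by apply: mu_le => //; [mset|exact: EB_ball].
    have E4 : 0 < fine (mu (EB x s)).
      apply: (@lt_le_trans _ _ (b * s ^+ N)); first by rewrite mulr_gt0// exprn_gt0.
      apply: (le_trans E2); apply: fine_mu_le => //; exact: subIsetr.
    rewrite ler_pdivlMr//; apply: le_trans E2.
    rewrite mulrAC ler_pdivrMr ?exprn_gt0// -mulrA ler_wpM2l ?(ltW b0)//.
    by rewrite mulrC -exprMn.
  by rewrite leNgt divr_gt0// exprn_gt0.
Unshelve. all: by end_near. Qed.

End regular.

(** * Compactness *)

Lemma geometric_bigcup (W : nat -> set 'rV[R]_N) (M : R) : (forall n, measurable (W n)) ->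
  0 <= M -> (forall n, (mu (W n) <= (M * 2^-1 ^+ n)%:E)%E) ->
  (mu (\bigcup_n W n) <= (2 * M)%:E)%E.
Proof.
move=> mW M0 H.
have -> : \bigcup_n W n = \bigcup_n \big[setU/set0]_(k < n) W k.
  apply/seteqP; split => x.
    by move=> [n _ Wx]; exists n.+1 => //; rewrite -bigcup_mkord; exists n => /=.
  by move=> [n _]; rewrite -bigcup_mkord => -[k _ Wx]; exists k.
apply: le_mu_bigcup => [n|n m nm|n]; first exact: bigsetU_measurable.
  rewrite -!bigcup_mkord; apply: bigcup_sub => k /= kn.
  by apply: (@bigcup_sup _ _ k) => /=; exact: leq_trans kn nm.
suff : (mu (\big[setU/set0]_(k < n) W k) <= (2 * M * (1 - 2^-1 ^+ n))%:E)%E.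
  move=> /le_trans; apply; rewrite lee_fin ler_piMr ?mulr_ge0// gerBl.
elim: n => [|n IH]; first by rewrite big_ord0 measure0 expr0 subrr mulr0.
rewrite big_ord_recr /=; apply: le_trans (mu_setU _ (mW n)) _.
  exact: bigsetU_measurable.
apply: (le_trans (leeD IH (H n))); rewrite -EFinD lee_fin exprS.
by apply: le_of_eq; field.
Qed.

Lemma symdiff_trans A B E : A `+` E `<=` (A `+` B) `|` (B `+` E).
Proof.
by move=> x [[Ax Ex]|[Ex Ax]]; have [Bx|Bx] := pselect (B x);
  [right; left|left; left|left; right|right; right].
Qed.

Lemma mu_symdiff_trans A B E S S1 S2 : measurable A -> measurable B -> measurable E ->
  measurable S -> measurable S1 -> measurable S2 -> S `<=` S1 -> S `<=` S2 ->
  (mu ((A `+` E) `&` S) <= mu ((A `+` B) `&` S1) + mu ((B `+` E) `&` S2))%E.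
Proof.
move=> mA mB mE mS mS1 mS2 SS1 SS2; apply: le_trans (mu_setU _ _); [|mset|mset].
apply: mu_le; [mset|mset|].
by move=> x [/(@symdiff_trans _ B _)[|] ? Sx]; [left|right]; split => //; [exact: SS1|exact: SS2].
Qed.

Lemma mu_cap_symdiff A E S : measurable A -> measurable E -> measurable S ->
  (mu (A `&` S) <= mu E + mu ((E `+` A) `&` S))%E.
Proof.
move=> mA mE mS; apply: le_trans (mu_setU _ _); [|mset|mset].
apply: mu_le; [mset|mset|].
move=> x [Ax Sx]; have [Ex|Ex] := pselect (E x); [by left|right].
by split => //; right.
Qed.

Definition net (n : nat) : 'rV[R]_N :=
  if @unpickle 'rV[rat]_N n is Some q then \row_i ratr (q ord0 i) else 0.

Definition net_ball h n : set 'rV[R]_N := ball (net n) h.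

(** Pieces of balls of radius [h] about the rational points, made disjoint. A dense net covers at
    every [h]; a bounded region then meets infinitely many cells, but finitely many carry almost all
    of its volume. *)
Definition cell h n : set 'rV[R]_N := seqDU (net_ball h) n.

Definition cells h (chi : set nat) : set 'rV[R]_N := \bigcup_(n in chi) cell h n.

Lemma measurable_cell h n : measurable (cell h n).
Proof.
rewrite /cell /seqDU; apply: measurableD; first mset.
by apply: bigsetU_measurable => i _; mset.
Qed.

Lemma measurable_cells h chi : measurable (cells h chi).
Proof. by apply: bigcup_measurable => n _; exact: measurable_cell. Qed.

Lemma cell_ball h n x : cell h n x -> ball (net n) h x.
Proof. by case. Qed.

Lemma cell_cover h x : 0 < h -> exists n, cell h n x.
Proof.
move=> h0.
have [q [q1 q2]] := rat_ball_dense (lexx 1) (ball_open x h) (ballxx x h0).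
rewrite mul1r in q2.
have : (\bigcup_n net_ball h n) x.
  exists (pickle q.1) => //; rewrite /net_ball /net pickleK; apply: ball_sym; apply: q2.
  by apply: ballxx; rewrite invr_gt0.
by rewrite seqDU_bigcup_eq => -[n _]; exists n.
Qed.

Lemma cell_inj h n m x : cell h n x -> cell h m x -> n = m.
Proof.
by move=> nx mx; apply: (@trivIset_seqDU _ (net_ball h) n m) => //; exists x.
Qed.

Lemma cellsP h chi n x : cell h n x -> cells h chi x <-> chi n.
Proof.
by move=> nx; split => [[m cm /(cell_inj nx) ->]|cn]//; exists n.
Qed.

(** The vote is taken in the whole ball and not in the cell: a cell may have arbitrarily small
    volume, whereas the ball has volume (2h)^N and lies within 2h of every point of the cell. *)
Definition majority E h : set nat :=
  [set n | ((2 * h) ^+ N / 2)%:E <= mu (E `&` net_ball h n)]%E.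

Definition inner C d : set 'rV[R]_N := [set x | ball x d `<=` interior C].

Lemma measurable_inner C d : measurable (inner C d).
Proof.
apply: closed_rV_measurable; rewrite -[inner C d]setCK; apply: open_closedC.
rewrite openE => x /existsNP[y /not_implyP[xy Cy]].
have : nbhs x (ball y d).
  by apply: open_nbhs_nbhs; split; [exact: ball_open|exact: ball_sym].
apply: filterS => z yz Hz; apply: Cy; apply: Hz; exact: ball_sym.
Qed.

Lemma inner_sub C d : 0 < d -> inner C d `<=` interior C.
Proof. by move=> d0 x; apply; exact: ballxx. Qed.

Lemma inner_homo C d d' : d <= d' -> inner C d' `<=` inner C d.
Proof. by move=> dd x Hx; apply: subset_trans Hx; exact: le_ball. Qed.

(** A point where [E] disagrees with the vote of its cell sees at least (2h)^N / 2 of the opposite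
    side within 2h. Each of the two nonlocal estimates at scale 2h then contributes 4 2^N L p h; the
    inner set ensures that the voting balls stay in the interior of [C]. *)
Lemma majority_diff C E p h : convex_interior C -> perim_le C E p -> measurable E -> 0 < h ->
  (mu ((E `+` cells h (majority E h)) `&` inner C (2 * h)) <=
    (8 * 2 ^+ N * L * p * h)%:E)%E.
Proof.
move=> cI pE mE h0; set V := cells _ _; set O := inner _ _.
have mV : measurable V := measurable_cells _ _.
have mO : measurable O := measurable_inner _ _.
have d0 : 0 < 2 * h by rewrite mulr_gt0.
have c0 : 0 < (2 * h) ^+ N / 2 by rewrite divr_gt0// exprn_gt0.
have mB n : measurable (net_ball h n) by mset.
have mI := measurable_interior C.
have near n x : cell h n x -> net_ball h n `<=` ball x (2 * h).
  move=> nx y ny; rewrite mulr_natl mulr2n.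
  by apply: ball_triangle ny; apply: ball_sym; exact: cell_ball nx.
have cst S : ((((2 * h) ^+ N / 2)%:E * mu S <= ((2 * (2 * h)) ^+ N * (L * (2 * h) * p))%:E)%E) ->
    (mu S <= (4 * 2 ^+ N * L * p * h)%:E)%E.
  rewrite muleC -lee_pdivlMr// -EFinM; move=> /le_trans; apply; rewrite lee_fin.
  apply: le_of_eq; rewrite !exprMn; field.
  by rewrite !gt_eqF// exprn_gt0.
have -> : 8 * 2 ^+ N * L * p * h = 4 * 2 ^+ N * L * p * h + 4 * 2 ^+ N * L * p * h by ring.
have m1 : measurable ((E `\` V) `&` O) by mset.
have m2 : measurable ((V `\` E) `&` O) by mset.
have -> : (E `+` V) `&` O = ((E `\` V) `&` O) `|` ((V `\` E) `&` O) by rewrite -setIUl.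
rewrite EFinD; apply: le_trans (mu_setU m1 m2) _; apply: leeD; apply: cst.
  apply: (nonlocal_out cI pE mE m1 _ d0 (ltW c0)).
    by move=> x [[Ex _] Ox]; split => //; exact: inner_sub Ox.
  move=> x [[Ex Vx] Ox]; have [n nx] := cell_cover x h0.
  have /negP : ~ majority E h n by move=> /(cellsP _ nx).
  rewrite -ltNge => Hn.
  have mEn : measurable (E `&` net_ball h n) by mset.
  have mNn : measurable (net_ball h n `\` E) by mset.
  have Hs : (((2 * h) ^+ N)%:E <= mu (net_ball h n `\` E) + mu (E `&` net_ball h n))%E.
    rewrite -(borel_lebesgue_ball (net n) h0); apply: le_trans (mu_setU mNn mEn).
    apply: mu_le; [exact: mB|mset|].
    by move=> y ny; have [Ey|Ey] := pselect (E y); [right|left].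
  have H1 : (((2 * h) ^+ N / 2)%:E <= mu (net_ball h n `\` E))%E.
    have := le_trans Hs (leeD2l _ (ltW Hn)).
    by rewrite -leeBlDr// -EFinB; congr (_ <= _)%E; congr EFin; lra.
  apply: (le_trans H1); apply: mu_le => //.
    mset.
  by move=> y [ny Ey]; have yx := near n x nx y ny; split => //; split => //; exact: Ox.
apply: (nonlocal_in cI pE mE m2 _ d0 (ltW c0)).
  by move=> x [[_ Ex] Ox]; split => //; exact: inner_sub Ox.
move=> x [[[n Hn nx] _] Ox]; apply: (le_trans Hn); apply: mu_le; [mset|mset|].
by move=> y [Ey ny]; have yx := near n x nx y ny; split => //; split => //; exact: Ox.
Qed.

Section sequence.
Variables (C : set 'rV[R]_N) (p : R) (E : nat -> set 'rV[R]_N).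
Hypotheses (cI : convex_interior C) (bC : mu (C `\` interior C) = 0%E) (mC : measurable C).
Hypotheses (mE : forall k, measurable (E k)) (EC : forall k, E k `<=` C).
Hypotheses (pE : forall k, perim_le C (E k) p).

Let hj (j : nat) : R := 2^-1 ^+ j.
Let hj0 j : 0 < hj j. Proof. by rewrite exprn_gt0// invr_gt0. Qed.
Let G k j := majority (E k) (hj j).
Let a : R := 8 * 2 ^+ N * L * p + 1.
Let a0 : 0 < a.
Proof.
rewrite ltr_wpDl// !mulr_ge0 ?exprn_ge0//; exact: perim_le_ge0 (pE 0%N).
Qed.
Let Om j := inner C (2 * hj j).
Let mOm j : measurable (Om j). Proof. exact: measurable_inner. Qed.
Let Om_homo j l : (j <= l)%N -> Om j `<=` Om l.
Proof.
move=> jl; apply: inner_homo; rewrite ler_pM2l// ler_wiXn2l//.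
by rewrite invf_le1// ler1n.
Qed.
Let Br r : set 'rV[R]_N := ball 0 r.
Let mBr r : measurable (Br r). Proof. mset. Qed.

(* The majority colourings at all scales converge along an ultrafilter. *)
Variable U : set_system nat.
Hypotheses (UU : UltraFilter U) (Uoo : \oo `<=` U).

Let chi j : set nat := [set n | U [set k | G k j n]].
Let V j := cells (hj j) (chi j).
Let mV j : measurable (V j). Proof. exact: measurable_cells. Qed.

Lemma color_eventually j n : U [set k | G k j n <-> chi j n].
Proof.
have [H|H] := in_ultra_setVsetC [set k | G k j n] UU.
  by apply: filterS (H) => k Gk; split => _; [exact: H|exact: Gk].
apply: filterS (H) => k Gk; split => [/Gk//|cn]; exfalso.
by have [m [H1 H2]] := filter_ex (filterI cn H).
Qed.

(** Up to volume [e], finitely many cells fill the ball, and the filter is closed under finite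
    intersections. *)
Lemma near_color j r e : 0 < e ->
  U [set k | (mu ((cells (hj j) (G k j) `+` V j) `&` Br r) <= e%:E)%E].
Proof.
move=> e0; pose P n := cell (hj j) n `&` Br r.
have mP n : measurable (P n) by apply: measurableI => //; exact: measurable_cell.
have Pfin : (mu (\bigcup_n P n) < +oo)%E.
  apply: (@mu_bounded_fin _ _ _ 0 r); first by move=> x [n _ []].
  exact: bigcup_measurable.
have [n0 Hn0] := @bigcup_exhaust _ _ R mu P e mP Pfin e0.
have H : U [set k | forall n, (n < n0)%N -> G k j n <-> chi j n].
  elim: n0 {Hn0} => [|m IH]; first by apply: filterS filterT => k _ n.
  apply: filterS (filterI IH (color_eventually j m)) => k [H1 H2] n.
  by rewrite ltnS leq_eqVlt => /orP[/eqP ->|/H1].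
apply: filterS H => k Hk /=; apply: le_trans Hn0; apply: le_measure; rewrite ?inE.
- apply: measurableI => //; apply: measurable_symdiff => //; exact: measurable_cells.
- apply: measurableD; first exact: bigcup_measurable.
  by apply: bigsetU_measurable => i _; exact: mP.
move=> x [Hx Bx]; have [n nx] := cell_cover x (hj0 j).
split; first by exists n.
rewrite -bigcup_mkord => -[m /= mn [mx _]]; have nm := cell_inj nx mx; subst m.
have H1 := Hk n mn; have H2 := cellsP (G k j) nx; have H3 := cellsP (chi j) nx.
move: Hx; rewrite -/(V j) in H3 * => -[[/H2 ? /H3]|[/H3 ? /H2]]; tauto.
Qed.

Lemma near_V j r : U [set k | (mu ((E k `+` V j) `&` Om j `&` Br r) <= (a * hj j)%:E)%E].
Proof.
apply: filterS (near_color j r (hj0 j)) => k /= Hk.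
have mcol : measurable (cells (hj j) (G k j)) by exact: measurable_cells.
rewrite -setIA /a mulrDl mul1r EFinD.
apply: (le_trans (@mu_symdiff_trans _ (cells (hj j) (G k j)) _ _ (Om j) (Br r) _ _ _ _ _ _ _ _));
  try mset.
by apply: leeD => //; exact: majority_diff.
Qed.

(** Both limit colourings are close to a common [E k], because two sets of the ultrafilter meet. *)
Lemma V_cauchy j r :
  (mu ((V j `+` V j.+1) `&` Om j `&` Br r) <= (2 * a * hj j)%:E)%E.
Proof.
have [k [/= H1 H2]] := filter_ex (filterI (near_V j r) (near_V j.+1 r)).
rewrite -setIA; rewrite setYC -setIA in H1; rewrite -setIA in H2.
apply: (le_trans (@mu_symdiff_trans _ (E k) _ _ (Om j `&` Br r) (Om j.+1 `&` Br r)
  _ _ _ _ _ _ _ _)); try mset.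
  by apply: setSI; exact: (Om_homo (leqnSn j)).
apply: (le_trans (leeD H1 H2)).
rewrite -EFinD lee_fin /hj exprS.
have : 0 <= a * 2^-1 ^+ j by rewrite mulr_ge0 ?exprn_ge0 ?invr_ge0// ltW.
by move: (2^-1 ^+ j) => u; lra.
Qed.

(** The lower limit of the sets [V j]; their successive differences have geometrically decreasing
    volume on bounded parts of the inner sets. *)
Definition limit_set := interior C `&` \bigcup_n \bigcap_i V (n + i)%N.

Lemma measurable_limit : measurable limit_set.
Proof.
apply: measurableI; first exact: measurable_interior.
by apply: bigcup_measurable => n _; apply: bigcapT_measurable => i; exact: mV.
Qed.

(** Off the union of the later differences, membership in [V (j + i)] is constant in i and hence
    agrees with membership in the limit. *)
Lemma limit_V j r :
  (mu ((limit_set `+` V j) `&` Om j `&` Br r) <= (4 * a * hj j)%:E)%E.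
Proof.
pose W i := (V (j + i)%N `+` V (j + i).+1) `&` Om (j + i)%N `&` Br r.
have mW i : measurable (W i) by mset.
apply: (@le_trans _ _ (mu (\bigcup_i W i))).
  apply: le_measure; rewrite ?inE.
  - apply: measurableI => //; apply: measurableI => //; apply: measurable_symdiff => //.
    exact: measurable_limit.
  - exact: bigcup_measurable.
  move=> x [[Hx Ox] Bx]; apply: contrapT => HW.
  have const i : V (j + i)%N x <-> V j x.
    elim: i => [|i IH]; first by rewrite addn0.
    rewrite -IH addnS; apply: contrapT => Hi; apply: HW; exists i => //.
    split => //; split; last by apply: Om_homo Ox; exact: leq_addr.
    have [H1|H1] := pselect (V (j + i)%N x); have [H2|H2] := pselect (V (j + i).+1 x).
    - by exfalso; apply: Hi.
    - by left.
    - by right.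
    - by exfalso; apply: Hi.
  have Ix : interior C x by apply: inner_sub Ox; rewrite mulr_gt0.
  case: Hx => [[[_ [n _ Hn]] Vx]|[Vx []]].
    by apply: Vx; have := Hn j Logic.I; rewrite addnC => /(const n).
  by split => //; exists j => // i _; apply/const.
have -> : 4 * a * hj j = 2 * (2 * a * hj j) by ring.
apply: geometric_bigcup => //; first by rewrite !mulr_ge0 ?ltW.
move=> i; apply: le_trans (V_cauchy _ _) _.
by rewrite lee_fin /hj exprD mulrA.
Qed.

Lemma limit_near j r :
  U [set k | (mu ((E k `+` limit_set) `&` Om j `&` Br r) <= (5 * a * hj j)%:E)%E].
Proof.
apply: filterS (near_V j r) => k /= H1; have H2 := limit_V j r.
have mA := measurable_limit.
rewrite -setIA in H1; rewrite setYC -setIA in H2; rewrite -setIA.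
apply: (le_trans (@mu_symdiff_trans _ (V j) _ _ (Om j `&` Br r) (Om j `&` Br r)
  _ _ _ _ _ _ _ _)); try mset.
apply: (le_trans (leeD H1 H2)).
by rewrite -EFinD lee_fin; move: (a * hj j) (mulrA 4 a (hj j)) (mulrA 5 a (hj j)) => u <- <-; lra.
Qed.

(** In a ball, the inner sets exhaust the interior of [C] up to small volume, and the boundary is
    null. Sets of the ultrafilter meet every tail, whence an index beyond [K]. *)
Lemma limit_frequently r e (K : nat) : 0 < e ->
  exists2 k, (K <= k)%N & (mu ((E k `+` limit_set) `&` Br r) <= e%:E)%E.
Proof.
move=> e0; have mA := measurable_limit; have mI := measurable_interior C.
have e2 : 0 < e / 2 by rewrite divr_gt0.
pose B j := interior C `&` Br r `&` Om j.
have mB j : measurable (B j) by mset.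
have UB : \bigcup_j B j = interior C `&` Br r.
  apply/seteqP; split => x; first by move=> [j _ []].
  move=> [Ix Bx].
  have /nbhs_ballP[d /= d0 Hd] : nbhs x (interior C).
    by apply: open_nbhs_nbhs; split => //; exact: open_interior.
  have [j Hj] : exists j, 2 * hj j <= d.
    have cv : (fun j => 2 * hj j) @ \oo --> (0 : R).
      rewrite -[X in _ --> X](mulr0 2); apply: cvgM; first exact: cvg_cst.
      by apply: cvg_expr; rewrite ger0_norm ?invr_ge0// invf_lt1// ltr1n.
    have : \forall j \near \oo, 2 * hj j < d by move/cvgr_lt : cv; apply.
    by move=> [j _ Hj]; exists j; apply: ltW; apply: Hj => /=.
  by exists j => //; split => //; apply: subset_trans Hd; exact: le_ball.
have Bfin : (mu (\bigcup_j B j) < +oo)%E.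
  apply: (@mu_bounded_fin _ _ _ 0 r); first by move=> x [n _ [[]]].
  exact: bigcup_measurable.
have [n Hn] := @bigcup_exhaust _ _ R mu B (e / 2) mB Bfin e2.
have [m Hm] : exists m, 5 * a * hj m <= e / 2.
  have cv : (fun j => 5 * a * hj j) @ \oo --> (0 : R).
    rewrite -[X in _ --> X](mulr0 (5 * a)); apply: cvgM; first exact: cvg_cst.
    by apply: cvg_expr; rewrite ger0_norm ?invr_ge0// invf_lt1// ltr1n.
  have : \forall j \near \oo, 5 * a * hj j < e / 2 by move/cvgr_lt : cv; apply.
  by move=> [j _ Hj]; exists j; apply: ltW; apply: Hj => /=.
pose j := maxn n m.
have hjm : hj j <= hj m.
  by rewrite ler_wiXn2l ?invr_ge0// ?invf_le1// ?ler1n// leq_maxr.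
have UK : U [set k | (K <= k)%N] by apply: Uoo; exact: nbhs_infty_ge.
have [k [/= kK Hk]] := filter_ex (filterI UK (limit_near j r)).
exists k => //.
set S := _ `&` _ in Hk.
have mS : measurable S by mset.
set T := _ `\` _ in Hn.
have mT : measurable T.
  apply: measurableD; first exact: bigcup_measurable.
  by apply: bigsetU_measurable => i _; exact: mB.
have mD : measurable (C `\` interior C) by mset.
apply: (@le_trans _ _ (mu ((S `|` T) `|` (C `\` interior C)))).
  apply: mu_le; [mset|mset|].
  move=> x [Hx Bx]; have Cx : C x.
    by case: Hx => -[]; [move=> /EC|move=> [/interior_subset]].
  have [Ix|Ix] := pselect (interior C x); last by right.
  left; have [Ox|Ox] := pselect (Om j x); [by left|right].
  rewrite /T UB; split => //; rewrite -bigcup_mkord => -[i /= i_n [_ Oi]].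
  by apply: Ox; apply: Om_homo Oi; exact: leq_trans (ltnW i_n) (leq_maxl _ _).
have mST : measurable (S `|` T) by mset.
apply: (le_trans (mu_setU mST mD)).
have -> : (mu (S `|` T) + mu (C `\` interior C) = mu (S `|` T))%E.
  by rewrite -[RHS]adde0; congr (_ + _)%E; exact: bC.
apply: (le_trans (mu_setU mS mT)); apply: (le_trans (leeD Hk Hn)).
rewrite -EFinD lee_fin [leRHS](splitr e) lerD2r; apply: le_trans Hm.
by rewrite ler_wpM2l// mulr_ge0// ltW.
Qed.

End sequence.

(** Convergence in L^1_loc of a subsequence, stated as good indices beyond any [K] for each radius
    and precision; in this form it passes volumes and fluxes to the limit. *)
Lemma compactness C p (E : nat -> set 'rV[R]_N) : convex_interior C ->
  mu (C `\` interior C) = 0%E -> measurable C -> (forall k, measurable (E k)) ->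
  (forall k, E k `<=` C) -> (forall k, perim_le C (E k) p) ->
  exists A, [/\ measurable A, A `<=` C & forall r e (K : nat), 0 < e ->
    exists2 k, (K <= k)%N & (mu ((E k `+` A) `&` ball 0%R r) <= e%:E)%E].
Proof.
move=> cI bC mC mE EC pE.
have [U [UU Uoo]] := @ultraFilterLemma nat \oo _.
exists (limit_set C E U); split.
- exact: measurable_limit.
- by move=> x [/interior_subset].
- by move=> r e K e0; exact: (limit_frequently cI bC mC mE EC pE UU Uoo).
Qed.

(** * Existence *)

(** The integral is invariant under translation, so the first-order term of a small translation is
    bounded by the quadratic error. Being valid for -v too, the inequality expresses the divergence
    theorem. *)
Lemma intg_derive_le0 (phi : 'rV[R]_N -> R) K v : is_Ck 2 phi -> compact K ->
  (forall x, ~ K x -> phi x = 0) -> intg setT (fun x => 'D_v phi x) <= 0.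
Proof.
move=> sphi cK phi0; have clK : closed K by apply: compact_closed.
have sphi1 := is_CkW sphi; have sphi0 := is_CkW sphi1.
have [dphi _] := sphi1.
have [M M0 HM] := second_derive_bounded v sphi cK phi0.
have [r0 r00 Kr0] := compact_ball cK.
pose r := r0 + `|v|; pose S : set 'rV[R]_N := ball 0 r.
have mS : measurable S by mset.
have bS : bcs \1_S by exact: (@bcs_indic _ _ _ r).
have bphi : bcs phi by exact: bcs_continuous sphi0 cK phi0.
have bD w : bcs (fun x => 'D_w phi x).
  apply: (bcs_continuous _ cK); first exact: (is_Ck_derive w sphi1).
  by move=> x Kx; apply: (@derive_off_support _ _ phi K).
have Nv : intg setT (fun x => 'D_v phi x) = - intg setT (fun x => 'D_(- v) phi x).
  rewrite -mulN1r -intgZ//; congr intg; apply/funext => x.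
  by rewrite derive_oppv// mulN1r opprK.
rewrite Nv oppr_le0; apply/ler_addgt0Pr => e' e'0.
pose V := fine (mu S).
have V0 : 0 <= V by exact: fine_ge0.
have [e e0 [e1 He]] : exists2 e : R, 0 < e & e <= 1 /\ M * e * V <= e'.
  exists (Num.min 1 (e' / (M * V + 1))).
    by rewrite lt_min ltr01 divr_gt0// ltr_wpDl// mulr_ge0.
  split; first by rewrite ge_min lexx.
  have M1 : 0 < M * V + 1 by rewrite ltr_wpDl// mulr_ge0.
  rewrite mulrAC; apply: (@le_trans _ _ (M * V * (e' / (M * V + 1)))).
    by apply: ler_wpM2l; [exact: mulr_ge0|rewrite ge_min lexx orbT].
  by rewrite mulrA ler_pdivrMr// mulrC ler_wpM2l ?(ltW e'0)// lerDl.
have bs : bcs (fun x => phi (x + e *: v)).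
  rewrite (_ : (fun x => _) = phi \o aff (const_mx 1) (e *: v)).
    by apply: bcs_aff => // i; rewrite mxE.
  by rewrite aff1_scale.
have Es : intg setT (fun x => phi (x + e *: v)) = intg setT phi.
  rewrite (_ : (fun x => _) = phi \o aff (const_mx 1) (e *: v)); last by rewrite aff1_scale.
  rewrite -[X in intg X _](preimage_setT (aff (const_mx 1) (e *: v))) intg_aff//.
    by rewrite big1 ?mul1r// => i _; rewrite mxE invr1.
  by move=> i; rewrite mxE.
have H : intg setT (phi \- (fun x => phi (x + e *: v))) <=
    intg setT ((fun x => e * 'D_(- v) phi x) \+ (fun x => (M * e ^+ 2) * \1_S x)).
  apply: le_intg => //; [exact: bcsB|by apply: bcsD; exact: bcsZ|].
  move=> x _ /=; rewrite indicE.
  have [Bx|Bx] := boolP (x \in S).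
    have -> : M * e ^+ 2 * (true%:R : R) = M * e ^+ 2 by rewrite mulr1n mulr1.
    exact: (second_order_le x sphi HM (ltW e0)).
  have nS : ~ S x by move=> /mem_set; rewrite (negbTE Bx).
  have nK u : 0 <= u <= 1 -> ~ K (x + u *: v).
    move=> /andP[u0 u1] /Kr0 Hx; apply: nS; move: Hx.
    rewrite /S -!ball_normE /= !sub0r !normrN => Hx.
    rewrite -[x](addrK (u *: v)) (le_lt_trans (ler_normB _ _))//.
    by rewrite ltr_leD// normrZ ger0_norm// ler_piMl.
  have nKx : ~ K x by have := nK 0; rewrite scale0r addr0 lexx ler01; apply.
  have -> : M * e ^+ 2 * (false%:R : R) = 0 by rewrite mulr0n mulr0.
  rewrite (phi0 x)// (phi0 (x + e *: v)); last by apply: nK; rewrite (ltW e0).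
  by rewrite (@derive_off_support _ _ phi K)// subrr mulr0 addr0.
move: H; rewrite intgB// Es subrr intgD//; [|exact: bcsZ|exact: bcsZ].
rewrite intgZ// intgZ// (intg_indic mS (r := r))// setIT -/V => H.
rewrite -(ler_pM2l e0); move: H He; move: (intg _ _) => I H He.
rewrite mulr0 mulrDr; apply: (le_trans H); rewrite lerD2l.
have -> : M * e ^+ 2 * V = e * (M * e * V) by ring.
by rewrite ler_pM2l.
Qed.

Lemma intg_sum (I : Type) (s : seq I) (f : I -> 'rV[R]_N -> R) : (forall i, bcs (f i)) ->
  intg setT (fun x => \sum_(i <- s) f i x) = \sum_(i <- s) intg setT (f i).
Proof.
move=> bf.
have : bcs (fun x => \sum_(i <- s) f i x) /\
  intg setT (fun x => \sum_(i <- s) f i x) = \sum_(i <- s) intg setT (f i).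
  elim: s => [|i s [b1 IH]].
    have -> : (fun x => \sum_(i <- [::]) f i x) = cst 0.
      by apply/funext => x; rewrite big_nil.
    split; first exact: bcs0.
    by rewrite big_nil /intg /Rintegral integral0_eq.
  have -> : (fun x => \sum_(i <- i :: s) f i x) = f i \+ (fun x => \sum_(i <- s) f i x).
    by apply/funext => x; rewrite big_cons.
  by split; [exact: bcsD|rewrite intgD// IH big_cons].
by case.
Qed.

(** Test fields have compact support in the interior of [C], so the divergence theorem applies.
    Cutting [C] itself then produces sets of finite perimeter. *)
Lemma perim_le_self C : perim_le C C 0.
Proof.
move=> xi txi; have [sxi cK KC _] := txi.
have -> : intg C (divergence xi) = intg setT (divergence xi).
  rewrite intg_mkcond; congr intg; apply/funext => x; rewrite indicE.
  have [Kx|Kx] := pselect (field_support xi x).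
    by rewrite mem_set ?mulr1//; apply: interior_subset; exact: KC.
  by rewrite (divergence_off_support txi Kx) mul0r.
rewrite intg_sum; last first.
  move=> i; apply: (bcs_continuous _ cK).
    by have [_] := sxi i 1%N; exact.
  move=> x Kx; rewrite /partial; apply: (derive_off_support (K := field_support xi)) => //.
    exact: closed_closure.
  by move=> y Ky; exact: (test_field_coord0 i txi).
apply: sumr_le0 => i _; apply: (intg_derive_le0 _ (sxi i 2%N) cK) => x Kx.
exact: (test_field_coord0 i txi).
Qed.

Lemma intg_symdiff A E S f (M r : R) : measurable A -> measurable E -> measurable S ->
  S `<=` ball 0 r -> bcs f -> 0 <= M -> (forall x, `|f x| <= M) ->
  (forall x, ~ S x -> f x = 0) ->
  `|intg E f - intg A f| <= M * fine (mu ((E `+` A) `&` S)).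
Proof.
move=> mA mE mS Sr bf M0 HM f0.
have mEA : measurable ((E `+` A) `&` S) by mset.
have b1 := bcs_restr bf mE; have b2 := bcs_restr bf mA.
have -> : intg E f - intg A f =
    intg setT ((fun x => f x * \1_E x) \- (fun x => f x * \1_A x)).
  by rewrite intgB// -!intg_mkcond.
rewrite -[X in fine (mu X)](setTI ((E `+` A) `&` S)).
apply: (@intg_bound _ _ _ _ _ _ r) => //.
- by move=> x [_ /Sr].
- exact: bcsB.
move=> x _ /=; rewrite !indicE.
have [Sx|Sx] := pselect (S x); last first.
  by rewrite f0// !mul0r subrr normr0 mulr_ge0// ler0n.
have [Ex|Ex] := pselect (E x); have [Ax|Ax] := pselect (A x).
- by rewrite (mem_set Ex) (mem_set Ax) subrr normr0 mulr_ge0// ler0n.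
- rewrite (mem_set Ex) (memNset Ax) /= mulr1 mulr0 subr0 mem_set ?mulr1//.
  by split => //; left.
- rewrite (memNset Ex) (mem_set Ax) /= mulr1 mulr0 sub0r normrN mem_set ?mulr1//.
  by split => //; right.
- by rewrite (memNset Ex) (memNset Ax) subrr normr0 mulr_ge0// ler0n.
Qed.

Definition competitor C (v p : R) E :=
  [/\ measurable E, E `<=` C, mu E = v%:E & perim_le C E p].

Section domain.
Variables (C : set 'rV[R]_N) (i0 : 'I_N) (k r0 D : R).
Hypothesis gC : good_domain C i0 k r0 D.

Lemma competitor_stretch (w v p : R) E : 0 < w -> w <= v -> competitor C w p E ->
  exists F, competitor C v (v / w * p) F.
Proof.
move=> w0 wv [mE EC vE pE]; have v0 : 0 < v by exact: lt_le_trans wv.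
pose d : 'rV[R]_N := \row_i (if i == i0 then w / v else 1).
have d01 i : 0 < d ord0 i <= 1.
  rewrite mxE; case: ifP => _; last by rewrite ltr01 lexx.
  by rewrite divr_gt0// ler_pdivrMr// mul1r.
have d0 i : 0 < d ord0 i by case/andP: (d01 i).
have prod_d : \prod_i (d ord0 i)^-1 = v / w.
  rewrite (bigD1 i0)//= big1 ?mulr1.
    by rewrite mxE eqxx invf_div.
  by move=> i /negbTE i_i0; rewrite mxE i_i0 invr1.
have affE x : aff d 0 x = x + ((w / v - 1) * x ord0 i0) *: delta_mx ord0 i0.
  apply/rowP => i; rewrite !mxE eqxx /=; have [->|_] := eqVneq i i0.
    by rewrite addr0 mulr1 mulrBl mul1r addrC subrK.
  by rewrite mul1r mulr0 !addr0.
exists (aff d 0 @^-1` E); split.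
- by rewrite -[X in measurable X]setTI; exact: measurable_aff.
- move=> x /EC; rewrite affE => /(gd_line gC (- ((w / v - 1) * x ord0 i0))).
  by rewrite scaleNr addrK.
- by rewrite borel_lebesgue_affine// prod_d vE -EFinM divfK// gt_eqF.
- rewrite -prod_d; apply: stretch_le => //.
  by move=> x Cx; rewrite affE; exact: (gd_line gC).
Qed.

(** A small ball cut out of [C] has finite perimeter and positive volume at most [v]; stretching it
    brings the volume to [v]. *)
Lemma competitor_exists (v : R) : 0 < v -> exists p E, competitor C v p E.
Proof.
move=> v0; have [z Iz] := gd_interior gC.
have mC := closed_rV_measurable (gd_closed gC).
have /nbhs_ballP[d /= d0 Hd] : nbhs z C by exact: Iz.
(* The ball of radius b lies in [C], and 2b <= 1 gives (2b)^N <= 2b <= v. *)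
pose b := Num.min d (Num.min 1 v / 2).
have b0 : 0 < b by rewrite lt_min d0 divr_gt0// lt_min ltr01.
have [A0 A00 HA] := @cut_constP R N.
have b20 : 0 <= b / 2 by rewrite divr_ge0// ltW.
have b2b : b / 2 < b by rewrite ltr_pdivrMr// ltr_pMr// ltr1n.
have [t [bt tb Ht]] := HA C C 0 z (b / 2) b (@perim_le_self C) mC b20 b2b.
have t0 : 0 < t by apply: lt_le_trans bt; rewrite divr_gt0.
set p := 0 + _ in Ht.
have mE : measurable (C `&` EB z t) by mset.
have pE : perim_le C (C `&` EB z t) p.
  move=> xi txi; have := Ht xi _ txi (test_field0 C).
  by rewrite divergence0 {2}/intg /Rintegral integral0_eq// addr0.
have fE := mu_EB_fin z t mC.
pose w := fine (mu (C `&` EB z t)).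
have wv : w <= v.
  rewrite -lee_fin fineK//; apply: (@le_trans _ _ (mu (ball z b))).
    apply: mu_le => //; first mset.
    by move=> x [_ /(EB_homo (ltW t0) tb) /(EB_ball b0)].
  rewrite borel_lebesgue_ball// lee_fin.
  have b1 : 2 * b <= Num.min 1 v.
    by rewrite mulrC -ler_pdivlMr// ge_min lexx orbT.
  have N0 : (0 < N)%N by exact: leq_ltn_trans (ltn_ord i0).
  apply: (@le_trans _ _ (2 * b)); last by apply: (le_trans b1); rewrite ge_min lexx orbT.
  rewrite -(prednK N0) exprS ler_piMr ?mulr_ge0 ?(ltW b0)//.
  by rewrite exprn_ile1 ?mulr_ge0 ?(ltW b0)// (le_trans b1)// ge_min lexx.
have w0 : 0 < w.
  have tL : 0 < t / L by rewrite divr_gt0.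
  apply: (@lt_le_trans _ _ ((2 * (t / L)) ^+ N)).
    by rewrite exprn_gt0// mulr_gt0.
  rewrite -lee_fin fineK// -(borel_lebesgue_ball z tL).
  apply: mu_le => //; first mset.
  move=> x Bx; have Ex := ball_EB t0 Bx; split => //; apply: Hd.
  have := EB_homo (ltW t0) tb Ex => /(EB_ball b0); apply: le_ball.
  by rewrite ge_min lexx.
have [F HF] := @competitor_stretch w v p (C `&` EB z t) w0 wv
   (And4 mE (@subIsetl _ _ _) (esym (fineK fE)) pE).
by exists (v / w * p), F.
Qed.

(* Some ball of fixed radius holds a definite part of the volume, by
   [small_density_bound]; [gd_shift] then moves its center near the origin. *)
Lemma competitor_concentrate (v q : R) : 0 < v -> 0 <= q ->
  exists2 c0 : R, 0 < c0 & exists r1 : R, forall p E, p <= q -> competitor C v p E ->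
  exists2 F, competitor C v p F & (c0%:E <= mu (F `&` ball 0%R r1))%E.
Proof.
move=> v0 q0; set A1 := reg_const k.
have A10 : 0 < A1 := reg_const_gt0 gC.
(* Chosen so that A1 r q < v, which contradicts [small_density_bound] if no ball of radius r holds
   half of the guaranteed volume. *)
pose r := Num.min r0 (v / (2 * A1 * (q + 1))).
have q1 : 0 < q + 1 by rewrite ltr_wpDl.
have A1q : 0 < 2 * A1 * (q + 1).
  by apply: mulr_gt0 => //; apply: mulr_gt0.
have rp : 0 < r by rewrite lt_min (gd_r0 gC) divr_gt0.
have rr : r <= r0 by rewrite ge_min lexx.
have rv : A1 * r * q < v.
  apply: (@le_lt_trans _ _ (A1 * (v / (2 * A1 * (q + 1))) * q)).
    by rewrite ler_wpM2r// ler_wpM2l ?(ltW A10)// ge_min lexx orbT.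
  have -> : A1 * (v / (2 * A1 * (q + 1))) * q = v * (q / (2 * (q + 1))).
    by field; rewrite !gt_eqF.
  rewrite gtr_pMr// ltr_pdivrMr ?mulr_gt0//; lra.
have k0 := gd_k0 gC.
exists ((2 * k) ^+ N * r ^+ N / 2); first by rewrite divr_gt0// mulr_gt0// exprn_gt0// mulr_gt0.
exists (D + r) => p E pq [mE EC vE pE].
have Efin : (mu E < +oo)%E by rewrite vE ltry.
have [x [Ix Hx]] : exists x, interior C x /\
    (((2 * k) ^+ N * r ^+ N / 2)%:E <= mu (E `&` ball x r))%E.
  apply: contrapT => Hn.
  have Hs x : interior C x -> (mu (E `&` ball x r) <= ((2 * k) ^+ N * r ^+ N / 2)%:E)%E.
    move=> Ix; rewrite leNgt; apply/negP => H; apply: Hn; exists x; split => //.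
    exact: ltW.
  have := small_density_bound gC pE mE EC Efin rp rr Hs.
  rewrite vE -/A1 => /=; apply/negP; rewrite -ltNge; apply: le_lt_trans rv.
  by rewrite ler_wpM2l// mulr_ge0// ltW.
have [u [uC xu]] := gd_shift gC (interior_subset Ix).
have affE y : aff (const_mx 1) (- u) y = y - u by rewrite aff1E.
have preE (S : set 'rV[R]_N) : aff (const_mx 1) (- u) @^-1` S = (fun y => y - u) @^-1` S.
  by apply/seteqP; split => y; rewrite /= affE.
have one : \prod_i ((const_mx 1 : 'rV[R]_N) ord0 i)^-1 = 1.
  by rewrite big1// => i _; rewrite mxE invr1.
exists ((fun y => y - u) @^-1` E).
  split.
  - exact: measurable_preshift.
  - by move=> y /EC /uC; rewrite subrK.
  - by rewrite borel_lebesgue_shift.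
  - have d01 i : 0 < (const_mx 1 : 'rV[R]_N) ord0 i <= 1 by rewrite mxE ltr01 lexx.
    have CS y : C y -> C (aff (const_mx 1) (- u) y).
      by move=> Cy; rewrite affE; apply/uC; rewrite subrK.
    by have := stretch_le d01 CS mE pE; rewrite one mul1r preE.
have mEx : measurable (E `&` ball x r) by mset.
apply: (le_trans Hx); rewrite -(borel_lebesgue_shift (- u) mEx); apply: mu_le.
- exact: measurable_preshift.
- by apply: measurableI; [exact: measurable_preshift|mset].
move=> y [Ey By]; split => //; apply: ball_triangle xu _; move: By.
by rewrite -!ball_normE /= opprB addrA.
Qed.

(** The linear bound on the profile. The case w = 0, where stretching is impossible, can occur when
    a cut leaves no volume outside. *)
Lemma competitor_scale (v i w p : R) E : 0 < v ->
  (forall q F, competitor C v q F -> i <= q) ->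
  0 <= w -> w <= v -> competitor C w p E -> w / v * i <= p.
Proof.
move=> v0 Hi w0 wv cE; have [w00|w00] := eqVneq w 0.
  by rewrite w00 !mul0r; have [_ _ _ /perim_le_ge0] := cE.
have {w00}w0 : 0 < w by rewrite lt_neqAle eq_sym w00.
have [F /Hi H] := competitor_stretch w0 wv cE.
rewrite -ler_pdivlMl ?divr_gt0//; apply: (le_trans H).
by rewrite invf_div.
Qed.

(** Stronger than lower semicontinuity, which would give only the bound i: cutting [E n] along a
    large sphere leaves outside a part of volume v - m whose perimeter is at least (v - m)/v times
    i. What remains for the inside is about (m/v) i, and m is at most about the volume of [A]. *)
Lemma limit_perimeter (v i : R) (E : nat -> set 'rV[R]_N) A : 0 < v -> 0 <= i ->
  (forall q F, competitor C v q F -> i <= q) ->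
  (forall n, competitor C v (i + n.+1%:R^-1) (E n)) ->
  measurable A -> (mu A < +oo)%E ->
  (forall r e (K : nat), 0 < e ->
    exists2 n, (K <= n)%N & (mu ((E n `+` A) `&` ball 0%R r) <= e%:E)%E) ->
  perim_le C A (fine (mu A) / v * i).
Proof.
move=> v0 ige0 Hi cE mA Afin HA xi txi.
have [A0 A00 HC] := @cut_constP R N.
have [_ cK _ _] := txi; have bdiv := bcs_divergence txi.
have [M M0 HM] := continuous_supp_bounded (divergence_continuous txi) cK
  (fun x => @divergence_off_support _ _ _ _ x txi).
have [rK rK0 HrK] := compact_ball cK.
set v1 := fine (mu A).
(* The three errors proportional to [e]: the volume m compared with that of [A], the excess 1/(n+1)
   of [E n] over the infimum, and the difference of the fluxes through [E n] and [A]. *)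
pose Q := i / v + 1 + M.
have iv0 : 0 <= i / v by rewrite divr_ge0// ltW.
have Q0 : 0 < Q by rewrite /Q ltr_wpDr// ltr_wpDl.
have key (j : nat) e : rK * L <= j%:R -> 0 < e ->
    intg A (divergence xi) <= v1 / v * i + A0 * v / j%:R + Q * e.
  move=> rj e0.
  have j0 : (0 : R) < j%:R by apply: lt_le_trans rj; rewrite mulr_gt0.
  have [r Hr] := EB_bounded (0 : 'rV[R]_N) (2 * j%:R).
  have [K HK] : exists K : nat, forall n, (K <= n)%N -> n.+1%:R^-1 <= e :> R.
    have /ltr_add_invr[K] := e0; rewrite add0r => HK; exists K => n Kn.
    apply: le_trans (ltW HK); rewrite lef_pV2 ?posrE// ler_nat; exact: Kn.
  have [n Kn Hn] := HA r e K e0.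
  have [mE EC vE pE] := cE n.
  have jj2 : j%:R < 2 * j%:R :> R by rewrite ltr_pMl// ltr1n.
  have [t [jt t2j Ht]] := HC C (E n) (i + n.+1%:R^-1) 0 j%:R (2 * j%:R) pE mE (ltW j0) jj2.
  have t0 : 0 < t by exact: lt_le_trans jt.
  have mEt : measurable (E n `&` EB 0 t) by mset.
  have mEc : measurable (E n `\` EB 0 t) by mset.
  have fEn : mu (E n) \is a fin_num by rewrite vE.
  pose m := fine (mu (E n `&` EB 0 t)).
  have m0 : 0 <= m by exact: fine_ge0.
  have mv : m <= v.
    by have := fine_mu_le mEt mE (@subIsetl _ _ _) fEn; rewrite vE.
  have mEcE : mu (E n `\` EB 0 t) = (v - m)%:E.
    rewrite measureD//; [|mset|by rewrite ltey_eq fEn].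
    by rewrite EFinB -vE /m fineK// mu_EB_fin.
  have m2 : fine (mu (E n `&` EB 0 (2 * j%:R))) <= v.
    have := @fine_mu_le (E n `&` EB 0 (2 * j%:R)) (E n) _ mE (@subIsetl _ _ _) fEn.
    by rewrite vE; apply; apply: measurableI => //; mset.
  set I := intg A _.
  pose I' := intg (E n `&` EB 0 t) (divergence xi).
  (* The inner field is fixed to xi; the outer one being arbitrary, the cut estimate is a perimeter
     bound for the outer part, to which the linear bound applies. *)
  have H1 : (v - m) / v * i <= i + n.+1%:R^-1 + A0 * v / j%:R - I'.
    apply: (@competitor_scale v i (v - m) _ (E n `\` EB 0 t)) => //.
    - by rewrite subr_ge0.
    - by rewrite gerBl.
    split => //; first by move=> x [/EC].
    move=> xi2 t2; have := Ht xi xi2 txi t2; rewrite -/I'.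
    have -> : 2 * j%:R - j%:R = j%:R :> R by ring.
    have : A0 * fine (mu (E n `&` EB 0 (2 * j%:R))) / j%:R <= A0 * v / j%:R.
      by rewrite ler_pM2r ?invr_gt0// ler_pM2l.
    by move=> h1 h2; rewrite lerBrDl; apply: (le_trans h2); rewrite lerD2l.
  have Hsub : fine (mu ((E n `&` EB 0 t `+` A) `&` EB 0 j%:R)) <= e.
    rewrite -lee_fin fineK; last by apply: mu_EB_fin; mset.
    apply: le_trans Hn; apply: mu_le.
    - mset.
    - mset.
    move=> x [Hx Bx]; have Bt := EB_homo (ltW j0) jt Bx.
    split; last by apply: Hr; exact: EB_homo (ltW t0) t2j x Bt.
    by case: Hx => -[]; [move=> [Ex _] Ax; left|move=> Ax Ex; right; split => // Enx; apply: Ex].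
  have H2 : `|I' - I| <= M * e.
    apply: (@le_trans _ _ (M * fine (mu ((E n `&` EB 0 t `+` A) `&` EB 0 j%:R)))).
      have [r' Hr'] := EB_bounded (0 : 'rV[R]_N) j%:R.
      apply: (@intg_symdiff _ _ _ _ _ r') => //; first mset.
      move=> x Bx; apply: (divergence_off_support txi) => Kx; apply: Bx.
      apply: ball_EB => //; apply: le_ball (HrK x Kx).
      by rewrite ler_pdivlMr.
    by rewrite ler_wpM2l.
  have H3 : m <= v1 + e.
    have mE1 : m%:E = mu (E n `&` EB 0 t) by rewrite /m fineK// mu_EB_fin.
    have v1E : v1%:E = mu A by rewrite /v1 fineK// ge0_fin_numE.
    rewrite -lee_fin EFinD mE1 v1E.
    apply: (@le_trans _ _ (mu (E n `&` ball 0 r))).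
      by apply: mu_le; [mset|mset|]; apply: setIS => x Bx; apply: Hr; exact: EB_homo (ltW t0) t2j x Bx.
    apply: le_trans (mu_cap_symdiff mE mA _) _; first mset.
    by apply: leeD2l; rewrite setYC.
  have H4 := HK n Kn.
  have H5 : m / v * i <= (v1 + e) / v * i by rewrite ler_wpM2r// ler_pM2r ?invr_gt0.
  have H6 : (v - m) / v * i = i - m / v * i by field; rewrite gt_eqF.
  have H7 : (v1 + e) / v * i = v1 / v * i + i / v * e by ring.
  move: H2; rewrite ler_norml => /andP[H2 _]; rewrite H6 in H1; rewrite H7 in H5.
  rewrite /Q; have -> : (i / v + 1 + M) * e = i / v * e + e + M * e by ring.
  move: (v1 / v * i) (m / v * i) (i / v * e) (M * e) (A0 * v / j%:R) (n.+1%:R^-1) I I' H1 H2 H4 H5.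
  by move=> u1 u2 u3 u4 u5 u6 u7 u8; lra.
apply/ler_addgt0Pr => e e0.
(* [J] is large enough for the ball to contain the support of xi and for the cutting error A0 v / J
   to be at most e/2. *)
pose J := Num.bound (Num.max (rK * L) (A0 * v / (e / 2))).
have HJ : Num.max (rK * L) (A0 * v / (e / 2)) < J%:R.
  by apply: archi_boundP; rewrite le_max mulr_ge0// ltW.
have [HJ1 HJ2] : rK * L <= J%:R /\ A0 * v / (e / 2) <= J%:R.
  by split; apply: le_trans (ltW HJ); rewrite le_max lexx ?orbT.
have J0 : (0 : R) < J%:R by apply: lt_le_trans HJ1; rewrite mulr_gt0.
have e2 : 0 < e / 2 by rewrite divr_gt0.
have eQ : 0 < e / 2 / Q by rewrite divr_gt0.
apply: (le_trans (key J _ HJ1 eQ)).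
rewrite -addrA lerD2l [leRHS](splitr e); apply: lerD.
  by rewrite ler_pdivrMr// [leRHS]mulrC -ler_pdivrMr.
by rewrite mulrC divfK// gt_eqF.
Qed.

Lemma minimizer_exists (v : R) : 0 < v -> exists i E, competitor C v i E /\
  forall q F, competitor C v q F -> i <= q.
Proof.
move=> v0; pose P := [set p : R | exists E, competitor C v p E].
have Pinf : has_inf P.
  split; first by have [p [E HE]] := competitor_exists v0; exists p, E.
  by exists 0 => p [E [_ _ _ /perim_le_ge0]].
pose i := inf P.
have Hi q F : competitor C v q F -> i <= q.
  by move=> HF; apply: (ge_inf Pinf.2); exists F.
have i0' : 0 <= i by apply: lb_le_inf; [exact: Pinf.1|move=> p [E [_ _ _ /perim_le_ge0]]].
have weaken p q E : p <= q -> competitor C v p E -> competitor C v q E.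
  by move=> pq [? ? ? pE]; split => // xi txi; apply: le_trans pq; exact: pE.
have [c0 c00 [r1 Hc]] := competitor_concentrate v0 (addr_ge0 i0' ler01).
have /boolp.choice[E HE] : forall n : nat, exists E, competitor C v (i + n.+1%:R^-1) E /\
    (c0%:E <= mu (E `&` ball 0%R r1))%E.
  move=> n; have n0 : (0 : R) < n.+1%:R^-1 by rewrite invr_gt0.
  have [p [E cE] pi] := inf_adherent n0 Pinf.
  have n1 : i + n.+1%:R^-1 <= i + 1 by rewrite lerD2l invf_le1// ler1n.
  by have [F cF HF] := Hc _ E n1 (weaken _ _ _ (ltW pi) cE); exists F.
have [A [mA AC HA]] : exists A, [/\ measurable A, A `<=` C & forall r e (K : nat), 0 < e ->
    exists2 n, (K <= n)%N & (mu ((E n `+` A) `&` ball 0%R r) <= e%:E)%E].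
  apply: (@compactness C (i + 1)).
  - exact: seg_convex_interior (gd_convex gC).
  - exact: boundary_null (gd_closed gC) (gd_convex gC) (gd_interior gC).
  - exact: closed_rV_measurable (gd_closed gC).
  - by move=> n; have [[]] := HE n.
  - by move=> n; have [[]] := HE n.
  move=> n xi txi; have [[_ _ _ pE] _] := HE n.
  by apply: (le_trans (pE xi txi)); rewrite lerD2l invf_le1// ler1n.
have Av : (mu A <= v%:E)%E.
  apply: le_mu_balls => // n; apply/lee_addgt0Pr => e e0.
  have [m _ Hm] := HA n%:R e 0%N e0; have [[mE EC vE _] _] := HE m.
  apply: le_trans (mu_cap_symdiff mA mE _) _; first mset.
  by apply: leeD Hm; exact: le_of_eq.
have Afin : (mu A < +oo)%E by apply: (le_lt_trans Av); exact: ltry.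
pose v1 := fine (mu A).
have v1E : mu A = v1%:E by rewrite /v1 fineK// ge0_fin_numE.
have v1v : v1 <= v by rewrite -lee_fin -v1E.
have v10 : 0 < v1.
  (* The competitors keep volume [c0] in a fixed ball; an approximation within c0/2 there leaves
     positive volume to the limit. *)
  have c02 : 0 < c0 / 2 by rewrite divr_gt0.
  have [m _ Hm] := HA r1 _ 0%N c02; have [[mE _ _ _] Hc'] := HE m.
  have : (c0%:E <= v1%:E + (c0 / 2)%:E)%E.
    apply: (le_trans Hc'); apply: le_trans (mu_cap_symdiff mE mA _) _; first mset.
    apply: leeD; last by rewrite setYC.
    exact: le_of_eq.
  rewrite -EFinD lee_fin; lra.
have cA : competitor C v1 (v1 / v * i) A.
  split => //; apply: (@limit_perimeter v i E) => //.
  by move=> n; have [] := HE n.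
have [F cF] := competitor_stretch v10 v1v cA.
exists i, F; split => //; move: cF; congr (competitor C v _ F).
by field; rewrite !gt_eqF.
Qed.

(** * From Borel competitors to isoperimetric regions *)

Lemma profile_le_competitor (v p : R) E : competitor C v p E ->
  (isoperimetric_profile C v%:E <= p%:E)%E.
Proof.
move=> [mE EC vE pE]; apply: (@le_trans _ _ (perimeter C E)).
  apply: ereal_inf_lbound; exists E => //; split => //.
    exact: lebesgue_of_borel.
  by rewrite volume_borel.
exact/perimeter_borel_leP.
Qed.

Lemma isoperimetric_region_exists (v : R) : 0 < v ->
  exists E, isoperimetric_region C E /\ volume E = v%:E.
Proof.
move=> v0; have [i [E [cE Hi]]] := minimizer_exists v0.
have [mE EC vE pE] := cE.
have volE : volume E = v%:E by rewrite volume_borel.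
exists E; split => //; split => //.
- exact: lebesgue_of_borel.
- by rewrite volE ltry.
apply/eqP; rewrite eq_le volE; apply/andP; split; last first.
  apply: ereal_inf_lbound; exists E => //; split => //.
  exact: lebesgue_of_borel.
apply: le_ereal_inf_tmp => _ [F [mF FC vF] <-].
apply: (@le_trans _ _ i%:E); first exact/perimeter_borel_leP.
(* The profile ranges over Lebesgue measurable sets; a Borel kernel has the same volume and the same
   perimeter. *)
have [A [mA AF F0]] := borel_kernel mF.
have := perimeter_ge0 C mF; case pF : (perimeter C F) => [q| |] // _; last exact: leey.
rewrite lee_fin; apply: (Hi q A); split => //.
- exact: subset_trans FC.
- by rewrite -vF (volume_kernel mA AF F0).
- by apply/(perimeter_leP C q mF mA AF F0); rewrite pF.
Qed.

Lemma isoperimetric_region_bounded E : isoperimetric_region C E ->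
  exists F, represents E F /\ bounded_set F.
Proof.
move=> [mE EC Efin isoE].
have [A [mA AE E0]] := borel_kernel mE.
have vA := volume_kernel mA AE E0.
have fA : mu A \is a fin_num by rewrite ge0_fin_numE// -vA.
pose v := fine (mu A).
have vAE : mu A = v%:E by rewrite fineK.
(* A region of volume zero is represented by the empty set. *)
have [v0|v0] := eqVneq v 0.
  exists set0; split; last by exists 0; split => // M _ x.
  split => //.
  - by rewrite setY0 vA vAE v0.
  - exact: closed0.
  - move=> x Hx; have : (0 : R) = 1.
      rewrite -(cvg_lim (@Rhausdorff R) Hx); apply/esym/lim_near_cst => //.
      by apply: nearW => s; rewrite set0I volume_borel// measure0 mul0r.
    by move/eqP; rewrite eq_sym oner_eq0.
  - by move=> x _ [].
have {}v0 : 0 < v by rewrite lt_neqAle eq_sym v0 /v fine_ge0.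
(* Any competitor shows that the profile, hence the perimeter of [E], is finite. *)
have [q [G cG]] := competitor_exists v0.
have PE : perimeter C E = isoperimetric_profile C v%:E by rewrite isoE vA vAE.
have := perimeter_ge0 C mE; case pE : (perimeter C E) => [p| |] // _; last first.
  by have := profile_le_competitor cG; rewrite -PE pE leNgt ltry.
have pA : perim_le C A p.
  by apply/(perimeter_leP C p mE mA AE E0); rewrite pE.
have p0 : 0 <= p := perim_le_ge0 pA.
have AC : A `<=` C by exact: subset_trans EC.
have Hp q' G' : competitor C v q' G' -> p <= q'.
  by move=> /profile_le_competitor; rewrite -PE pE lee_fin.
have Q0 : 0 <= p / v by rewrite divr_ge0// ltW.
(* The linear bound for [A \ F], of volume v - |F|, gives p (v - |F|)/v <= p', which is almost
   minimality with constant p/v. *)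
have mn : almost_min C A p (p / v).
  move=> F p' mF FA pF.
  have fF : fine (mu F) <= v by exact: fine_mu_le.
  have mAF : measurable (A `\` F) by mset.
  have AFE : mu (A `\` F) = (v - fine (mu F))%:E.
    have finF : mu F \is a fin_num.
      by rewrite ge0_fin_numE// (le_lt_trans (mu_le mF mA FA))// -ge0_fin_numE.
    rewrite measureD//; last by rewrite ltey_eq fA.
    by rewrite (setIidr FA) EFinB -vAE fineK.
  have cAF : competitor C (v - fine (mu F)) p' (A `\` F).
    by split => // x [/AC].
  have := competitor_scale v0 Hp (_ : 0 <= v - fine (mu F)) (_ : _ <= v) cAF.
  rewrite subr_ge0 => /(_ fF); rewrite gerBl fine_ge0// => /(_ isT) H.
  have E1 : p / v * fine (mu F) = p - (v - fine (mu F)) / v * p by field; rewrite gt_eqF.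
  by rewrite E1; move: H; set u := _ * p; lra.
have Afin : (mu A < +oo)%E by rewrite vAE ltry.
exists (msupp A); split.
  exact: (msupp_represents gC pA mA AC Q0 mn mE AE E0).
exact: (msupp_bounded gC pA mA AC Q0 Afin mn).
Qed.

End domain.
End convex_domain.

(** * Cylinders over a convex body *)

Section cylinder.
Context {R : realType} {m q : nat}.
Implicit Types (K : set 'rV[R]_m).

Lemma convex_body_seg K : convex_set (K : set (convex_lmodType 'rV[R]_m)) -> seg_convex K.
Proof.
move=> cK x y s Kx Ky /andP[s0 s1].
have := cK y x (Itv01 s0 s1) (mem_set Ky) (mem_set Kx).
move=> /set_mem H; have {}H : K (s *: y + (1 - s) *: x) by exact: H.
have -> : x + s *: (y - x) = s *: y + (1 - s) *: x; last by [].
by apply/rowP => i; rewrite !mxE; ring.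
Qed.

Lemma lsubmx_ball (x y : 'rV[R]_(m + q)) (e : R) : ball x e y -> ball (lsubmx x) e (lsubmx y).
Proof.
move=> xy; have e0 : 0 < e by case: xy.
apply/(rV_ballP _ _ e0) => i; rewrite !mxE.
by have /(rV_ballP _ _ e0) := xy; apply.
Qed.

(** Thickness comes from convexity: the homothety centered at the projection of x to the base, of
    ratio t, sends a fixed ball of [K] around [z0] to a ball of radius t rho near x. The axis is the
    first of the last [q] coordinates, and translating by minus the last [q] coordinates of x brings
    x to the base. *)
Lemma cylinder_good K : (1 <= q)%N -> convex_body K ->
  exists (i0 : 'I_(m + q)) (k r0 D : R), good_domain (cylinder q K) i0 k r0 D.
Proof.
move=> q1 [cK convK [z0 Iz0]].
have sK := convex_body_seg convK.
have clK : closed K by exact: compact_closed.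
have [B B0 KB] := compact_ball cK.
have /nbhs_ballP[rho /= rho0 Hrho] : nbhs z0 K by exact: Iz0.
have z0K : K z0 by apply: Hrho; exact: ballxx.
pose i0 : 'I_(m + q) := rshift m (Ordinal q1).
(* With t = r/r0, the shrunken ball has its center within 2 B t of x and radius t rho, so it lies
   within t (2B + rho) = r; this also gives k = rho/r0. *)
pose r0 := 2 * B + rho.
have r00 : 0 < r0 by rewrite addr_gt0// mulr_gt0.
exists i0, (rho / r0), r0, B; split => //.
- rewrite -[cylinder q K]setCK; apply: open_closedC; rewrite openE => x Kx.
  have /nbhs_ballP[e /= e0 He] : nbhs (lsubmx x) (~` K).
    by apply: open_nbhs_nbhs; split => //; exact: closed_openC.
  by apply/nbhs_ballP; exists e => // y /lsubmx_ball /He.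
- move=> x y s Cx Cy s01; rewrite /cylinder /=.
  have -> : lsubmx (x + s *: (y - x)) = lsubmx x + s *: (lsubmx y - lsubmx x).
    by apply/rowP => i; rewrite !mxE.
  exact: sK.
- exists (row_mx z0 0); apply/nbhs_ballP; exists rho => // y /lsubmx_ball.
  by rewrite row_mxKl => /Hrho.
- by rewrite divr_gt0.
- move=> x r Cx rp rr; pose t := r / r0.
  have t0 : 0 < t by rewrite divr_gt0.
  have t1 : t <= 1 by rewrite ler_pdivrMr// mul1r.
  pose a := lsubmx x; pose c : 'rV[R]_(m + q) := row_mx (a + t *: (z0 - a)) (rsubmx x).
  have -> : rho / r0 * r = t * rho by rewrite /t; ring.
  have tr0 : 0 < t * rho by rewrite mulr_gt0.
  have az : `|z0 - a| < 2 * B.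
    have := KB _ z0K; have := KB _ (Cx : K a); rewrite -!ball_normE /= !sub0r !normrN => h1 h2.
    by apply: (le_lt_trans (ler_normB _ _)); rewrite mulr_natl mulr2n ltrD.
  exists c => y cy; split.
    have xc : `|x - c| <= t * (2 * B).
      have tB : 0 <= t * (2 * B).
        by apply: mulr_ge0; [exact: ltW|apply: mulr_ge0 => //; exact: ltW].
      apply: rV_norm_leP => //.
      move=> i; rewrite /c; case: (split_ordP i) => j ->.
        have -> : (x - row_mx (a + t *: (z0 - a)) (rsubmx x)) ord0 (lshift q j) =
            - (t * (z0 - a) ord0 j).
          by rewrite mxE [X in _ + X]mxE row_mxEl /a !mxE; ring.
        rewrite normrN normrM gtr0_norm// ler_wpM2l ?(ltW t0)//.
        by apply: le_trans (ltW az); exact: rV_coord_le_norm.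
      by rewrite mxE [X in _ + X]mxE row_mxEr mxE subrr normr0.
    move: cy; rewrite -!ball_normE /= => cy.
    rewrite -(subrK c x) -addrA (le_lt_trans (ler_normD _ _))//.
    have -> : r = t * (2 * B) + t * rho by rewrite /t /r0 -mulrDr divfK// gt_eqF.
    exact: ler_ltD.
  have {}cy := lsubmx_ball cy; rewrite row_mxKl in cy.
  pose w := z0 + t^-1 *: (lsubmx y - (a + t *: (z0 - a))).
  have -> : cylinder q K y = K (a + t *: (w - a)).
    rewrite /cylinder /=; congr K; apply/rowP => i; rewrite !mxE; field.
    by rewrite gt_eqF.
  apply: sK => //; last by rewrite (ltW t0).
  apply: Hrho; move: cy; rewrite -!ball_normE /= => cy.
  have -> : z0 - w = t^-1 *: (a + t *: (z0 - a) - lsubmx y).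
    by apply/rowP => i; rewrite !mxE; ring.
  by rewrite normrZ gtr0_norm ?invr_gt0// mulrC ltr_pdivrMr// mulrC.
- move=> x t; rewrite /cylinder /=; congr K; apply/rowP => i.
  by rewrite !mxE eq_lrshift mulr0 addr0.
- move=> x Cx; exists (row_mx 0 (- rsubmx x)); split.
    by move=> y; rewrite /cylinder /= linearD /= row_mxKl addr0.
  apply/(rV_ballP _ _ B0) => i; case: (split_ordP i) => j ->.
    have /(rV_ballP _ _ B0) /(_ j) := KB _ (Cx : K (lsubmx x)).
    by rewrite [(x + _) _ _]mxE row_mxEl !mxE addr0.
  by rewrite [(x + _) _ _]mxE row_mxEr !mxE subrr subr0 normr0.
Qed.

End cylinder.

Theorem proposition3p2 (R : realType) (m q : nat) (K : set 'rV[R]_m)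
    (hm : (1 <= m)%N) (hq : (1 <= q)%N) (hK : convex_body K) :
  (forall v : R, 0 < v ->
     exists E : set 'rV[R]_(m + q),
       isoperimetric_region (cylinder q K) E /\ volume E = v%:E) /\
  (forall E : set 'rV[R]_(m + q), isoperimetric_region (cylinder q K) E ->
     exists F : set 'rV[R]_(m + q), represents E F /\ bounded_set F).
Proof.
have [i0 [k [r0 [D gC]]]] := cylinder_good hq hK.
split=> [v v0|E]; first exact: isoperimetric_region_exists gC v v0.
exact: (isoperimetric_region_bounded gC).
Qed.
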